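(* Let $X$ be an object in $\mathcal D^*(\mathcal A)$. 1. If $X\in\mathcal D^b(\mathcal A)$ and every term of $X$ is $\mathcal D$-reflexive, then $X$ is $\mathcal D$-reflexive. 2. If $X\in\mathcal D^b(\mathcal A)$ and $H^i(X)$ is $\mathcal D$-reflexive for each $i\in\mathbb Z$, then $X$ is $\mathcal D$-reflexive. Assume $\mathbf R^\dagger\Psi\mathbf R^*\Phi$ is way-out left (resp. right). 3. If $X\in\mathcal D^-(\mathcal A)$ (resp. $X\in\mathcal D^+(\mathcal A)$) and every term of $X$ is $\mathcal D$-reflexive, then $X$ is $\mathcal D$-reflexive. 4. If $X\in\mathcal D^-(\mathcal A)$ (resp. $X\in\mathcal D^+(\mathcal A)$) and $H^i(X)$ is $\mathcal D$-reflexive for every $i$, then $X$ is $\mathcal D$-reflexive. Assume $\mathbf R^\dagger\Psi\mathbf R^*\Phi$ is way-out in both directions. 5. If every term of $X$ is $\mathcal D$-reflexive, then $X$ is $\mathcal D$-reflexive. 6. If $H^i(X)$ is $\mathcal D$-reflexive for every $i$, then $X$ is $\mathcal D$-reflexive.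
   Context: $\mathcal A,\mathcal B$ are abelian categories; $\mathcal D^*(\mathcal A)$ and $\mathcal D^\dagger(\mathcal B)$ denote any of the derived categories (unbounded, bounded below $\mathcal D^+$, bounded above $\mathcal D^-$, bounded $\mathcal D^b$), $K^*,K^\dagger$ the corresponding homotopy categories; complexes have differentials $X_n\to X_{n+1}$. $\mathcal D^*_{\le n}(\mathcal A)$ (resp. $\mathcal D^*_{\ge n}(\mathcal A)$) consists of the complexes whose cohomologies vanish in degrees $>n$ (resp. $<n$). $\Phi:\mathcal A\to\mathcal B$, $\Psi:\mathcal B\to\mathcal A$ are additive nonzero contravariant functors forming a right adjoint pair ($\mathrm{Hom}_{\mathcal A}(A,\Psi B)\cong\mathrm{Hom}_{\mathcal B}(B,\Phi A)$ naturally). The derived functors $\mathbf R^*\Phi:\mathcal D^*(\mathcal A)\to\mathcal D(\mathcal B)$ and $\mathbf R^\dagger\Psi:\mathcal D^\dagger(\mathcal B)\to\mathcal D(\mathcal A)$ are assumed to exist in the following way: there are triangulated subcategories $\mathcal P\subseteq K^*(\mathcal A)$, $\mathcal Q\subseteq K^\dagger(\mathcal B)$ such that every object of $K^*(\mathcal A)$ (resp. $K^\dagger(\mathcal B)$) admits a quasi-isomorphism from an object of $\mathcal P$ (resp. $\mathcal Q$), and $\Phi$ (resp. $\Psi$) sends exact complexes in $\mathcal P$ (resp. $\mathcal Q$) to exact complexes; $\mathbf R^*\Phi X=\Phi P$ for $P\in\mathcal P$ quasi-isomorphic to $X$, and similarly for $\Psi$. It is assumed that $(\Phi,\Psi)$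 induces a right adjoint pair $(\mathbf R^*\Phi,\mathbf R^\dagger\Psi)$ between $\mathcal D^*(\mathcal A)$ and $\mathcal D^\dagger(\mathcal B)$, with units $\hat\eta:\mathrm{id}\to\mathbf R^\dagger\Psi\mathbf R^*\Phi$ and $\hat\xi:\mathrm{id}\to\mathbf R^*\Phi\mathbf R^\dagger\Psi$. A complex $X\in\mathcal D^*(\mathcal A)$ is $\mathcal D$-reflexive if $\hat\eta_X$ is an isomorphism in $\mathcal D^*(\mathcal A)$; an object of $\mathcal A$ is $\mathcal D$-reflexive if it is so as a stalk complex in degree $0$. A covariant functor $F:\mathcal D^*(\mathcal A)\to\mathcal D(\mathcal A)$ commuting with shifts and preserving triangles is way-out left if $F(\mathcal D^*_{\le0}(\mathcal A))\subseteq\mathcal D_{\le n}(\mathcal A)$ for some $n\in\mathbb Z$, and way-out right if $F(\mathcal D^*_{\ge0}(\mathcal A))\subseteq\mathcal D_{\ge n}(\mathcal A)$ for some $n\in\mathbb Z$. *)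

(* Defs.v *)
From mathcomp Require Import all_boot all_order all_algebra.

Set Implicit Arguments.
Unset Strict Implicit.
Unset Printing Implicit Defensive.

Import Order.TTheory GRing.Theory Num.Theory.
Local Open Scope ring_scope.

(** * Categories whose hom-types carry an equivalence relation [heq], which
    plays the role of equality of morphisms. *)

Record category := Category {
  obj :> Type;
  hom : obj -> obj -> Type;
  heq : forall X Y, hom X Y -> hom X Y -> Prop;
  idc : forall X, hom X X;
  compo : forall X Y Z, hom Y Z -> hom X Y -> hom X Z;
  heq_refl : forall X Y (f : hom X Y), heq f f;
  heq_sym : forall X Y (f g : hom X Y), heq f g -> heq g f;
  heq_trans : forall X Y (f g h : hom X Y), heq f g -> heq g h -> heq f h;
  comp_heq : forall X Y Z (g g' : hom Y Z) (f f' : hom X Y),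
    heq g g' -> heq f f' -> heq (compo g f) (compo g' f');
  compcA : forall X Y Z T (h : hom Z T) (g : hom Y Z) (f : hom X Y),
    heq (compo h (compo g f)) (compo (compo h g) f);
  comp1c : forall X Y (f : hom X Y), heq (compo (idc Y) f) f;
  compc1 : forall X Y (f : hom X Y), heq (compo f (idc X)) f
}.

Notation "f =~ g" := (heq f g) (at level 70, no associativity).
Notation "g \oc f" := (compo g f) (at level 40, left associativity).

Definition is_iso (C : category) (X Y : C) (f : hom X Y) : Prop :=
  exists g : hom Y X, (g \oc f =~ idc X) /\ (f \oc g =~ idc Y).

Definition isomorphic (C : category) (X Y : C) : Prop :=
  exists f : hom X Y, is_iso f.

Definition full_subcategory (C : category) (P : C -> Prop) : category :=
  {| obj := {X : C | P X};
     hom := fun X Y => hom (proj1_sig X) (proj1_sig Y);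
     heq := fun X Y => @heq C (proj1_sig X) (proj1_sig Y);
     idc := fun X => idc (proj1_sig X);
     compo := fun X Y Z => @compo C (proj1_sig X) (proj1_sig Y) (proj1_sig Z);
     heq_refl := fun X Y => @heq_refl C _ _;
     heq_sym := fun X Y => @heq_sym C _ _;
     heq_trans := fun X Y => @heq_trans C _ _;
     comp_heq := fun X Y Z => @comp_heq C _ _ _;
     compcA := fun X Y Z T => @compcA C _ _ _ _;
     comp1c := fun X Y => @comp1c C _ _;
     compc1 := fun X Y => @compc1 C _ _ |}.

(** Gabriel-Zisman localization of [C] at the class [W]: morphisms are formal
    composites of morphisms of [C] and of formal inverses of elements of [W],
    modulo the congruence generated by the relations of [C] and by
    [s^-1 s = id], [s s^-1 = id]. *)

Section Localization.
Variables (C : category) (W : forall X Y : C, hom X Y -> Prop).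

Inductive word : C -> C -> Type :=
| wmap X Y (f : hom X Y) : word X Y
| winv X Y (s : hom X Y) (Ws : W s) : word Y X
| wcomp X Y Z (v : word Y Z) (u : word X Y) : word X Z.

Inductive weq : forall X Y, word X Y -> word X Y -> Prop :=
| weq_refl X Y (u : word X Y) : weq u u
| weq_sym X Y (u v : word X Y) : weq u v -> weq v u
| weq_trans X Y (u v w : word X Y) : weq u v -> weq v w -> weq u w
| weq_comp X Y Z (v v' : word Y Z) (u u' : word X Y) :
    weq v v' -> weq u u' -> weq (wcomp v u) (wcomp v' u')
| weq_compA X Y Z T (w : word Z T) (v : word Y Z) (u : word X Y) :
    weq (wcomp w (wcomp v u)) (wcomp (wcomp w v) u)
| weq_1comp X Y (u : word X Y) : weq (wcomp (wmap (idc Y)) u) u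
| weq_comp1 X Y (u : word X Y) : weq (wcomp u (wmap (idc X))) u
| weq_map X Y (f f' : hom X Y) : (f =~ f') -> weq (wmap f) (wmap f')
| weq_mapM X Y Z (g : hom Y Z) (f : hom X Y) :
    weq (wmap (g \oc f)) (wcomp (wmap g) (wmap f))
| weq_invl X Y (s : hom X Y) (Ws : W s) :
    weq (wcomp (winv Ws) (wmap s)) (wmap (idc X))
| weq_invr X Y (s : hom X Y) (Ws : W s) :
    weq (wcomp (wmap s) (winv Ws)) (wmap (idc Y)).

Definition localization : category :=
  {| obj := obj C;
     hom := word;
     heq := weq;
     idc := fun X => wmap (idc X);
     compo := wcomp;
     heq_refl := weq_refl;
     heq_sym := weq_sym;
     heq_trans := weq_trans;
     comp_heq := weq_comp;
     compcA := weq_compA;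
     comp1c := weq_1comp;
     compc1 := weq_comp1 |}.

End Localization.

Record cofunctor (C D : category) := Cofunctor {
  co_obj :> C -> D;
  co_map : forall X Y, hom X Y -> hom (co_obj X) (co_obj Y);
  co_heq : forall X Y (f f' : hom X Y), (f =~ f') -> co_map f =~ co_map f';
  co_id : forall X, co_map (idc X) =~ idc (co_obj X);
  co_comp : forall X Y Z (g : hom Y Z) (f : hom X Y),
    co_map (g \oc f) =~ co_map g \oc co_map f
}.

Record contrafunctor (C D : category) := Contrafunctor {
  ct_obj :> C -> D;
  ct_map : forall X Y, hom X Y -> hom (ct_obj Y) (ct_obj X);
  ct_heq : forall X Y (f f' : hom X Y), (f =~ f') -> ct_map f =~ ct_map f';
  ct_id : forall X, ct_map (idc X) =~ idc (ct_obj X);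
  ct_comp : forall X Y Z (g : hom Y Z) (f : hom X Y),
    ct_map (g \oc f) =~ ct_map f \oc ct_map g
}.

Program Definition comp_contra (C D E : category)
    (G : contrafunctor D E) (F : contrafunctor C D) : cofunctor C E :=
  {| co_obj := fun X => G (F X);
     co_map := fun X Y f => ct_map G (ct_map F f) |}.
Next Obligation. by move=> *; do 2!apply: ct_heq. Qed.
Next Obligation.
by move=> *; apply: heq_trans (ct_heq _ (ct_id _ _)) (ct_id _ _).
Qed.
Next Obligation.
by move=> *; apply: heq_trans (ct_heq _ (ct_comp _ _ _)) (ct_comp _ _ _).
Qed.

Definition corestrict (C D : category) (P : D -> Prop) (F : contrafunctor C D)
    (FP : forall X, P (F X)) : contrafunctor C (full_subcategory P) :=
  @Contrafunctor C (full_subcategory P)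
    (fun X => exist P (F X) (FP X)) (@ct_map _ _ F) (@ct_heq _ _ F)
    (@ct_id _ _ F) (@ct_comp _ _ F).

(** Right adjoint pair of contravariant functors: a natural bijection
    [Hom(X, G Y) = Hom(Y, F X)]. *)
Record right_adjoint_pair (C D : category)
    (F : contrafunctor C D) (G : contrafunctor D C) := RightAdjointPair {
  adj : forall X Y, hom X (G Y) -> hom Y (F X);
  adjV : forall X Y, hom Y (F X) -> hom X (G Y);
  adj_heq : forall X Y (f f' : hom X (G Y)), (f =~ f') -> adj f =~ adj f';
  adjV_heq : forall X Y (g g' : hom Y (F X)), (g =~ g') -> adjV g =~ adjV g';
  adjK : forall X Y (f : hom X (G Y)), adjV (adj f) =~ f;
  adjVK : forall X Y (g : hom Y (F X)), adj (adjV g) =~ g;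
  adj_natl : forall X X' Y (a : hom X' X) (f : hom X (G Y)),
    adj (f \oc a) =~ ct_map F a \oc adj f;
  adj_natr : forall X Y Y' (b : hom Y' Y) (f : hom X (G Y)),
    adj (ct_map G b \oc f) =~ adj f \oc b
}.

Definition adj_unit (C D : category) (F : contrafunctor C D)
    (G : contrafunctor D C) (a : right_adjoint_pair F G) (X : C) :
    hom X (G (F X)) :=
  adjV a (idc (F X)).

(** * Abelian categories *)

Record abelian := Abelian {
  aobj :> Type;
  ahom : aobj -> aobj -> zmodType;
  aid : forall X, ahom X X;
  acomp : forall X Y Z, ahom Y Z -> ahom X Y -> ahom X Z;
  acompA : forall X Y Z T (h : ahom Z T) (g : ahom Y Z) (f : ahom X Y),
    acomp h (acomp g f) = acomp (acomp h g) f;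
  acomp1l : forall X Y (f : ahom X Y), acomp (aid Y) f = f;
  acomp1r : forall X Y (f : ahom X Y), acomp f (aid X) = f;
  acompDl : forall X Y Z (g g' : ahom Y Z) (f : ahom X Y),
    acomp (g + g') f = acomp g f + acomp g' f;
  acompDr : forall X Y Z (g : ahom Y Z) (f f' : ahom X Y),
    acomp g (f + f') = acomp g f + acomp g f';
  azero : aobj;
  azeroP : aid azero = 0;
  abip : aobj -> aobj -> aobj;
  ainl : forall X Y, ahom X (abip X Y);
  ainr : forall X Y, ahom Y (abip X Y);
  afst : forall X Y, ahom (abip X Y) X;
  asnd : forall X Y, ahom (abip X Y) Y;
  afst_inl : forall X Y, acomp (afst X Y) (ainl X Y) = aid X;
  asnd_inr : forall X Y, acomp (asnd X Y) (ainr X Y) = aid Y;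
  afst_inr : forall X Y, acomp (afst X Y) (ainr X Y) = 0;
  asnd_inl : forall X Y, acomp (asnd X Y) (ainl X Y) = 0;
  abipP : forall X Y,
    acomp (ainl X Y) (afst X Y) + acomp (ainr X Y) (asnd X Y) =
    aid (abip X Y);
  ker : forall X Y, ahom X Y -> aobj;
  kinc : forall X Y (f : ahom X Y), ahom (ker f) X;
  klift : forall X Y (f : ahom X Y) T (g : ahom T X),
    acomp f g = 0 -> ahom T (ker f);
  kinc0 : forall X Y (f : ahom X Y), acomp f (kinc f) = 0;
  kinc_lift : forall X Y (f : ahom X Y) T (g : ahom T X) (fg0 : acomp f g = 0),
    acomp (kinc f) (klift fg0) = g;
  kinc_mono : forall X Y (f : ahom X Y) T (g g' : ahom T (ker f)),
    acomp (kinc f) g = acomp (kinc f) g' -> g = g';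
  coker : forall X Y, ahom X Y -> aobj;
  cproj : forall X Y (f : ahom X Y), ahom Y (coker f);
  cdesc : forall X Y (f : ahom X Y) T (g : ahom Y T),
    acomp g f = 0 -> ahom (coker f) T;
  cproj0 : forall X Y (f : ahom X Y), acomp (cproj f) f = 0;
  cdesc_proj : forall X Y (f : ahom X Y) T (g : ahom Y T) (gf0 : acomp g f = 0),
    acomp (cdesc gf0) (cproj f) = g;
  cproj_epi : forall X Y (f : ahom X Y) T (g g' : ahom (coker f) T),
    acomp g (cproj f) = acomp g' (cproj f) -> g = g';
  mono_normal : forall X Y (f : ahom X Y),
    (forall T (g g' : ahom T X), acomp f g = acomp f g' -> g = g') ->
    forall T (h : ahom T Y), acomp (cproj f) h = 0 ->
    exists k : ahom T X, acomp f k = h;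
  epi_normal : forall X Y (f : ahom X Y),
    (forall T (g g' : ahom Y T), acomp g f = acomp g' f -> g = g') ->
    forall T (h : ahom X T), acomp h (kinc f) = 0 ->
    exists k : ahom Y T, acomp k f = h
}.

Arguments aid {a} X.
Arguments azero {a}.
Arguments ainl {a} X Y.
Arguments ainr {a} X Y.
Arguments afst {a} X Y.
Arguments asnd {a} X Y.

Notation "g \oa f" := (acomp g f) (at level 40, left associativity).

Lemma acomp_heq (A : abelian) (X Y Z : A) (g g' : ahom Y Z) (f f' : ahom X Y) :
  g = g' -> f = f' -> g \oa f = g' \oa f'.
Proof. by move=> -> ->. Qed.

Definition acat (A : abelian) : category :=
  {| obj := aobj A;
     hom := fun X Y => ahom X Y;
     heq := fun X Y => @eq (ahom X Y);
     idc := fun X => aid X;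
     compo := fun X Y Z => @acomp A X Y Z;
     heq_refl := fun X Y => @erefl (ahom X Y);
     heq_sym := fun X Y => @esym (ahom X Y);
     heq_trans := fun X Y => @etrans (ahom X Y);
     comp_heq := @acomp_heq A;
     compcA := @acompA A;
     comp1c := @acomp1l A;
     compc1 := @acomp1r A |}.

Definition is_zero (A : abelian) (X : A) : Prop := aid X = 0.

Section AbelianTheory.
Variable A : abelian.
Implicit Types X Y Z : A.

Lemma acomp0l X Y Z (f : ahom X Y) : (0 : ahom Y Z) \oa f = 0.
Proof. by apply: (addrI (0 \oa f)); rewrite -acompDl !addr0. Qed.

Lemma acomp0r X Y Z (g : ahom Y Z) : g \oa (0 : ahom X Y) = 0.
Proof. by apply: (addrI (g \oa 0)); rewrite -acompDr !addr0. Qed.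

Lemma acompNl X Y Z (g : ahom Y Z) (f : ahom X Y) : (- g) \oa f = - (g \oa f).
Proof. by apply: (addrI (g \oa f)); rewrite -acompDl !subrr acomp0l. Qed.

Lemma acompNr X Y Z (g : ahom Y Z) (f : ahom X Y) : g \oa (- f) = - (g \oa f).
Proof. by apply: (addrI (g \oa f)); rewrite -acompDr !subrr acomp0r. Qed.

(** The identity of [F i] when [i = j], and [0] otherwise. *)
Definition idd (I : eqType) (F : I -> A) (i j : I) : ahom (F i) (F j) :=
  match i =P j with
  | ReflectT e => ecast k (ahom (F i) (F k)) e (aid (F i))
  | ReflectF _ => 0
  end.

Lemma idd_refl (I : eqType) (F : I -> A) i : idd F i i = aid (F i).
Proof. by rewrite /idd; case: eqP => // e; rewrite eq_axiomK. Qed.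

Lemma idd_neq (I : eqType) (F : I -> A) i j : i != j -> idd F i j = 0.
Proof. by rewrite /idd; case: eqP. Qed.

End AbelianTheory.

(** * Complexes, the homotopy category and the derived category *)

(** The differential [X_i -> X_(i+1)] is [cd X i (i + 1)]; the family [cd] is
    extended by [0] to all pairs of degrees, so that no cast between equal
    degrees is needed. *)
Record cplx (A : abelian) := Cplx {
  cobj :> int -> A;
  cd : forall i j, ahom (cobj i) (cobj j);
  cd_shape : forall i j, i + 1 != j -> cd i j = 0;
  cd_sq : forall i j k, cd j k \oa cd i j = 0
}.

Record chain (A : abelian) (X Y : cplx A) := Chain {
  cmap :> forall i, ahom (X i) (Y i);
  cmapP : forall i j, cd Y i j \oa cmap i = cmap j \oa cd X i j
}.

Program Definition chain_id (A : abelian) (X : cplx A) : chain X X :=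
  @Chain A X X (fun i => aid (X i)) _.
Next Obligation. by move=> *; rewrite acomp1l acomp1r. Qed.

Program Definition chain_comp (A : abelian) (X Y Z : cplx A)
    (g : chain Y Z) (f : chain X Y) : chain X Z :=
  @Chain A X Z (fun i => g i \oa f i) _.
Next Obligation. by move=> *; rewrite acompA cmapP -acompA cmapP acompA. Qed.

Definition homotopic (A : abelian) (X Y : cplx A) (f g : chain X Y) : Prop :=
  exists s : forall i j, ahom (X i) (Y j), forall i,
    f i - g i = cd Y (i - 1) i \oa s i (i - 1) + s (i + 1) i \oa cd X i (i + 1).

Section HomotopyCategory.
Variable A : abelian.
Implicit Types X Y Z T : cplx A.

Lemma homotopic_eq X Y (f g : chain X Y) :
  (forall i, f i = g i) -> homotopic f g.
Proof.
move=> fg; exists (fun _ _ => 0) => i.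
by rewrite fg subrr acomp0l acomp0r addr0.
Qed.

Lemma homotopic_refl X Y (f : chain X Y) : homotopic f f.
Proof. exact: homotopic_eq. Qed.

Lemma homotopic_sym X Y (f g : chain X Y) : homotopic f g -> homotopic g f.
Proof.
case=> s sP; exists (fun i j => - s i j) => i.
by rewrite -opprB sP acompNl acompNr opprD.
Qed.

Lemma homotopic_trans X Y (f g h : chain X Y) :
  homotopic f g -> homotopic g h -> homotopic f h.
Proof.
case=> s sP [t tP]; exists (fun i j => s i j + t i j) => i.
rewrite -[f i](subrK (g i)) -addrA sP tP acompDl acompDr.
by rewrite addrACA.
Qed.

Lemma homotopic_comp X Y Z (g g' : chain Y Z) (f f' : chain X Y) :
  homotopic g g' -> homotopic f f' ->
  homotopic (chain_comp g f) (chain_comp g' f').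
Proof.
case=> s sP [t tP]; exists (fun i j => s i j \oa f i + g' j \oa t i j) => i /=.
have -> : g i \oa f i - g' i \oa f' i =
    (g i - g' i) \oa f i + g' i \oa (f i - f' i).
  by rewrite acompDl acompDr acompNl acompNr addrA subrK.
rewrite sP tP !(acompDl, acompDr) addrACA.
congr (_ + _); congr (_ + _); rewrite -?acompA ?cmapP // !acompA.
  by rewrite cmapP.
Qed.

Definition Kcat : category.
Proof.
refine {| obj := cplx A;
     hom := @chain A;
     heq := @homotopic A;
     idc := @chain_id A;
     compo := @chain_comp A;
     heq_refl := homotopic_refl;
     heq_sym := homotopic_sym;
     heq_trans := homotopic_trans;
     comp_heq := homotopic_comp |}.
- by move=> *; apply: homotopic_eq => i /=; rewrite acompA.
- by move=> *; apply: homotopic_eq => i /=; rewrite acomp1l.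
- by move=> *; apply: homotopic_eq => i /=; rewrite acomp1r.
Defined.

End HomotopyCategory.

Section Cohomology.
Variable A : abelian.
Implicit Types X Y : cplx A.

(** [X_(i-1) -> Ker (X_i -> X_(i+1))]. *)
Definition to_cycles X i : ahom (X (i - 1)) (ker (cd X i (i + 1))) :=
  klift (cd_sq X (i - 1) i (i + 1)).

Definition cohomology X i : A := coker (to_cycles X i).

Lemma cycles_mapP X Y (f : chain X Y) i :
  cd Y i (i + 1) \oa (f i \oa kinc (cd X i (i + 1))) = 0.
Proof. by rewrite acompA cmapP -acompA kinc0 acomp0r. Qed.

Definition cycles_map X Y (f : chain X Y) i :
    ahom (ker (cd X i (i + 1))) (ker (cd Y i (i + 1))) :=
  klift (cycles_mapP f i).

Lemma cohomology_mapP X Y (f : chain X Y) i :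
  cproj (to_cycles Y i) \oa cycles_map f i \oa to_cycles X i = 0.
Proof.
rewrite -acompA.
have -> : cycles_map f i \oa to_cycles X i = to_cycles Y i \oa f (i - 1).
  apply: kinc_mono; rewrite !acompA kinc_lift -acompA !kinc_lift.
  by rewrite cmapP.
by rewrite acompA cproj0 acomp0l.
Qed.

Definition cohomology_map X Y (f : chain X Y) i :
    ahom (cohomology X i) (cohomology Y i) :=
  cdesc (cohomology_mapP f i).

Definition quasi_iso X Y (f : hom (X : Kcat A) Y) : Prop :=
  forall i, is_iso (cohomology_map f i : @hom (acat A) _ _).

Definition exact_cplx X : Prop := forall i, is_zero (cohomology X i).

End Cohomology.

Definition Dcat (A : abelian) : category :=
  @localization (Kcat A) (@quasi_iso A).

Definition Dmap (A : abelian) (X Y : cplx A) (f : chain X Y) :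
    @hom (Dcat A) X Y :=
  @wmap (Kcat A) (@quasi_iso A) X Y f.

Variant boundedness := Unbounded | BoundedBelow | BoundedAbove | Bounded.

Definition bounded_below (A : abelian) (X : cplx A) : Prop :=
  exists n : int, forall i, i < n -> is_zero (X i).

Definition bounded_above (A : abelian) (X : cplx A) : Prop :=
  exists n : int, forall i, n < i -> is_zero (X i).

Definition bounded (s : boundedness) (A : abelian) (X : cplx A) : Prop :=
  match s with
  | Unbounded => True
  | BoundedBelow => bounded_below X
  | BoundedAbove => bounded_above X
  | Bounded => bounded_below X /\ bounded_above X
  end.

(** [D^s(A)] as the full subcategory of [D(A)] on the objects of [K^s(A)],
    i.e. on the complexes satisfying the termwise condition [bounded s]. *)
Definition Dstar (s : boundedness) (A : abelian) : category :=
  @full_subcategory (Dcat A) (@bounded s A).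

(** [X] lies in the essential image of [D^s(A)] in [D(A)]; unlike [bounded s]
    this is invariant under isomorphism in [D(A)]. *)
Definition in_D (s : boundedness) (A : abelian) (X : cplx A) : Prop :=
  exists Y : cplx A, bounded s Y /\ @isomorphic (Dcat A) X Y.

Section StalkShiftCone.
Variable A : abelian.

Program Definition stalk (X : A) : cplx A :=
  @Cplx A (fun i => if i == 0 then X else azero) (fun _ _ => 0) _ _.
Next Obligation. by []. Qed.
Next Obligation. by move=> *; rewrite acomp0l. Qed.

Lemma bounded_stalk (s : boundedness) (X : A) : bounded s (stalk X).
Proof.
have b : bounded_below (stalk X).
  by exists 0 => i i0; rewrite /is_zero /= lt_eqF // azeroP.
have a : bounded_above (stalk X).
  by exists 0 => i i0; rewrite /is_zero /= gt_eqF // azeroP.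
by case: s.
Qed.

(** [X[k]]: degree [i] is [X_(i+k)], with differential [(-1)^k d]. *)
Program Definition shift (X : cplx A) (k : int) : cplx A :=
  @Cplx A (fun i => X (i + k))
    (fun i j => if odd `|k|%N then - cd X (i + k) (j + k)
                else cd X (i + k) (j + k)) _ _.
Next Obligation.
move=> X k i j ij; rewrite /= cd_shape ?oppr0 ?if_same //.
by apply: contraNneq ij; rewrite addrAC => /addIr ->.
Qed.
Next Obligation.
by move=> X k i j l /=; case: ifP; rewrite ?acompNl ?acompNr cd_sq ?oppr0.
Qed.

Lemma ainlK (X Y Z : A) (u : ahom Z X) :
  (afst X Y \oa (ainl X Y \oa u) = u) * (asnd X Y \oa (ainl X Y \oa u) = 0).
Proof. by rewrite !acompA afst_inl asnd_inl acomp1l acomp0l. Qed.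

Lemma ainrK (X Y Z : A) (u : ahom Z Y) :
  (asnd X Y \oa (ainr X Y \oa u) = u) * (afst X Y \oa (ainr X Y \oa u) = 0).
Proof. by rewrite !acompA asnd_inr afst_inr acomp1l acomp0l. Qed.

(** Mapping cone of [f : X -> Y]: degree [i] is [X_(i+1) + Y_i], with
    differential [(x, y) |-> (- d x, f x + d y)]. *)
Program Definition cone (X Y : cplx A) (f : chain X Y) : cplx A :=
  @Cplx A (fun i : int => abip (X (i + 1)) (Y i))
    (fun i j : int =>
       ainl (X (j + 1)) (Y j) \oa
         (- cd X (i + 1) (j + 1) \oa afst (X (i + 1)) (Y i))
     + ainr (X (j + 1)) (Y j) \oa
         (idd Y (i + 1) j \oa f (i + 1) \oa afst (X (i + 1)) (Y i)
          + cd Y i j \oa asnd (X (i + 1)) (Y i))) _ _.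
Next Obligation.
move=> X Y f i j ij /=; have ij1 : i + 1 + 1 != j + 1 by apply: contraNneq ij => /addIr ->.
rewrite (cd_shape Y ij) (idd_neq _ ij) (cd_shape X ij1).
by rewrite oppr0 !(acomp0l, acomp0r, addr0).
Qed.
Next Obligation.
move=> X Y f i j k /=.
set a := afst (X (i + 1)) (Y i); set b := asnd (X (i + 1)) (Y i).
have key : idd Y (j + 1) k \oa f (j + 1) \oa - cd X (i + 1) (j + 1)
    + cd Y j k \oa (idd Y (i + 1) j \oa f (i + 1)) = 0.
  have [ij|ij] := eqVneq (i + 1) j; last first.
    have ij1 : i + 1 + 1 != j + 1 by apply: contraNneq ij => /addIr ->.
    by rewrite (idd_neq _ ij) (cd_shape X ij1) !(acomp0l, acomp0r, oppr0, addr0).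
  subst j; rewrite idd_refl acomp1l cmapP acompNr.
  have [jk|jk] := eqVneq (i + 1 + 1) k; last first.
    by rewrite (idd_neq _ jk) (cd_shape X jk) !(acomp0l, acomp0r, oppr0, addr0).
  by subst k; rewrite idd_refl acomp1l addNr.
rewrite !(acompDl, acompDr) -!acompA !(ainlK, ainrK).
rewrite !(acomp0r, addr0, add0r) (acompA (cd Y j k) (cd Y i j)) cd_sq.
have -> : - cd X (j + 1) (k + 1) \oa (- cd X (i + 1) (j + 1) \oa a) = 0.
  by rewrite acompA acompNl acompNr cd_sq !oppr0 acomp0l.
rewrite acomp0l !acomp0r addr0 add0r -acompDr.
move/(congr1 (fun u => u \oa a)): key.
by rewrite acompDl acomp0l -!acompA => ->; rewrite acomp0r.
Qed.

End StalkShiftCone.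

(** A strictly full triangulated subcategory of [K^s(A)]. *)
Record triangulated_subcategory (s : boundedness) (A : abelian)
    (P : cplx A -> Prop) : Prop := {
  tri_bounded : forall X, P X -> bounded s X;
  tri_iso : forall X Y : cplx A,
    bounded s Y -> @isomorphic (Kcat A) X Y -> P X -> P Y;
  tri_zero : P (stalk azero);
  tri_shift : forall X k, P X -> P (shift X k);
  tri_cone : forall X Y (f : chain X Y), P X -> P Y -> P (cone f)
}.

(** * Additive contravariant functors and their derived functors *)

Record additive_contrafunctor (A B : abelian) := AdditiveContrafunctor {
  ac_functor :> contrafunctor (acat A) (acat B);
  ac_add : forall (X Y : A) (f g : ahom X Y),
    ct_map ac_functor (f + g : ahom X Y) =
    (ct_map ac_functor f : ahom (ac_functor Y) (ac_functor X))
      + ct_map ac_functor g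
}.

Definition nonzero_functor (A B : abelian) (F : additive_contrafunctor A B) :
    Prop :=
  exists X : A, ~ is_zero (F X : B).

Section ApplyToComplexes.
Variables (A B : abelian) (F : additive_contrafunctor A B).

Definition fmap (X Y : A) (f : ahom X Y) : ahom (F Y : B) (F X) := ct_map F f.

Lemma fmap0 (X Y : A) : fmap (0 : ahom X Y) = 0.
Proof.
by apply: (addrI (fmap 0)); rewrite -[LHS](ac_add F) !addr0.
Qed.

(** [(F X)_n = F (X_(-n))]. *)
Program Definition on_cplx (X : cplx A) : cplx B :=
  @Cplx B (fun n : int => F (X (- n)))
    (fun m n : int => fmap (cd X (- n) (- m))) _ _.
Next Obligation.
move=> X m n mn /=; rewrite cd_shape ?fmap0 //.
by apply: contraNneq mn => e; rewrite -[m]opprK -e opprD opprK subrK.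
Qed.
Next Obligation.
by move=> X i j k /=; rewrite -[LHS](ct_comp F) [compo _ _]cd_sq [LHS]fmap0.
Qed.

Program Definition on_chain (X Y : cplx A) (f : chain X Y) :
    chain (on_cplx Y) (on_cplx X) :=
  @Chain B (on_cplx Y) (on_cplx X) (fun n : int => fmap (f (- n))) _.
Next Obligation.
move=> X Y f i j /=; rewrite -[LHS](ct_comp F) -[RHS](ct_comp F).
by congr (fmap _); rewrite /= cmapP.
Qed.

(** [P] is a triangulated subcategory of [K^s(A)] by which the right derived
    functor of [F] on [D^s(A)] is computed. *)
Record adapted (s : boundedness) (P : cplx A -> Prop) : Prop := {
  ad_tri : triangulated_subcategory s P;
  ad_resolve : forall X, bounded s X ->
    exists (R : cplx A) (q : chain R X), P R /\ quasi_iso (q : hom (R : Kcat A) X);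
  ad_exact : forall R, P R -> exact_cplx R -> exact_cplx (on_cplx R)
}.

Definition ad_bounded (s : boundedness) (P : cplx A -> Prop)
    (h : adapted s P) X : P X -> bounded s X :=
  tri_bounded (ad_tri h) (X := X).

(** The right derived functor is determined up to unique isomorphism by being
    a functor on [D^s(A)] naturally isomorphic to [F] on [P]. *)
Record right_derived (s : boundedness) (P : cplx A -> Prop)
    (h : adapted s P) := RightDerived {
  rd_functor :> contrafunctor (Dstar s A) (Dcat B);
  rd_can : forall (R : cplx A) (pR : P R),
    @hom (Dcat B) (on_cplx R) (rd_functor (exist _ R (ad_bounded h pR)));
  rd_can_iso : forall (R : cplx A) (pR : P R), is_iso (rd_can pR);
  rd_can_nat : forall (R S : cplx A) (pR : P R) (pS : P S) (f : chain R S),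
    rd_can pR \oc (Dmap (on_chain f) : @hom (Dcat B) (on_cplx S) (on_cplx R)) =~
    ct_map rd_functor
      (Dmap f : @hom (Dstar s A) (exist _ R (ad_bounded h pR))
                                 (exist _ S (ad_bounded h pS)))
      \oc rd_can pS
}.

End ApplyToComplexes.

Section DerivedAdjunction.
Variables (A B : abelian).
Variables (Phi : additive_contrafunctor A B) (Psi : additive_contrafunctor B A).
Variable a : right_adjoint_pair Phi Psi.

(** [f : X -> Psi Y] and [g : Y -> Phi X] correspond to each other under the
    degreewise application of the adjunction; [idd] identifies [Y_m] with
    [Y_(-(-m))]. *)
Definition transposes (X : cplx A) (Y : cplx B)
    (f : chain X (on_cplx Psi Y)) (g : chain Y (on_cplx Phi X)) : Prop :=
  forall m : int,
    g m = (adj a (f (- m) : @hom (acat A) _ (Psi (Y (- - m))))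
             : ahom (Y (- - m)) (Phi (X (- m)) : B))
            \oa idd Y m (- - m).

Variables (s t : boundedness) (P : cplx A -> Prop) (Q : cplx B -> Prop).
Variables (hP : adapted Phi s P) (hQ : adapted Psi t Q).
Variables (RPhi : right_derived hP) (RPsi : right_derived hQ).

Hypothesis RPhi_t : forall X, bounded t (RPhi X).
Hypothesis RPsi_s : forall Y, bounded s (RPsi Y).

(** The adjunction between the derived functors is induced by [a]: the square
<<
       Hom (R, Psi S)   ---- a ---->    Hom (S, Phi R)
             |                                |
             v                                v
    Hom_D (R, RPsi S) -- ahat -->  Hom_D (S, RPhi R)
>>
    where the upper row consists of morphisms of complexes, commutes for all
    [R] in [P] and [S] in [Q]. *)
Definition induced_by (ahat : 
    right_adjoint_pair (corestrict RPhi_t) (corestrict RPsi_s)) : Prop :=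
  forall (R : cplx A) (S : cplx B) (pR : P R) (qS : Q S)
      (f : chain R (on_cplx Psi S)) (g : chain S (on_cplx Phi R)),
    transposes f g ->
    @adj _ _ _ _ ahat (exist _ R (ad_bounded hP pR))
      (exist _ S (ad_bounded hQ qS)) (rd_can RPsi qS \oc Dmap f) =~
    (rd_can RPhi pR \oc Dmap g : @hom (Dstar t B)
      (exist _ S (ad_bounded hQ qS)) (corestrict RPhi_t (exist _ R (ad_bounded hP pR)))).

Variable ahat : 
    right_adjoint_pair (corestrict RPhi_t) (corestrict RPsi_s).

Definition D_reflexive (X : Dstar s A) : Prop := is_iso (adj_unit ahat X).

Definition D_reflexive_obj (M : A) : Prop :=
  D_reflexive (exist _ (stalk M) (bounded_stalk s M)).

End DerivedAdjunction.

(** [coh_le n X]: [X] belongs to [D_(<= n)(A)], and similarly for [coh_ge]. *)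

Definition coh_le (A : abelian) (n : int) (X : cplx A) : Prop :=
  forall i, n < i -> is_zero (cohomology X i).

Definition coh_ge (A : abelian) (n : int) (X : cplx A) : Prop :=
  forall i, i < n -> is_zero (cohomology X i).

(** Used below only for composites of two derived functors, which commute with
    shifts and preserve triangles. *)
Definition way_out_left (s : boundedness) (A : abelian)
    (F : cofunctor (Dstar s A) (Dcat A)) : Prop :=
  exists n : int, forall X : Dstar s A,
    coh_le 0 (proj1_sig X) -> coh_le n (F X : cplx A).

Definition way_out_right (s : boundedness) (A : abelian)
    (F : cofunctor (Dstar s A) (Dcat A)) : Prop :=
  exists n : int, forall X : Dstar s A,
    coh_ge 0 (proj1_sig X) -> coh_ge n (F X : cplx A).

(* Main.v *)
Require Import Defs.
From mathcomp Require Import all_boot all_order all_algebra.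
From mathcomp Require Import zify.
From Stdlib Require Import IndefiniteDescription Setoid.
Import Defs.

Set Implicit Arguments.
Unset Strict Implicit.
Unset Printing Implicit Defensive.

Import Order.TTheory GRing.Theory Num.Theory.
Local Open Scope ring_scope.

(** Write [T] for the composite of the two derived functors and [eta : id ->
    T] for the unit. Cohomology detects isomorphisms of the derived category
    ([Diso_coh]), so [X] is reflexive when [H^i (eta_X)] is an isomorphism for
    every [i].

    The proof rests on two properties of the reflexive complexes.

    - They are closed under shifts ([reflexive_shift]). By adjunction, [eta_X]
      is an isomorphism if and only if [RPhi] is bijective on the morphisms
      into [X] ([unit_iso_full], [full_unit_iso]). The shift is bijective on
      morphisms, and [RPhi (X[k])] is naturally isomorphic to [(RPhi X)[-k]]
      ([rd_shift_nat]), so this property passes from [X] to [X[k]].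

    - In a short exact sequence [V -> X -> W] of complexes, [H^i (eta_X)] is
      an isomorphism as soon as [H^i (eta)] is one for [W[-1]], [V], [W] and
      [V[1]] ([ses_eta_iso_at]). This is the five lemma, applied to the long
      exact sequences of cohomology of the triangle and of its image under
      [T]; the latter is exact because a derived functor, computed on a
      triangulated subcategory of resolutions, is cohomological
      ([rd_triangle], [rd_exact]).

    A bounded complex is then reduced to stalk complexes by induction: brutal
    truncation splits off one term, canonical truncation one cohomology object
    ([finite_term_reflexive], [finite_coh_reflexive]). If [T] is way-out left
    and [X] is bounded above, cut [X] at a degree [k] far below [i]. The lower
    piece has no cohomology near [i], and neither has its image under [T]; the
    upper piece is bounded, hence reflexive, and so [H^i (eta_X)] is an
    isomorphism. The case of way-out right functors is symmetric, and if [T]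
    is way-out in both directions, an arbitrary complex is cut at [0] into a
    piece bounded above and one bounded below.

    Two devices carry this out. Exactness in an abelian category is checked on
    local elements, that is, on morphisms [U -> X] that may be replaced by
    their restrictions to epi covers of [U]. And formal composites of chain
    maps and inverses of quasi-isomorphisms are controlled by fractions
    ([roof]), made of bounded complexes where necessary ([Dstar_generated]). *)

(** * Equations between sums in an abelian group *)

Section AbelianGroupExpressions.
Variable V : zmodType.

Inductive gexp := GVar of nat | GAdd of gexp & gexp | GOpp of gexp | GZero.

Fixpoint geval (env : seq V) e : V :=
  match e with
  | GVar n => nth 0 env n
  | GAdd e1 e2 => geval env e1 + geval env e2
  | GOpp e1 => - geval env e1
  | GZero => 0
  end.

Fixpoint gcoef n e : int :=
  match e with
  | GVar m => (n == m)%:Z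
  | GAdd e1 e2 => gcoef n e1 + gcoef n e2
  | GOpp e1 => - gcoef n e1
  | GZero => 0
  end.

Lemma geval_sum env e :
  geval env e = \sum_(i < size env) nth 0 env i *~ gcoef i e.
Proof.
elim: e => [m|e1 IH1 e2 IH2|e IH|] /=.
- have [lt_m|ge_m] := ltnP m (size env); last first.
    rewrite nth_default // big1 // => i _; rewrite ltn_eqF ?mulr0z //.
    exact: leq_trans (ltn_ord i) ge_m.
  rewrite (bigD1 (Ordinal lt_m)) //= eqxx mulr1z big1 ?addr0 // => i ne_i.
  suff -> : (i == m :> nat) = false by rewrite mulr0z.
  by apply: contraNF ne_i => /eqP e; apply/eqP/val_inj.
- by rewrite IH1 IH2 -big_split /=; apply: eq_bigr => i _; rewrite mulrzDr.
- by rewrite IH -sumrN; apply: eq_bigr => i _; rewrite mulrNz.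
- by rewrite big1 // => i _; rewrite mulr0z.
Qed.

Lemma geval_eq env e1 e2 :
  all (fun i => gcoef i e1 == gcoef i e2) (iota 0 (size env)) ->
  geval env e1 = geval env e2.
Proof.
move/allP=> H; rewrite !geval_sum; apply: eq_bigr => i _; congr (_ *~ _).
by apply/eqP/H; rewrite mem_iota /= add0n.
Qed.

End AbelianGroupExpressions.

Ltac gindex x env :=
  match env with
  | ?y :: _ =>
      let _ := match constr:(tt) with _ => unify x y end in constr:(0%N)
  | _ :: ?env' => let n := gindex x env' in constr:(n.+1)
  end.

Ltac gatoms env t :=
  lazymatch t with
  | (?u + ?v)%R => let env1 := gatoms env u in gatoms env1 v
  | (- ?u)%R => gatoms env u
  | 0%R => env
  | _ => match constr:(tt) with
         | _ => let _ := gindex t env in env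
         | _ => constr:(t :: env)
         end
  end.

Ltac greify env t :=
  lazymatch t with
  | (?u + ?v)%R =>
      let e1 := greify env u in let e2 := greify env v in
      constr:(GAdd e1 e2)
  | (- ?u)%R => let e := greify env u in constr:(GOpp e)
  | 0%R => constr:(GZero)
  | _ => let n := gindex t env in constr:(GVar n)
  end.

(** Decides equations between sums and differences of the same terms: only
    the coefficients of the terms are compared. *)
Ltac abel :=
  lazymatch goal with
  | |- @eq ?T ?l ?r =>
      let env0 := constr:(@nil T) in
      let env1 := gatoms env0 l in let env := gatoms env1 r in
      let e1 := greify env l in let e2 := greify env r in
      exact (@geval_eq _ env e1 e2 isT)
  end.

(** * Arguing with elements in an abelian category *)

Section LocalElements.
Variable A : abelian.

Definition epi (X Y : A) (p : ahom X Y) : Prop :=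
  forall Z (g g' : ahom Y Z), g \oa p = g' \oa p -> g = g'.

Definition mono (X Y : A) (f : ahom X Y) : Prop :=
  forall Z (g g' : ahom Z X), f \oa g = f \oa g' -> g = g'.

Lemma acompBl (X Y Z : A) (g g' : ahom Y Z) (f : ahom X Y) :
  (g - g') \oa f = g \oa f - g' \oa f.
Proof. by rewrite acompDl acompNl. Qed.

Lemma acompBr (X Y Z : A) (g : ahom Y Z) (f f' : ahom X Y) :
  g \oa (f - f') = g \oa f - g \oa f'.
Proof. by rewrite acompDr acompNr. Qed.

(** Commutativity of addition restricted to morphisms, so that it never
    rewrites inside the degrees on which their types depend. *)
Lemma hC (X Y : A) (f g : ahom X Y) : f + g = g + f.
Proof. exact: addrC. Qed.

Lemma epi0 (X Y : A) (p : ahom X Y) :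
  (forall Z (g : ahom Y Z), g \oa p = 0 -> g = 0) -> epi p.
Proof.
move=> H Z g g' e; apply/eqP; rewrite -subr_eq0; apply/eqP/H.
by rewrite acompBl e subrr.
Qed.

Lemma mono0 (X Y : A) (f : ahom X Y) :
  (forall Z (g : ahom Z X), f \oa g = 0 -> g = 0) -> mono f.
Proof.
move=> H Z g g' e; apply/eqP; rewrite -subr_eq0; apply/eqP/H.
by rewrite acompBr e subrr.
Qed.

Lemma epi_eq0 (X Y Z : A) (p : ahom X Y) (g : ahom Y Z) :
  epi p -> g \oa p = 0 -> g = 0.
Proof. by move=> ep e; apply: ep; rewrite e acomp0l. Qed.

Lemma mono_eq0 (X Y Z : A) (f : ahom X Y) (g : ahom Z X) :
  mono f -> f \oa g = 0 -> g = 0.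
Proof. by move=> mf e; apply: mf; rewrite e acomp0r. Qed.

Lemma epi_id (X : A) : epi (aid X).
Proof. by move=> Z g g'; rewrite !acomp1r. Qed.

Lemma epi_comp (X Y Z : A) (q : ahom Y Z) (p : ahom X Y) :
  epi q -> epi p -> epi (q \oa p).
Proof. by move=> eq ep T g g'; rewrite !acompA => /ep/eq. Qed.

Lemma split_epi (X Y : A) (p : ahom X Y) (s : ahom Y X) :
  p \oa s = aid Y -> epi p.
Proof.
by move=> e Z g g' /(congr1 (fun u => u \oa s)); rewrite -!acompA e !acomp1r.
Qed.

Lemma split_mono (X Y : A) (f : ahom X Y) (r : ahom Y X) :
  r \oa f = aid X -> mono f.
Proof.
by move=> e Z g g' /(congr1 (fun u => r \oa u)); rewrite !acompA e !acomp1l.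
Qed.

Lemma kinc_is_mono (X Y : A) (f : ahom X Y) : mono (kinc f).
Proof. by move=> T g g'; apply: kinc_mono. Qed.

Lemma cproj_is_epi (X Y : A) (f : ahom X Y) : epi (cproj f).
Proof. by move=> T g g'; apply: cproj_epi. Qed.

(** The pullback is the kernel of the difference [phi] of the two maps to [Y].
    As [phi] is epi, it is the cokernel of this kernel; so a map [g] that kills
    the projection to [T] factors through [phi], and the factor is zero because
    its restriction to [X], along which [e] is epi, is zero. *)
Lemma epi_pullback (X Y T : A) (e : ahom X Y) (y : ahom T Y) :
  epi e -> exists (T' : A) (p : ahom T' T) (x : ahom T' X),
    epi p /\ e \oa x = y \oa p.
Proof.
move=> ee; pose phi := e \oa afst X T - y \oa asnd X T.
have ephi : epi phi.
  move=> Z g g' /(congr1 (fun u => u \oa ainl X T)).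
  rewrite -!acompA !acompBl -!acompA afst_inl asnd_inl.
  by rewrite !(acomp1r, acomp0r) subr0; apply: ee.
exists (ker phi), (asnd X T \oa kinc phi), (afst X T \oa kinc phi); split.
  apply: epi0 => Z g; rewrite acompA => /(epi_normal ephi)[k Ek].
  have k0 : k = 0.
    apply: (epi_eq0 ee); move/(congr1 (fun u => u \oa ainl X T)): Ek.
    rewrite -!acompA acompBl -!acompA afst_inl asnd_inl.
    by rewrite !(acomp1r, acomp0r) subr0.
  have := congr1 (fun u => u \oa ainr X T) Ek.
  by rewrite k0 !acomp0l -acompA asnd_inr acomp1r.
by apply/eqP; rewrite -subr_eq0 !acompA -acompBl kinc0.
Qed.

Lemma mono_epi_iso (X Y : A) (f : ahom X Y) :
  mono f -> epi f -> @is_iso (acat A) X Y f.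
Proof.
move=> mf ef.
have c0 : cproj f = 0 by apply: (epi_eq0 ef); rewrite cproj0.
have [|k Ek] := mono_normal mf (h := aid Y); first by rewrite c0 acomp0l.
exists k; split=> //=; apply: mf.
by rewrite acompA Ek acomp1l acomp1r.
Qed.

Lemma iso_mono (X Y : A) (f : ahom X Y) : @is_iso (acat A) X Y f -> mono f.
Proof. by case=> g [gf _]; apply: split_mono gf. Qed.

Lemma iso_epi (X Y : A) (f : ahom X Y) : @is_iso (acat A) X Y f -> epi f.
Proof. by case=> g [_ fg]; apply: split_epi fg. Qed.

(** The map from [X] to the image of [f], taken to be the kernel of the
    cokernel of [f], is epi: a morphism killing it cuts out a subobject of the
    image that already contains [f], and a subobject is the kernel of its
    cokernel. *)
Lemma coker_eq0_lift (X Y T : A) (f : ahom X Y) (y : ahom T Y) :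
  cproj f \oa y = 0 ->
  exists (T' : A) (p : ahom T' T) (x : ahom T' X), epi p /\ f \oa x = y \oa p.
Proof.
move=> y0; pose e := klift (cproj0 f).
have ee : epi e.
  apply: epi0 => Z g ge0.
  pose m := kinc (cproj f) \oa kinc g.
  have mm : mono m.
    by move=> U u u'; rewrite -!acompA => /kinc_mono/kinc_mono.
  have mf : m \oa klift ge0 = f by rewrite -acompA !kinc_lift.
  have cmf : cproj m \oa f = 0.
    by have := congr1 (fun u => cproj m \oa u) mf; rewrite acompA cproj0 acomp0l.
  have [|k Ek] := mono_normal mm (h := kinc (cproj f)).
    by rewrite -(cdesc_proj cmf) -acompA kinc0 acomp0r.
  have E1 : kinc g \oa k = aid _.
    by apply: (@kinc_is_mono _ _ (cproj f)); rewrite acompA Ek acomp1r.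
  by rewrite -[g]acomp1r -E1 acompA kinc0 acomp0l.
have [T' [p [x [ep Ex]]]] := epi_pullback (klift y0) ee.
exists T', p, x; split=> //.
by rewrite -{1}(kinc_lift (cproj0 f)) -acompA Ex acompA kinc_lift.
Qed.

Lemma lift_coker_eq0 (X Y T T' : A) (f : ahom X Y) (y : ahom T Y)
    (p : ahom T' T) (x : ahom T' X) :
  epi p -> f \oa x = y \oa p -> cproj f \oa y = 0.
Proof.
by move=> ep e; apply: (epi_eq0 ep); rewrite -acompA -e acompA cproj0 acomp0l.
Qed.

Lemma zero_cod (X Y : A) (f : ahom X Y) : is_zero Y -> f = 0.
Proof. by move=> Y0; rewrite -[f]acomp1l Y0 acomp0l. Qed.

Lemma zero_dom (X Y : A) (f : ahom X Y) : is_zero X -> f = 0.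
Proof. by move=> X0; rewrite -[f]acomp1r X0 acomp0r. Qed.

Lemma zero_iso (X Y : A) (f : ahom X Y) :
  is_zero X -> is_zero Y -> @is_iso (acat A) X Y f.
Proof.
by move=> X0 Y0; exists 0; split=> /=; rewrite ?acomp0l ?acomp0r ?X0 ?Y0.
Qed.

Lemma is_zero_mono (X Y : A) (f : ahom X Y) : mono f -> is_zero Y -> is_zero X.
Proof. by move=> mf Y0; apply: (mono_eq0 mf); apply: zero_cod. Qed.

Lemma is_zero_epi (X Y : A) (f : ahom X Y) : epi f -> is_zero X -> is_zero Y.
Proof. by move=> ef X0; apply: (epi_eq0 ef); apply: zero_dom. Qed.

Lemma is_zero_bip (X Y : A) : is_zero X -> is_zero Y -> is_zero (abip X Y).
Proof.
move=> X0 Y0; rewrite /is_zero -abipP.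
by rewrite (zero_cod (afst X Y) X0) (zero_cod (asnd X Y) Y0) !acomp0r addr0.
Qed.

(** ** The five lemma *)

Definition exact_pair (X Y Z : A) (f : ahom X Y) (g : ahom Y Z) : Prop :=
  g \oa f = 0 /\
  forall T (y : ahom T Y), g \oa y = 0 ->
  exists (T' : A) (p : ahom T' T) (x : ahom T' X), epi p /\ f \oa x = y \oa p.

Lemma five_lemma (X1 X2 X3 X4 X5 Y1 Y2 Y3 Y4 Y5 : A)
    (f1 : ahom X1 X2) (f2 : ahom X2 X3) (f3 : ahom X3 X4) (f4 : ahom X4 X5)
    (g1 : ahom Y1 Y2) (g2 : ahom Y2 Y3) (g3 : ahom Y3 Y4) (g4 : ahom Y4 Y5)
    (h1 : ahom X1 Y1) (h2 : ahom X2 Y2) (h3 : ahom X3 Y3) (h4 : ahom X4 Y4)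
    (h5 : ahom X5 Y5) :
  exact_pair f1 f2 -> exact_pair f2 f3 -> exact_pair f3 f4 ->
  exact_pair g1 g2 -> exact_pair g2 g3 -> exact_pair g3 g4 ->
  h2 \oa f1 = g1 \oa h1 -> h3 \oa f2 = g2 \oa h2 ->
  h4 \oa f3 = g3 \oa h3 -> h5 \oa f4 = g4 \oa h4 ->
  epi h1 -> mono h2 -> epi h2 -> mono h4 -> epi h4 -> mono h5 ->
  mono h3 /\ epi h3.
Proof.
move=> [f21 F2] [f32 F3] [f43 F4] [g21 G2] [g32 G3] [g43 G4] E1 E2 E3 E4.
move=> eh1 mh2 eh2 mh4 eh4 mh5; split.
  apply: mono0 => T x hx0.
  have fx0 : f3 \oa x = 0.
    by apply: (mono_eq0 mh4); rewrite acompA E3 -acompA hx0 acomp0r.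
  have [T1 [p1 [x2 [ep1 Ex2]]]] := F3 _ _ fx0.
  have /G2[T2 [p2 [y1 [ep2 Ey1]]]] : g2 \oa (h2 \oa x2) = 0.
    by rewrite acompA -E2 -acompA Ex2 acompA hx0 acomp0l.
  have [T3 [p3 [x1 [ep3 Ex1]]]] := epi_pullback y1 eh1.
  apply: (epi_eq0 (epi_comp ep1 (epi_comp ep2 ep3))).
  have E : f1 \oa x1 = x2 \oa (p2 \oa p3).
    by apply: mh2; rewrite acompA E1 -acompA Ex1 acompA Ey1 -!acompA.
  by rewrite acompA -Ex2 -acompA -E acompA f21 acomp0l.
apply: epi0 => Z k kh0.
(* A morphism out of [Y3] vanishes if it does so on an epi cover, and locally
   every element of [Y3] comes from [X3]. *)
suff [T [p [x [ep Ex]]]] : exists (T : A) (p : ahom T Y3) (x : ahom T X3),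
    epi p /\ h3 \oa x = p.
  by apply: (epi_eq0 ep); rewrite -Ex acompA kh0 acomp0l.
have [T1 [p1 [x4 [ep1 Ex4]]]] := epi_pullback g3 eh4.
have /F4[T2 [p2 [x3 [ep2 Ex3]]]] : f4 \oa x4 = 0.
  by apply: (mono_eq0 mh5); rewrite acompA E4 -acompA Ex4 acompA g43 acomp0l.
have /G3[T3 [p3 [y2 [ep3 Ey2]]]] : g3 \oa (p1 \oa p2 - h3 \oa x3) = 0.
  by rewrite acompBr !acompA -E3 -[in X in _ - X]acompA Ex3 acompA Ex4 subrr.
have [T4 [p4 [x2 [ep4 Ex2]]]] := epi_pullback y2 eh2.
exists T4, (p1 \oa p2 \oa p3 \oa p4), (x3 \oa p3 \oa p4 + f2 \oa x2); split.
  by do 3 (apply: epi_comp => //).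
rewrite acompDr [X in _ + X]acompA E2 -[X in _ + X]acompA Ex2.
rewrite [X in _ + X]acompA Ey2 !acompBl !acompA.
by rewrite addrC subrK.
Qed.

End LocalElements.

(** * Cohomology in terms of local elements *)

Section CyclesBoundaries.
Variable A : abelian.
Implicit Types (X Y Z : cplx A) (T : A).

Definition cyc X i T (z : ahom T (X i)) : Prop := forall j, cd X i j \oa z = 0.

(** [z] becomes a boundary on an epi cover of [T]. The degree [j] is left free:
    [cd X j i] vanishes unless [j + 1 = i], so nothing is gained, and no cast
    between equal degrees is ever needed. *)
Definition bnd X i T (z : ahom T (X i)) : Prop :=
  exists (T' : A) (p : ahom T' T) (j : int) (w : ahom T' (X j)),
    epi p /\ cd X j i \oa w = z \oa p.

Lemma cyc_next X i T (z : ahom T (X i)) : cd X i (i + 1) \oa z = 0 -> cyc z.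
Proof.
move=> z0 j; have [<- //|ij] := eqVneq (i + 1) j.
by rewrite (cd_shape X ij) acomp0l.
Qed.

Lemma cycB X i T (z z' : ahom T (X i)) : cyc z -> cyc z' -> cyc (z - z').
Proof. by move=> cz cz' j; rewrite acompBr cz cz' subrr. Qed.

Lemma cyc_pre X i T T' (z : ahom T (X i)) (p : ahom T' T) :
  cyc z -> cyc (z \oa p).
Proof. by move=> cz j; rewrite acompA cz acomp0l. Qed.

Lemma cyc_map X Y (f : chain X Y) i T (z : ahom T (X i)) :
  cyc z -> cyc (f i \oa z).
Proof. by move=> cz j; rewrite acompA cmapP -acompA cz acomp0r. Qed.

Lemma bnd0 X i T : bnd (0 : ahom T (X i)).
Proof.
exists T, (aid T), i, 0; split; first exact: epi_id.
by rewrite acomp0r acomp0l.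
Qed.

Lemma bnd_cd X i j T (w : ahom T (X j)) : bnd (cd X j i \oa w).
Proof.
by exists T, (aid T), j, w; split; [exact: epi_id | rewrite acomp1r].
Qed.

Lemma bnd_eq0 X i T (z : ahom T (X i)) : z = 0 -> bnd z.
Proof. by move=> ->; apply: bnd0. Qed.

Lemma bnd_loc X i T T' (z : ahom T (X i)) (p : ahom T' T) :
  epi p -> bnd (z \oa p) -> bnd z.
Proof.
move=> ep [T2 [q [j [w [eq Ew]]]]]; exists T2, (p \oa q), j, w.
by split; [exact: epi_comp | rewrite acompA].
Qed.

Lemma bnd_prev X i T (z : ahom T (X i)) : bnd z ->
  exists (T' : A) (p : ahom T' T) (w : ahom T' (X (i - 1))),
    epi p /\ cd X (i - 1) i \oa w = z \oa p.
Proof.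
move=> [T2 [q [j [w [eq Ew]]]]]; have [ji|ji] := eqVneq (j + 1) i.
  have {ji} E : j = i - 1 by lia.
  by subst j; exists T2, q, w.
exists T2, q, 0; split=> //; rewrite -Ew (cd_shape X ji).
by rewrite acomp0l acomp0r.
Qed.

Lemma bndN X i T (z : ahom T (X i)) : bnd z -> bnd (- z).
Proof.
move=> [T2 [q [j [w [eq Ew]]]]]; exists T2, q, j, (- w); split=> //.
by rewrite acompNl acompNr Ew.
Qed.

(** ** Cohomology classes of cycles *)

(** An epi cover carries every element of [H^i] to the class of a cycle
    ([cls_surj] below), so that maps out of cohomology are determined by their
    values on classes. *)
Definition cls X i T (z : ahom T (X i)) (cz : cyc z) : ahom T (cohomology X i) :=
  cproj (to_cycles X i) \oa klift (cz (i + 1)).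

Lemma cls_eq0 X i T (z : ahom T (X i)) (cz : cyc z) : cls cz = 0 -> bnd z.
Proof.
case/coker_eq0_lift => T' [p [w [ep Ew]]].
exists T', p, (i - 1), w; split=> //.
rewrite -(kinc_lift (cd_sq X (i - 1) i (i + 1))) -acompA Ew.
by rewrite acompA kinc_lift.
Qed.

Lemma bnd_cls X i T (z : ahom T (X i)) (cz : cyc z) : bnd z -> cls cz = 0.
Proof.
case/bnd_prev => T' [p [w [ep Ew]]]; apply: (lift_coker_eq0 ep (x := w)).
by apply: kinc_mono; rewrite !acompA !kinc_lift.
Qed.

Lemma cls_irr X i T (z z' : ahom T (X i)) (cz : cyc z) (cz' : cyc z') :
  z = z' -> cls cz = cls cz'.
Proof.
move=> e; congr (_ \oa _); apply: kinc_mono; rewrite !kinc_lift //.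
Qed.

Lemma cls_pre X i T T' (z : ahom T (X i)) (cz : cyc z) (p : ahom T' T)
    (czp : cyc (z \oa p)) : cls cz \oa p = cls czp.
Proof.
rewrite /cls -acompA; congr (_ \oa _); apply: kinc_mono.
by rewrite acompA !kinc_lift.
Qed.

Lemma clsB X i T (z z' : ahom T (X i)) (cz : cyc z) (cz' : cyc z')
    (czz : cyc (z - z')) : cls czz = cls cz - cls cz'.
Proof.
rewrite /cls -acompBr; congr (_ \oa _); apply: kinc_mono.
by rewrite acompBr !kinc_lift.
Qed.

Lemma cls_surj X i T (h : ahom T (cohomology X i)) :
  exists (T' : A) (p : ahom T' T) (z : ahom T' (X i)) (cz : cyc z),
    epi p /\ cls cz = h \oa p.
Proof.
have [T' [p [x [ep Ex]]]] := epi_pullback h (@cproj_is_epi _ _ _ (to_cycles X i)).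
have cz : cyc (kinc (cd X i (i + 1)) \oa x).
  by apply: cyc_next; rewrite acompA kinc0 acomp0l.
exists T', p, _, cz; split=> //; rewrite -Ex; congr (_ \oa _).
by apply: kinc_mono; rewrite kinc_lift.
Qed.

Lemma cohomology_map_cls X Y (f : chain X Y) i T (z : ahom T (X i))
    (cz : cyc z) (cfz : cyc (f i \oa z)) :
  cohomology_map f i \oa cls cz = cls cfz.
Proof.
rewrite /cls acompA cdesc_proj -acompA; congr (_ \oa _); apply: kinc_mono.
by rewrite acompA kinc_lift -acompA !kinc_lift.
Qed.

Lemma cohomology_ext X i (Z : A) (g g' : ahom (cohomology X i) Z) :
  (forall T (z : ahom T (X i)) (cz : cyc z), g \oa cls cz = g' \oa cls cz) ->
  g = g'.
Proof.
move=> H; have [T [p [z [cz [ep Ez]]]]] := cls_surj (aid (cohomology X i)).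
by apply: ep; have := H T z cz; rewrite Ez acomp1l.
Qed.

Lemma cohomology_eq0 X i :
  is_zero (cohomology X i) <-> forall T (z : ahom T (X i)), cyc z -> bnd z.
Proof.
split=> [H0 T z cz|H]; first by apply: (cls_eq0 (cz := cz)); apply: zero_cod.
by apply: cohomology_ext => T z cz; rewrite bnd_cls ?acomp0r //; apply: H.
Qed.

Lemma cohomology_map_mono X Y (f : chain X Y) i :
  mono (cohomology_map f i) <->
  forall T (z : ahom T (X i)), cyc z -> bnd (f i \oa z) -> bnd z.
Proof.
split=> [mf T z cz bfz|H].
  apply: (cls_eq0 (cz := cz)); apply: (mono_eq0 mf).
  by rewrite (cohomology_map_cls _ (cyc_map f cz)) bnd_cls.
apply: mono0 => T h fh0; have [T' [p [z [cz [ep Ez]]]]] := cls_surj h.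
apply: (epi_eq0 ep); rewrite -Ez bnd_cls //; apply: H => //.
apply: (cls_eq0 (cz := cyc_map f cz)).
by rewrite -cohomology_map_cls Ez acompA fh0 acomp0l.
Qed.

Lemma cohomology_map_epi X Y (f : chain X Y) i :
  epi (cohomology_map f i) <->
  forall T (y : ahom T (Y i)), cyc y ->
  exists (T' : A) (p : ahom T' T) (x : ahom T' (X i)),
    [/\ epi p, cyc x & bnd (y \oa p - f i \oa x)].
Proof.
split=> [ef T y cy|H].
  have [T1 [p1 [h [ep1 Eh]]]] := epi_pullback (cls cy) ef.
  have [T2 [p2 [x [cx [ep2 Ex]]]]] := cls_surj h.
  exists T2, (p1 \oa p2), x; split=> //; first exact: epi_comp.
  have cyp := cyc_pre (p1 \oa p2) cy; have cfx := cyc_map f cx.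
  apply: (cls_eq0 (cz := cycB cyp cfx)).
  rewrite (clsB cyp cfx) -(cohomology_map_cls cx) Ex -(cls_pre cy).
  by rewrite !acompA Eh subrr.
apply: epi0 => Z g gf0; apply: cohomology_ext => T y cy; rewrite acomp0l.
have [T' [p [x [ep cx bx]]]] := H _ _ cy.
apply: (epi_eq0 ep); rewrite -acompA (cls_pre cy (cyc_pre p cy)).
have cyp := cyc_pre p cy; have cfx := cyc_map f cx.
have := bnd_cls (cycB cyp cfx) bx; rewrite (clsB cyp cfx) => /eqP.
rewrite subr_eq0 => /eqP E; rewrite (cls_irr (cyc_pre p cy) cyp) // E.
by rewrite -(cohomology_map_cls cx) acompA gf0 acomp0l.
Qed.

Definition coh_iso X Y (f : chain X Y) i : Prop :=
  @is_iso (acat A) _ _ (cohomology_map f i).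

(** Mono and epi on cohomology, spelled out on local elements; in this form the
    quasi-isomorphisms below are verified by chasing. *)
Lemma coh_isoI X Y (f : chain X Y) i :
  (forall T (z : ahom T (X i)), cyc z -> bnd (f i \oa z) -> bnd z) ->
  (forall T (y : ahom T (Y i)), cyc y ->
   exists (T' : A) (p : ahom T' T) (x : ahom T' (X i)),
    [/\ epi p, cyc x & bnd (y \oa p - f i \oa x)]) ->
  coh_iso f i.
Proof.
by move=> /cohomology_map_mono mf /cohomology_map_epi ef; apply: mono_epi_iso.
Qed.

Lemma coh_iso_inj X Y (f : chain X Y) i T (z : ahom T (X i)) :
  coh_iso f i -> cyc z -> bnd (f i \oa z) -> bnd z.
Proof. by move/iso_mono/cohomology_map_mono; apply. Qed.

Lemma coh_iso_surj X Y (f : chain X Y) i T (y : ahom T (Y i)) :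
  coh_iso f i -> cyc y ->
  exists (T' : A) (p : ahom T' T) (x : ahom T' (X i)),
    [/\ epi p, cyc x & bnd (y \oa p - f i \oa x)].
Proof. by move/iso_epi/cohomology_map_epi; apply. Qed.

Definition qis X Y (f : chain X Y) : Prop := @quasi_iso A X Y f.

Lemma coh_iso_zero X Y (f : chain X Y) i :
  is_zero (cohomology X i) -> is_zero (cohomology Y i) -> coh_iso f i.
Proof. exact: zero_iso. Qed.

Lemma cohomology_term0 X i : is_zero (X i) -> is_zero (cohomology X i).
Proof.
by move=> X0; apply/cohomology_eq0 => T z _; apply: bnd_eq0; apply: zero_cod.
Qed.

(** ** Homotopies *)

Lemma homotopicP X Y (f g : chain X Y) :
  homotopic f g <-> exists s : forall i j, ahom (X i) (Y j),
    forall i j l, j + 1 = i -> i + 1 = l ->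
    f i - g i = cd Y j i \oa s i j + s l i \oa cd X i l.
Proof.
split=> -[s sP]; exists s; last by move=> i; apply: sP => //; rewrite subrK.
move=> i j l ji il.
have E : j = i - 1 by lia.
by subst j l; apply: sP.
Qed.

Lemma homotopic_bnd X Y (f g : chain X Y) i T (z : ahom T (X i)) :
  homotopic f g -> cyc z -> bnd (f i \oa z - g i \oa z).
Proof.
case=> s sP cz; rewrite -acompBl sP acompDl -!acompA cz acomp0r addr0.
exact: bnd_cd.
Qed.

Lemma homotopic_cohomology X Y (f g : chain X Y) i :
  homotopic f g -> cohomology_map f i = cohomology_map g i.
Proof.
move=> fg; apply: cohomology_ext => T z cz.
have cf := cyc_map f cz; have cg := cyc_map g cz.
rewrite (cohomology_map_cls _ cf) (cohomology_map_cls _ cg).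
apply/eqP; rewrite -subr_eq0; apply/eqP.
by rewrite -(clsB cf cg (cycB cf cg)) bnd_cls //; apply: homotopic_bnd.
Qed.

Lemma cohomology_map_id X i : cohomology_map (chain_id X) i = aid _.
Proof.
apply: cohomology_ext => T z cz.
rewrite (cohomology_map_cls _ (cyc_map (chain_id X) cz)) acomp1l.
by apply: cls_irr; rewrite /= acomp1l.
Qed.

Lemma cohomology_map_comp X Y Z (g : chain Y Z) (f : chain X Y) i :
  cohomology_map (chain_comp g f) i = cohomology_map g i \oa cohomology_map f i.
Proof.
apply: cohomology_ext => T z cz; have cf := cyc_map f cz.
rewrite -acompA (cohomology_map_cls _ (cyc_map (chain_comp g f) cz)).
rewrite (cohomology_map_cls _ cf) (cohomology_map_cls _ (cyc_map g cf)).
by apply: cls_irr; rewrite /= acompA.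
Qed.

End CyclesBoundaries.

(** * Mapping cones, shifts and homotopy pullbacks *)

Section Pairs.
Variable A : abelian.
Implicit Types X Y T : A.

Definition apair X Y T (x : ahom T X) (y : ahom T Y) : ahom T (abip X Y) :=
  ainl X Y \oa x + ainr X Y \oa y.

Lemma fst_apair X Y T (x : ahom T X) (y : ahom T Y) :
  afst X Y \oa apair x y = x.
Proof. by rewrite acompDr ainlK ainrK addr0. Qed.

Lemma snd_apair X Y T (x : ahom T X) (y : ahom T Y) :
  asnd X Y \oa apair x y = y.
Proof. by rewrite acompDr ainlK ainrK add0r. Qed.

Lemma apair_eta X Y T (c : ahom T (abip X Y)) :
  c = apair (afst X Y \oa c) (asnd X Y \oa c).
Proof. by rewrite /apair !acompA -acompDl abipP acomp1l. Qed.

Lemma apair_pre X Y T T' (x : ahom T X) (y : ahom T Y) (p : ahom T' T) :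
  apair x y \oa p = apair (x \oa p) (y \oa p).
Proof. by rewrite /apair acompDl -!acompA. Qed.

Lemma apairD X Y T (x x' : ahom T X) (y y' : ahom T Y) :
  apair x y + apair x' y' = apair (x + x') (y + y').
Proof. by rewrite /apair !acompDr addrACA. Qed.

Lemma apairN X Y T (x : ahom T X) (y : ahom T Y) :
  - apair x y = apair (- x) (- y).
Proof. by rewrite /apair !acompNr opprD. Qed.

Lemma apair0 X Y T : apair (0 : ahom T X) (0 : ahom T Y) = 0.
Proof. by rewrite /apair !acomp0r addr0. Qed.

Lemma apair_inj X Y T (x x' : ahom T X) (y y' : ahom T Y) :
  apair x y = apair x' y' -> x = x' /\ y = y'.
Proof.
by move=> e; split; [rewrite -(fst_apair x y) e fst_apair |
  rewrite -(snd_apair x y) e snd_apair].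
Qed.

Lemma apair_eq0 X Y T (x : ahom T X) (y : ahom T Y) :
  apair x y = 0 -> x = 0 /\ y = 0.
Proof. by rewrite -apair0 => /apair_inj. Qed.

Lemma ahom_ext X Y (u v : ahom X Y) :
  (forall T (x : ahom T X), u \oa x = v \oa x) -> u = v.
Proof. by move=> /(_ X (aid X)); rewrite !acomp1r. Qed.

Lemma apair_ind X Y T (Pr : ahom T (abip X Y) -> Prop) :
  (forall x y, Pr (apair x y)) -> forall c, Pr c.
Proof. by move=> H c; rewrite (apair_eta c). Qed.

Lemma ainrE X Y T (y : ahom T Y) : ainr X Y \oa y = apair 0 y.
Proof. by rewrite /apair acomp0r add0r. Qed.

Lemma ainlE X Y T (x : ahom T X) : ainl X Y \oa x = apair x 0.
Proof. by rewrite /apair acomp0r addr0. Qed.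

Lemma idd_trans (I : eqType) (F : I -> A) i j k :
  i = j -> idd F j k \oa idd F i j = idd F i k.
Proof. by move=> <-; rewrite idd_refl acomp1r. Qed.

Lemma idd_transK (I : eqType) (F : I -> A) i j T (x : ahom T (F i)) :
  i = j -> idd F j i \oa (idd F i j \oa x) = x.
Proof. by move=> <-; rewrite idd_refl !acomp1l. Qed.

End Pairs.

Section ChainMaps.
Variable A : abelian.
Implicit Types X Y Z W : cplx A.

Lemma idd_cd X i j k T (x : ahom T (X i)) :
  j = k -> idd X j k \oa (cd X i j \oa x) = cd X i k \oa x.
Proof. by move=> <-; rewrite idd_refl acomp1l. Qed.

Lemma cd_idd X i j k T (x : ahom T (X i)) :
  i = j -> cd X j k \oa (idd X i j \oa x) = cd X i k \oa x.
Proof. by move=> <-; rewrite idd_refl acomp1l. Qed.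

Lemma chain_idd X Y (f : chain X Y) i j :
  f j \oa idd X i j = idd Y i j \oa f i.
Proof.
have [<-|ij] := eqVneq i j; first by rewrite !idd_refl acomp1r acomp1l.
by rewrite !(idd_neq _ ij) acomp0l acomp0r.
Qed.

Lemma chain_cd X Y (f : chain X Y) i j T (x : ahom T (X i)) :
  cd Y i j \oa (f i \oa x) = f j \oa (cd X i j \oa x).
Proof. by rewrite acompA cmapP acompA. Qed.

Lemma cd_cd X i j k T (x : ahom T (X i)) : cd X j k \oa (cd X i j \oa x) = 0.
Proof. by rewrite acompA cd_sq acomp0l. Qed.

(** The differentials other than [X_i -> X_(i+1)] being zero, a family of maps
    is a chain map as soon as it commutes with these. *)
Lemma chain_next X Y (f : forall i, ahom (X i) (Y i)) :
  (forall i T (x : ahom T (X i)),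
    cd Y i (i + 1) \oa (f i \oa x) = f (i + 1) \oa (cd X i (i + 1) \oa x)) ->
  forall i j, cd Y i j \oa f i = f j \oa cd X i j.
Proof.
move=> H i j; have [<-|ij] := eqVneq (i + 1) j.
  by apply: ahom_ext => T x; rewrite -!acompA H.
by rewrite !(cd_shape _ ij) acomp0l acomp0r.
Qed.

Definition shift_chain X Y (f : chain X Y) (k : int) :
  chain (shift X k) (shift Y k).
Proof.
exists (fun i => f (i + k)) => i j /=.
by case: ifP => _; rewrite ?acompNl ?acompNr cmapP.
Defined.

(** Cycles and boundaries of a shift are those of the complex: its differential
    differs from the original one by a sign. *)
Lemma cyc_shift X k i T (z : ahom T (X (i + k))) :
  @cyc _ (shift X k) i T z <-> cyc z.
Proof.
split=> cz j; last by rewrite /=; case: ifP => _; rewrite ?acompNl cz ?oppr0.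
have := cz (j - k); rewrite /= subrK; case: ifP => _ //.
by rewrite acompNl => /eqP; rewrite oppr_eq0 => /eqP.
Qed.

Lemma bnd_shift X k i T (z : ahom T (X (i + k))) :
  @bnd _ (shift X k) i T z <-> bnd z.
Proof.
split=> [[T' [p [j [w [ep Ew]]]]]|/bnd_prev[T' [p [w [ep Ew]]]]].
  exists T', p, (j + k); move: Ew => /=; case: ifP => _ Ew; last by exists w.
  by exists (- w); rewrite acompNr -acompNl.
have E : i + k - 1 = i - 1 + k by lia.
rewrite E in w Ew; exists T', p, (i - 1).
exists (if odd `|k|%N then - w else w); split=> //=.
by case: ifP => _; rewrite ?acompNl ?acompNr ?opprK.
Qed.

Lemma shift_coh_iso X Y (f : chain X Y) k i :
  coh_iso f (i + k) -> coh_iso (shift_chain f k) i.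
Proof.
move=> H; apply: coh_isoI => T z.
  move=> /cyc_shift cz /bnd_shift bz; apply/bnd_shift.
  exact: coh_iso_inj H cz bz.
move=> /cyc_shift cz; have [T' [p [x [ep cx bx]]]] := coh_iso_surj H cz.
exists T', p, x; split=> //; first by apply/(@cyc_shift X k i).
by apply/(@bnd_shift Y k i).
Qed.

Lemma shift_qis X Y (f : chain X Y) k : qis f -> qis (shift_chain f k).
Proof. by move=> H i; apply: (@shift_coh_iso X Y f k i (H _)). Qed.

Lemma shift_cohomology0 X k i :
  is_zero (cohomology (shift X k) i) <-> is_zero (cohomology X (i + k)).
Proof.
rewrite !cohomology_eq0; split=> H T z.
  by move/cyc_shift/H/bnd_shift.
by move/cyc_shift/H/bnd_shift.
Qed.

Section Cone.
Variables (X Y : cplx A) (f : chain X Y).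

Lemma cone_cd i T (x : ahom T (X (i + 1))) (y : ahom T (Y i)) :
  cd (cone f) i (i + 1) \oa apair x y =
  apair (- (cd X (i + 1) (i + 1 + 1) \oa x))
        (f (i + 1) \oa x + cd Y i (i + 1) \oa y).
Proof.
rewrite /= idd_refl acomp1l acompDl -!acompA acompDl -!acompA.
by rewrite fst_apair snd_apair acompNl.
Qed.

Definition cone_in : chain Y (cone f).
Proof.
exists (fun i => ainr (X (i + 1)) (Y i)); apply: chain_next => i T x.
by rewrite [X in _ \oa X]ainrE cone_cd ainrE !acomp0r oppr0 add0r.
Defined.

Definition cone_out : chain (cone f) (shift X 1).
Proof.
exists (fun i => afst (X (i + 1)) (Y i)); apply: chain_next => i T.
by apply: apair_ind => x y; rewrite cone_cd !fst_apair /= acompNl.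
Defined.

Lemma cyc_cone i T (x : ahom T (X (i + 1))) (y : ahom T (Y i)) :
  @cyc _ (cone f) i T (apair x y) <->
  cyc x /\ f (i + 1) \oa x + cd Y i (i + 1) \oa y = 0.
Proof.
split=> [/(_ (i + 1))|[cx cy]]; last first.
  by apply: cyc_next; rewrite cone_cd cx cy oppr0 apair0.
rewrite cone_cd => /apair_eq0[/eqP]; rewrite oppr_eq0 => /eqP cx cy.
by split=> //; apply: cyc_next.
Qed.

Lemma bnd_cone i T (x : ahom T (X (i + 1 + 1))) (y : ahom T (Y (i + 1))) :
  @bnd _ (cone f) (i + 1) T (apair x y) <->
  exists (T' : A) (p : ahom T' T) (u : ahom T' (X (i + 1))) (w : ahom T' (Y i)),
  [/\ epi p, cd X (i + 1) (i + 1 + 1) \oa u = - (x \oa p)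
    & f (i + 1) \oa u + cd Y i (i + 1) \oa w = y \oa p].
Proof.
split=> [/bnd_prev[T' [p [c [ep Ec]]]]|[T' [p [u [w [ep Eu Ew]]]]]].
  rewrite addrK in c Ec; exists T', p; elim/apair_ind: c Ec => u w.
  rewrite cone_cd apair_pre => /apair_inj[Eu Ew]; exists u, w; split=> //.
  by rewrite -Eu opprK.
exists T', p, i, (apair u w); split=> //.
by rewrite cone_cd apair_pre Eu Ew opprK.
Qed.

End Cone.
End ChainMaps.
(** ** The long exact sequence of a cone *)

Section ConeExactness.
Variable A : abelian.
Implicit Types X Y Z W : cplx A.

Lemma bnd_succ X i T (z : ahom T (X (i + 1))) : bnd z ->
  exists (T' : A) (p : ahom T' T) (w : ahom T' (X i)),
    epi p /\ cd X i (i + 1) \oa w = z \oa p.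
Proof. by move/bnd_prev; rewrite addrK. Qed.

Lemma coh_exact X Y Z (f : chain X Y) (g : chain Y Z) i :
  (forall T (x : ahom T (X i)), cyc x -> bnd (g i \oa (f i \oa x))) ->
  (forall T (y : ahom T (Y i)), cyc y -> bnd (g i \oa y) ->
   exists (T' : A) (p : ahom T' T) (x : ahom T' (X i)),
    [/\ epi p, cyc x & bnd (y \oa p - f i \oa x)]) ->
  exact_pair (cohomology_map f i) (cohomology_map g i).
Proof.
move=> gf0 H; split=> [|T h gh0].
  apply: cohomology_ext => T x cx.
  have cf := cyc_map f cx; rewrite -acompA (cohomology_map_cls _ cf).
  rewrite (cohomology_map_cls _ (cyc_map g cf)) acomp0l bnd_cls //.
  exact: gf0.
have [T1 [p1 [y [cy [ep1 Ey]]]]] := cls_surj h.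
have by0 : bnd (g i \oa y).
  apply: (cls_eq0 (cz := cyc_map g cy)).
  by rewrite -(cohomology_map_cls cy) Ey acompA gh0 acomp0l.
have [T2 [p2 [x [ep2 cx bx]]]] := H _ _ cy by0.
exists T2, (p1 \oa p2), (cls cx); split; first exact: epi_comp.
have cyp := cyc_pre p2 cy; have cfx := cyc_map f cx.
rewrite (cohomology_map_cls _ cfx) acompA -Ey (cls_pre cy cyp).
apply/eqP; rewrite eq_sym -subr_eq0; apply/eqP.
by rewrite -(clsB cyp cfx (cycB cyp cfx)) bnd_cls.
Qed.

Section OneCone.
Variables (X Y : cplx A) (f : chain X Y).

Lemma cone_exact_base i :
  exact_pair (cohomology_map f i) (cohomology_map (cone_in f) i).
Proof.
have [j E] : exists j : int, i = j + 1 by exists (i - 1); rewrite subrK.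
subst i; apply: coh_exact => T z cz.
  rewrite ainrE; apply/bnd_cone; exists T, (aid T), z, 0.
  by rewrite cz acomp0l oppr0 !acomp0r acomp1r addr0; split=> //; apply: epi_id.
rewrite ainrE => /bnd_cone[T' [p [u [w [ep Eu Ew]]]]].
exists T', p, u; split=> //.
  by apply: cyc_next; rewrite Eu acomp0l oppr0.
by rewrite -Ew [X in bnd X]hC addKr; apply: bnd_cd.
Qed.

Lemma cone_exact_mid i :
  exact_pair (cohomology_map (cone_in f) i) (cohomology_map (cone_out f) i).
Proof.
have [j E] : exists j : int, i = j + 1 by exists (i - 1); rewrite subrK.
subst i; apply: coh_exact => T.
  by move=> y _; rewrite ainrE fst_apair; apply: bnd0.
apply: apair_ind => x y /cyc_cone[cx Ey]; rewrite fst_apair.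
move=> /(@bnd_shift _ X 1)/bnd_succ[T' [p [w [ep Ew]]]].
exists T', p, (y \oa p + f (j + 1) \oa w); split=> //.
  apply: cyc_next; rewrite acompDr chain_cd Ew acompA.
  by rewrite hC !acompA -acompDl Ey acomp0l.
rewrite ainrE apair_pre apairN apairD; apply/bnd_cone.
exists T', (aid T'), (- w), 0; split; first exact: epi_id.
  by rewrite acompNr Ew oppr0 addr0 acomp1r.
by rewrite acomp1r acomp0r addr0 acompNr opprD addNKr.
Qed.

Lemma cone_exact_top i :
  exact_pair (cohomology_map (cone_out f) i)
             (cohomology_map (shift_chain f 1) i).
Proof.
apply: coh_exact => T.
  apply: apair_ind => x y /cyc_cone[cx Ey]; rewrite fst_apair.
  apply/(@bnd_shift _ Y 1); move/eqP: Ey; rewrite addr_eq0 => /eqP ->.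
  by apply: bndN; apply: bnd_cd.
move=> x /(@cyc_shift _ X 1) cx /(@bnd_shift _ Y 1)/bnd_succ[T' [p [w [ep Ew]]]].
exists T', p, (apair (x \oa p) (- w)); split=> //.
  by apply/cyc_cone; split; [apply: cyc_pre | rewrite acompNr Ew acompA subrr].
by rewrite fst_apair subrr; apply: bnd0.
Qed.

End OneCone.

(** ** Functoriality of the cone *)

Section ConeMap.
Variables (X Y X' Y' : cplx A) (f : chain X Y) (f' : chain X' Y').
Variables (a : chain X X') (b : chain Y Y').

Lemma cone_map_exists : homotopic (chain_comp b f) (chain_comp f' a) ->
  exists c : chain (cone f) (cone f'),
    (forall i, c i \oa cone_in f i = cone_in f' i \oa b i) /\
    (forall i, cone_out f' i \oa c i = a (i + 1) \oa cone_out f i).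
Proof.
case/homotopicP => s sP.
pose c i := apair (a (i + 1) \oa afst (X (i + 1)) (Y i))
  (b i \oa asnd (X (i + 1)) (Y i) + s (i + 1) i \oa afst (X (i + 1)) (Y i)).
have cE i T (x : ahom T (X (i + 1))) (y : ahom T (Y i)) : c i \oa apair x y =
    apair (a (i + 1) \oa x) (b i \oa y + s (i + 1) i \oa x).
  by rewrite apair_pre acompDl -!acompA fst_apair snd_apair.
have cP : forall i T (x : ahom T (cone f i)),
    cd (cone f') i (i + 1) \oa (c i \oa x) =
    c (i + 1) \oa (cd (cone f) i (i + 1) \oa x).
  move=> i T; apply: apair_ind => x y; rewrite cone_cd !cE cone_cd; congr apair.
    by rewrite acompNr chain_cd.
  rewrite !acompDr !acompNr chain_cd.
  have := congr1 (fun u => u \oa x) (sP (i + 1) i (i + 1 + 1) erefl erefl).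
  rewrite /= acompBl acompDl -!acompA => /eqP.
  rewrite subr_eq => /eqP ->; set u := f' _ \oa _; set v := cd Y' _ _ \oa _.
  set w := s _ _ \oa _; set z := b _ \oa _.
  abel.
exists (Chain (chain_next cP)); split=> i; apply: ahom_ext => T x /=.
  rewrite -!acompA [ainr _ _ \oa x]ainrE cE !acomp0r addr0 ainrE //.
by elim/apair_ind: x => x y; rewrite -!acompA cE !fst_apair.
Qed.

(** The long exact sequences of both cones and the five lemma. *)
Lemma cone_map_qis (c : chain (cone f) (cone f')) :
  homotopic (chain_comp b f) (chain_comp f' a) ->
  (forall i, c i \oa cone_in f i = cone_in f' i \oa b i) ->
  (forall i, cone_out f' i \oa c i = a (i + 1) \oa cone_out f i) ->
  qis a -> qis b -> qis c.
Proof.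
move=> h cin cout qa qb i.
have E1 : cohomology_map b i \oa cohomology_map f i =
          cohomology_map f' i \oa cohomology_map a i.
  by rewrite -!cohomology_map_comp; apply: homotopic_cohomology.
have E2 : cohomology_map c i \oa cohomology_map (cone_in f) i =
          cohomology_map (cone_in f') i \oa cohomology_map b i.
  rewrite -!cohomology_map_comp; apply: homotopic_cohomology.
  exact: homotopic_eq.
have E3 : cohomology_map (shift_chain a 1) i \oa cohomology_map (cone_out f) i =
          cohomology_map (cone_out f') i \oa cohomology_map c i.
  rewrite -!cohomology_map_comp; apply: homotopic_cohomology.
  by apply: homotopic_eq => j; rewrite /= cout.
have E4 : cohomology_map (shift_chain b 1) i \oa
            cohomology_map (shift_chain f 1) i =
          cohomology_map (shift_chain f' 1) i \oa
            cohomology_map (shift_chain a 1) i.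
  rewrite -!cohomology_map_comp; apply: cohomology_ext => T z cz.
  have c1 := cyc_map (chain_comp (shift_chain b 1) (shift_chain f 1)) cz.
  have c2 := cyc_map (chain_comp (shift_chain f' 1) (shift_chain a 1)) cz.
  rewrite (cohomology_map_cls _ c1) (cohomology_map_cls _ c2).
  apply/eqP; rewrite -subr_eq0; apply/eqP.
  rewrite -(clsB c1 c2 (cycB c1 c2)) bnd_cls //; apply/(@bnd_shift _ Y' 1).
  by apply: (homotopic_bnd h); apply/(@cyc_shift _ X 1).
have ia := qa i; have ib := qb i.
have ia1 := shift_qis 1 qa i; have ib1 := shift_qis 1 qb i.
have [] := five_lemma (cone_exact_base f i) (cone_exact_mid f i)
  (cone_exact_top f i) (cone_exact_base f' i) (cone_exact_mid f' i)
  (cone_exact_top f' i) E1 E2 E3 E4 (iso_epi ia) (iso_mono ib) (iso_epi ib)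
  (iso_mono ia1) (iso_epi ia1) (iso_mono ib1).
exact: mono_epi_iso.
Qed.

End ConeMap.

(** ** Two identifications of cones *)

(** The cone of the inclusion [Y -> cone f] is [X[1]] up to quasi-isomorphism:
    this is the rotation of triangles. *)
Definition cone_rot X Y (f : chain X Y) : chain (cone (cone_in f)) (shift X 1).
Proof.
exists (fun i => afst (X (i + 1)) (Y i) \oa asnd (Y (i + 1)) (cone f i)).
apply: chain_next => i T; apply: apair_ind => y; apply: apair_ind => x y'.
rewrite cone_cd cone_cd -!acompA !snd_apair fst_apair acompDr fst_apair.
by rewrite ainrE fst_apair add0r acompNl.
Defined.

Lemma cone_rot_in X Y (f : chain X Y) i :
  cone_rot f i \oa cone_in (cone_in f) i = cone_out f i.
Proof.
by apply: ahom_ext => T x; rewrite -!acompA [ainr _ _ \oa x]ainrE snd_apair.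
Qed.

Lemma cone_rot_qis X Y (f : chain X Y) : qis (cone_rot f).
Proof.
move=> i; have [j E] : exists j : int, i = j + 1.
  by exists (i - 1); rewrite subrK.
subst i; apply: coh_isoI => T.
  apply: apair_ind => y; apply: apair_ind => x y' /cyc_cone[cy].
  rewrite cone_cd ainrE apairD => /apair_eq0[Ex Ey].
  rewrite -acompA snd_apair fst_apair.
  move=> /(@bnd_shift _ X 1)/bnd_succ[T' [p [w [ep Ew]]]].
  apply/bnd_cone; exists T', p, (y' \oa p + f (j + 1) \oa w).
  exists (apair (- w) 0); split=> //.
    rewrite acompDr chain_cd Ew acompA [f _ \oa (x \oa p)]acompA.
    have := congr1 (fun u => u \oa p) Ey; rewrite !acompDl acomp0l => Ep.
    by apply/eqP; rewrite -addr_eq0; apply/eqP; rewrite -[RHS]Ep; abel.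
  rewrite cone_cd ainrE !apair_pre apairD acompNr opprK Ew add0r.
  by rewrite acompNr acomp0r addr0 addrK.
move=> x /(@cyc_shift _ X 1) cx.
exists T, (aid T), (apair (- (f _ \oa x)) (apair x 0)); split.
- exact: epi_id.
- apply/cyc_cone; split; first by move=> k; rewrite acompNr chain_cd cx acomp0r oppr0.
  rewrite cone_cd ainrE apairD cx acomp0r oppr0 !addr0 addNr.
  exact: apair0.
by rewrite -acompA snd_apair fst_apair acomp1r subrr; apply: bnd0.
Qed.

Definition short_exact V X W (f : chain V X) (g : chain X W) : Prop :=
  forall i, [/\ mono (f i), epi (g i), g i \oa f i = 0 &
    forall T (x : ahom T (X i)), g i \oa x = 0 ->
      exists v : ahom T (V i), f i \oa v = x].

Definition cone_desc V X W (f : chain V X) (g : chain X W)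
  (gf0 : forall i, g i \oa f i = 0) : chain (cone f) W.
Proof.
exists (fun i => g i \oa asnd (V (i + 1)) (X i)).
apply: chain_next => i T; apply: apair_ind => v x.
rewrite cone_cd -!acompA !snd_apair chain_cd acompDr (acompA (g _) (f _)) gf0.
by rewrite acomp0l add0r.
Defined.

Lemma cone_desc_in V X W (f : chain V X) (g : chain X W)
    (gf0 : forall i, g i \oa f i = 0) i :
  cone_desc gf0 i \oa cone_in f i = g i.
Proof. by rewrite /= -acompA asnd_inr acomp1r. Qed.

Lemma ses_cone_qis V X W (f : chain V X) (g : chain X W)
    (gf0 : forall i, g i \oa f i = 0) :
  short_exact f g -> qis (cone_desc gf0).
Proof.
move=> fg i; have [j E] : exists j : int, i = j + 1.
  by exists (i - 1); rewrite subrK.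
subst i; apply: coh_isoI => T.
  apply: apair_ind => v x /cyc_cone[cv Ex].
  rewrite -acompA snd_apair => /bnd_succ[T1 [p1 [w [ep1 Ew]]]].
  have [_ eg _ _] := fg j; have [T2 [p2 [y [ep2 Ey]]]] := epi_pullback w eg.
  have [mf _ _ lift] := fg (j + 1).
  have /lift[u Eu] : g (j + 1) \oa
      (x \oa (p1 \oa p2) - cd X j (j + 1) \oa y) = 0.
    by rewrite acompBr -chain_cd Ey !acompA Ew -!acompA subrr.
  apply/bnd_cone; exists T2, (p1 \oa p2), u, y; split; first exact: epi_comp.
    have [mf' _ _ _] := fg (j + 1 + 1); apply: mf'.
    rewrite -chain_cd Eu acompBr cd_cd subr0 acompNr !acompA.
    apply/eqP; rewrite -addr_eq0 -!acompDl hC.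
    by rewrite Ex !acomp0l.
  by rewrite Eu subrK.
move=> w cw; have [mf eg _ lift] := fg (j + 1).
have [T1 [p1 [x [ep1 Ex]]]] := epi_pullback w eg.
have [_ _ _ lift'] := fg (j + 1 + 1).
have /lift'[v Ev] : g (j + 1 + 1) \oa (cd X (j + 1) (j + 1 + 1) \oa x) = 0.
  by rewrite -chain_cd Ex acompA cw acomp0l.
exists T1, p1, (apair (- v) x); split=> //.
  apply/cyc_cone; split.
    apply: cyc_next; have [mf3 _ _ _] := fg (j + 1 + 1 + 1).
    apply: (mono_eq0 mf3); rewrite -chain_cd !acompNr Ev cd_cd.
    exact: oppr0.
  by rewrite acompNr Ev addNr.
by rewrite -acompA snd_apair Ex subrr; apply: bnd0.
Qed.

End ConeExactness.

(** ** Homotopy pullbacks *)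

Section HomotopyPullback.
Variable A : abelian.
Variables (X Y Z : cplx A) (f : chain X Y) (s : chain Z Y).

(** In degree [i] the homotopy pullback is [X_i + Z_i + Y_(i-1)], with
    differential [(x, z, y) |-> (d x, d z, f x - s z - d y)]: a cycle is a pair
    of cycles [x] and [z] together with a reason [y] for [f x] and [s z] to be
    cohomologous. *)
Definition hpb_d i j : ahom (abip (abip (X i) (Z i)) (Y (i - 1)))
                            (abip (abip (X j) (Z j)) (Y (j - 1))) :=
  let x := afst (X i) (Z i) \oa afst _ (Y (i - 1)) in
  let z := asnd (X i) (Z i) \oa afst _ (Y (i - 1)) in
  apair (apair (cd X i j \oa x) (cd Z i j \oa z))
    (idd Y i (j - 1) \oa (f i \oa x - s i \oa z)
     - cd Y (i - 1) (j - 1) \oa asnd _ (Y (i - 1))).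

Lemma hpb_dE i j T (x : ahom T (X i)) (z : ahom T (Z i))
    (y : ahom T (Y (i - 1))) :
  hpb_d i j \oa apair (apair x z) y =
  apair (apair (cd X i j \oa x) (cd Z i j \oa z))
    (idd Y i (j - 1) \oa (f i \oa x - s i \oa z) - cd Y (i - 1) (j - 1) \oa y).
Proof.
rewrite /hpb_d !apair_pre !acompBl -!acompA !acompBl -!acompA.
by rewrite !(fst_apair, snd_apair).
Qed.

Lemma hpb_shape i j : i + 1 != j -> hpb_d i j = 0.
Proof.
move=> ij; have n1 : i != j - 1 by lia.
have n2 : i - 1 + 1 != j - 1 by lia.
rewrite /hpb_d (cd_shape X ij) (cd_shape Z ij) (cd_shape Y n2) (idd_neq _ n1).
by rewrite !acomp0l subr0 !apair0.
Qed.

Lemma hpb_sq i j k : hpb_d j k \oa hpb_d i j = 0.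
Proof.
apply: ahom_ext => T; apply: apair_ind; apply: apair_ind => x z y.
rewrite -acompA !hpb_dE !cd_cd !acomp0l.
rewrite -!chain_cd -acompBr !acompBr !cd_cd subr0.
set u := f i \oa x; set v := s i \oa z.
have [ij|ij] := eqVneq i (j - 1); last first.
  have n : i + 1 != j by lia.
  by rewrite (idd_neq _ ij) (cd_shape Y n) !acomp0l !acomp0r !subr0 !apair0.
have [jk|jk] := eqVneq j (k - 1); last first.
  have n : j - 1 + 1 != k - 1 by lia.
  by rewrite (idd_neq _ jk) (cd_shape Y n) !acomp0l !subr0 !apair0.
by rewrite !idd_cd // !cd_idd // subrr !apair0.
Qed.

Definition hpb : cplx A := Cplx hpb_shape hpb_sq.

Definition hpb_fst : chain hpb X.
Proof.
exists (fun i => afst (X i) (Z i) \oa afst _ (Y (i - 1))) => i j.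
by rewrite /= -acompA /hpb_d !fst_apair.
Defined.

Definition hpb_snd : chain hpb Z.
Proof.
exists (fun i => asnd (X i) (Z i) \oa afst _ (Y (i - 1))) => i j.
by rewrite /= -acompA /hpb_d fst_apair snd_apair.
Defined.

Lemma hpb_homotopic : homotopic (chain_comp f hpb_fst) (chain_comp s hpb_snd).
Proof.
apply/homotopicP.
exists (fun i j => idd Y (i - 1) j \oa asnd _ (Y (i - 1))) => i j l ji il.
have e1 : i - 1 = j by lia.
have e2 : i = l - 1 by lia.
apply: ahom_ext => T; apply: apair_ind; apply: apair_ind => x z y.
rewrite acompBl acompDl -!acompA hpb_dE !(snd_apair, fst_apair).
rewrite (acompBr (idd _ (l - 1) i)) (idd_transK _ e2) idd_cd // cd_idd //.
by abel.
Qed.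

Lemma cyc_hpb i T (x : ahom T (X i)) (z : ahom T (Z i))
    (y : ahom T (Y (i - 1))) :
  @cyc _ hpb i T (apair (apair x z) y) <->
  [/\ cyc x, cyc z & cd Y (i - 1) i \oa y = f i \oa x - s i \oa z].
Proof.
have e : i = i + 1 - 1 by lia.
split=> [H|[cx cz Ey]].
  have H1 j := H j; split.
  - by move=> j; have := H j; rewrite [LHS]hpb_dE => /apair_eq0[/apair_eq0[]].
  - by move=> j; have := H j; rewrite [LHS]hpb_dE => /apair_eq0[/apair_eq0[]].
  have := H (i + 1); rewrite [LHS]hpb_dE => /apair_eq0[_ /eqP].
  rewrite subr_eq0 => /eqP /(congr1 (fun u => idd Y (i + 1 - 1) i \oa u)).
  by rewrite idd_transK // idd_cd.
apply: cyc_next; rewrite [LHS]hpb_dE cx cz -Ey idd_cd // subrr.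
by rewrite !apair0.
Qed.

Lemma bnd_hpb i T (x : ahom T (X i)) (z : ahom T (Z i))
    (y : ahom T (Y (i - 1))) T' (p : ahom T' T) (u : ahom T' (X (i - 1)))
    (v : ahom T' (Z (i - 1))) (w : ahom T' (Y (i - 1 - 1))) :
  epi p -> cd X (i - 1) i \oa u = x \oa p -> cd Z (i - 1) i \oa v = z \oa p ->
  f (i - 1) \oa u - s (i - 1) \oa v - cd Y (i - 1 - 1) (i - 1) \oa w
    = y \oa p ->
  @bnd _ hpb i T (apair (apair x z) y).
Proof.
move=> ep Eu Ev Ew; exists T', p, (i - 1), (apair (apair u v) w); split=> //.
by rewrite [LHS]hpb_dE Eu Ev idd_refl acomp1l Ew !apair_pre.
Qed.

(** Surjectivity on cohomology lifts [f x] along [s]. For injectivity, let [x] be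
    the boundary of [u] and [z] that of [v]; what remains is the cycle
    [y - f u + s v] of [Y], absorbed by lifting it along [s] in degree [i - 1]. *)
Lemma hpb_fst_qis : qis s -> qis hpb_fst.
Proof.
move=> qs i; apply: coh_isoI => T.
  apply: apair_ind; apply: apair_ind => x z y /cyc_hpb[cx cz Ey].
  rewrite -acompA !fst_apair => /bnd_prev[T1 [p1 [u [ep1 Eu]]]].
  have bz : bnd (z \oa p1).
    apply: (coh_iso_inj (qs i)); first exact: cyc_pre.
    have -> : s i \oa (z \oa p1) =
        cd Y (i - 1) i \oa (f (i - 1) \oa u - y \oa p1).
      rewrite acompBr chain_cd Eu !acompA Ey acompBl.
      by abel.
    exact: bnd_cd.
  have [T2 [p2 [v [ep2 Ev]]]] := bnd_prev bz.
  pose y' := y \oa (p1 \oa p2) - f (i - 1) \oa (u \oa p2) + s (i - 1) \oa v.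
  have cy' : cyc y'.
    apply: cyc_next; rewrite subrK /y' acompDr acompBr !chain_cd Ev.
    rewrite [cd X _ _ \oa (u \oa _)]acompA Eu !acompA Ey acompBl !acompBl.
    by rewrite -!acompA; abel.
  have [T3 [p3 [z' [ep3 cz' bz']]]] := coh_iso_surj (qs (i - 1)) cy'.
  have [T4 [p4 [w [ep4 Ew]]]] := bnd_prev bz'.
  pose p := p1 \oa p2 \oa p3 \oa p4.
  apply: (@bnd_hpb i T x z y T4 p (u \oa p2 \oa p3 \oa p4)
    (v \oa p3 \oa p4 - z' \oa p4) (- w)).
  - by do 3 (apply: epi_comp => //).
  - by rewrite !acompA Eu.
  - by rewrite acompBr [cd _ _ _ \oa (z' \oa _)]acompA cz' acomp0l subr0 !acompA Ev.
  - rewrite acompBr acompNr opprK Ew /y' !acompDl !acompNl /p.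
    by rewrite -!acompA; abel.
move=> x cx; have [T1 [p1 [z [ep1 cz bz]]]] := coh_iso_surj (qs i) (cyc_map f cx).
have [T2 [p2 [w [ep2 Ew]]]] := bnd_prev bz.
exists T2, (p1 \oa p2), (apair (apair (x \oa (p1 \oa p2)) (z \oa p2)) w).
split; first exact: epi_comp.
  by apply/cyc_hpb; split; [exact: cyc_pre | exact: cyc_pre |
    rewrite Ew acompBl -!acompA].
by rewrite -acompA !fst_apair subrr; apply: bnd0.
Qed.

End HomotopyPullback.
(** * Isomorphisms in categories and in the derived category *)

Add Parametric Relation (C : category) (X Y : C) : (hom X Y) (@heq C X Y)
  reflexivity proved by (@heq_refl C X Y)
  symmetry proved by (@heq_sym C X Y)
  transitivity proved by (@heq_trans C X Y) as heq_relation.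

Add Parametric Morphism (C : category) (X Y Z : C) : (@compo C X Y Z)
  with signature (@heq C Y Z) ==> (@heq C X Y) ==> (@heq C X Z)
  as compo_morphism.
Proof. by move=> g g' eg f f' ef; apply: comp_heq. Qed.

#[local] Hint Resolve heq_refl : core.

Section Categories.
Variable C : category.
Implicit Types X Y Z : C.

Lemma is_iso_id X : is_iso (idc X).
Proof. by exists (idc X); split; apply: comp1c. Qed.

Lemma is_iso_heq X Y (f g : hom X Y) : f =~ g -> is_iso f -> is_iso g.
Proof.
by move=> fg [h [h1 h2]]; exists h; rewrite -fg.
Qed.

Lemma is_iso_comp X Y Z (g : hom Y Z) (f : hom X Y) :
  is_iso g -> is_iso f -> is_iso (g \oc f).
Proof.
move=> [g' [g1 g2]] [f' [f1 f2]]; exists (f' \oc g'); split.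
  by rewrite compcA -(compcA f' g' g) g1 compc1.
by rewrite compcA -(compcA g f f') f2 compc1.
Qed.

Lemma inv_iso X Y (f : hom X Y) (g : hom Y X) :
  g \oc f =~ idc X -> f \oc g =~ idc Y -> is_iso g.
Proof. by move=> gf fg; exists f. Qed.

Lemma iso_cancell X Y Z (f : hom Y Z) (a b : hom X Y) :
  is_iso f -> f \oc a =~ f \oc b -> a =~ b.
Proof.
by move=> [g [gf _]] e; rewrite -(comp1c a) -(comp1c b) -gf -!compcA e.
Qed.

Lemma iso_cancelr X Y Z (f : hom X Y) (a b : hom Y Z) :
  is_iso f -> a \oc f =~ b \oc f -> a =~ b.
Proof.
by move=> [g [_ fg]] e; rewrite -(compc1 a) -(compc1 b) -fg !compcA e.
Qed.

Lemma is_iso_right X Y Z (g : hom Y Z) (f : hom X Y) :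
  is_iso g -> is_iso (g \oc f) -> is_iso f.
Proof.
move=> ig [h [h1 h2]]; exists (h \oc g); split; first by rewrite -compcA.
apply: (iso_cancell ig); rewrite !compcA h2 comp1c compc1.
exact: heq_refl.
Qed.

Lemma is_iso_left X Y Z (g : hom Y Z) (f : hom X Y) :
  is_iso f -> is_iso (g \oc f) -> is_iso g.
Proof.
move=> if_ [h [h1 h2]]; exists (f \oc h); split; last by rewrite compcA.
apply: (iso_cancelr if_); rewrite -compcA -compcA h1 compc1.
by rewrite comp1c.
Qed.

Lemma isomorphic_refl X : isomorphic X X.
Proof. by exists (idc X); apply: is_iso_id. Qed.

Lemma isomorphic_sym X Y : isomorphic X Y -> isomorphic Y X.
Proof. by case=> f [g [gf fg]]; exists g, f. Qed.

Lemma isomorphic_trans X Y Z :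
  isomorphic X Y -> isomorphic Y Z -> isomorphic X Z.
Proof. by case=> f i [g j]; exists (g \oc f); apply: is_iso_comp. Qed.

Lemma zigzag_comp X Y Z V V' W (u : hom X Y) (v : hom Y Z) (s : hom V X)
    (f : hom V Y) (s' : hom V' Y) (f' : hom V' Z) (a : hom W V) (b : hom W V') :
  u \oc s =~ f -> v \oc s' =~ f' -> f \oc a =~ s' \oc b ->
  (v \oc u) \oc (s \oc a) =~ f' \oc b.
Proof.
by move=> <- <- E; rewrite -!compcA (compcA u) E.
Qed.

Definition pair_iso X Y Z X' Y' Z' (u : hom X Y) (v : hom Y Z)
    (u' : hom X' Y') (v' : hom Y' Z') : Prop :=
  exists (a : hom X X') (b : hom Y Y') (c : hom Z Z'),
    [/\ is_iso a, is_iso b, is_iso c, b \oc u =~ u' \oc a &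
        c \oc v =~ v' \oc b].

Lemma square_inv X Y X' Y' (u : hom X Y) (u' : hom X' Y')
    (a : hom X X') (b : hom Y Y') (a' : hom X' X) (b' : hom Y' Y) :
  b \oc u =~ u' \oc a -> a \oc a' =~ idc X' -> b' \oc b =~ idc Y ->
  b' \oc u' =~ u \oc a'.
Proof.
move=> E aa bb; rewrite -(compc1 u') -aa (compcA u') -E -(compcA b u).
by rewrite compcA bb comp1c.
Qed.

Lemma square_comp X Y X' Y' X2 Y2 (u : hom X Y) (u' : hom X' Y')
    (u2 : hom X2 Y2) (a : hom X X') (b : hom Y Y') (a' : hom X' X2)
    (b' : hom Y' Y2) :
  b \oc u =~ u' \oc a -> b' \oc u' =~ u2 \oc a' ->
  (b' \oc b) \oc u =~ u2 \oc (a' \oc a).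
Proof. by move=> E E'; rewrite -compcA E compcA E' -compcA. Qed.

Lemma pair_iso_sym X Y Z X' Y' Z' (u : hom X Y) (v : hom Y Z)
    (u' : hom X' Y') (v' : hom Y' Z') :
  pair_iso u v u' v' -> pair_iso u' v' u v.
Proof.
case=> a [b [c [[a' [a1 a2]] [b' [b1 b2]] [c' [c1 c2]] E1 E2]]].
exists a', b', c'; split; try exact: inv_iso.
- exact: inv_iso a1 a2.
- exact: inv_iso b1 b2.
- exact: inv_iso c1 c2.
- exact: square_inv E1 a2 b1.
- exact: square_inv E2 b2 c1.
Qed.

Lemma pair_iso_trans X Y Z X' Y' Z' X2 Y2 Z2 (u : hom X Y) (v : hom Y Z)
    (u' : hom X' Y') (v' : hom Y' Z') (u2 : hom X2 Y2) (v2 : hom Y2 Z2) :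
  pair_iso u v u' v' -> pair_iso u' v' u2 v2 -> pair_iso u v u2 v2.
Proof.
case=> a [b [c [ia ib ic E1 E2]]] [a' [b' [c' [ia' ib' ic' E1' E2']]]].
exists (a' \oc a), (b' \oc b), (c' \oc c).
split; try exact: is_iso_comp.
  exact: square_comp E1 E1'.
exact: square_comp E2 E2'.
Qed.

End Categories.

Section Functors.
Variables C D : category.

Lemma co_iso (F : cofunctor C D) X Y (f : hom X Y) :
  is_iso f -> is_iso (co_map F f).
Proof.
case=> g [gf fg]; exists (co_map F g).
by split; rewrite -co_comp;
  [rewrite (co_heq F gf) co_id | rewrite (co_heq F fg) co_id].
Qed.

Lemma ct_iso (F : contrafunctor C D) X Y (f : hom X Y) :
  is_iso f -> is_iso (ct_map F f).
Proof.
case=> g [gf fg]; exists (ct_map F g).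
by split; rewrite -ct_comp;
  [rewrite (ct_heq F fg) ct_id | rewrite (ct_heq F gf) ct_id].
Qed.

Lemma ct_square (F : contrafunctor C D) X Y X' Y' (u : hom X Y)
    (u' : hom X' Y') (a : hom X X') (b : hom Y Y') :
  b \oc u =~ u' \oc a ->
  ct_map F u \oc ct_map F b =~ ct_map F a \oc ct_map F u'.
Proof. by move=> E; rewrite -!ct_comp (ct_heq F E). Qed.

Lemma ct_pair_iso (F : contrafunctor C D) X Y Z X' Y' Z' (u : hom X Y)
    (v : hom Y Z) (u' : hom X' Y') (v' : hom Y' Z') :
  pair_iso u v u' v' ->
  pair_iso (ct_map F v) (ct_map F u) (ct_map F v') (ct_map F u').
Proof.
move=> /pair_iso_sym[a [b [c [ia ib ic E1 E2]]]].
exists (ct_map F c), (ct_map F b), (ct_map F a).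
split; try exact: ct_iso.
  by apply: heq_sym; apply: ct_square.
by apply: heq_sym; apply: ct_square.
Qed.

End Functors.

Section DerivedCategory.
Variable A : abelian.
Implicit Types X Y Z : cplx A.

(** The inverse of [H^i s] is unique, but only its existence is given: making
    cohomology a function on formal fractions takes a choice. *)
Definition HD_inv X Y (s : chain X Y) (qs : qis s) i :
    ahom (cohomology Y i) (cohomology X i) :=
  proj1_sig (constructive_indefinite_description _ (qs i)).

Lemma HD_invP X Y (s : chain X Y) (qs : qis s) i :
  HD_inv qs i \oa cohomology_map s i = aid _ /\
  cohomology_map s i \oa HD_inv qs i = aid _.
Proof. by rewrite /HD_inv; case: constructive_indefinite_description. Qed.

Fixpoint HD_map i X Y (w : @word (Kcat A) (@quasi_iso A) X Y) :
    ahom (cohomology X i) (cohomology Y i) :=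
  match w with
  | wmap _ _ f => cohomology_map f i
  | winv _ _ _ qs => HD_inv qs i
  | wcomp _ _ _ v u => HD_map i v \oa HD_map i u
  end.

Lemma HD_weq i X Y (w w' : @word (Kcat A) (@quasi_iso A) X Y) :
  weq w w' -> HD_map i w = HD_map i w'.
Proof.
elim=> {X Y w w'} /=.
- by [].
- by move=> X Y u v _ ->.
- by move=> X Y u v w _ -> _ ->.
- by move=> X Y Z v v' u u' _ -> _ ->.
- by move=> X Y Z T w v u; rewrite acompA.
- by move=> X Y u; rewrite cohomology_map_id acomp1l.
- by move=> X Y u; rewrite cohomology_map_id acomp1r.
- by move=> X Y f f'; apply: homotopic_cohomology.
- by move=> X Y Z g f; apply: cohomology_map_comp.
- by move=> X Y s qs; rewrite cohomology_map_id; case: (HD_invP qs i).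
- by move=> X Y s qs; rewrite cohomology_map_id; case: (HD_invP qs i).
Qed.

Definition HD (i : int) : cofunctor (Dcat A) (acat A) :=
  @Cofunctor (Dcat A) (acat A) (fun X => cohomology X i) (@HD_map i)
    (@HD_weq i) (fun X => cohomology_map_id X i)
    (fun _ _ _ _ _ => erefl).

Lemma Dmap_comp X Y Z (g : chain Y Z) (f : chain X Y) :
  Dmap (chain_comp g f) =~ Dmap g \oc Dmap f.
Proof. exact: weq_mapM. Qed.

Lemma Dmap_homotopic X Y (f g : chain X Y) :
  homotopic f g -> Dmap f =~ Dmap g.
Proof. by move=> h; apply: (@weq_map (Kcat A) (@quasi_iso A) X Y f g h). Qed.

Lemma Dmap_eq X Y (f g : chain X Y) : (forall i, f i = g i) -> Dmap f =~ Dmap g.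
Proof. by move=> fg; apply: Dmap_homotopic; apply: homotopic_eq. Qed.

Lemma Dmap_square X Y X' Y' (u : chain X Y) (u' : chain X' Y')
    (a : chain X X') (b : chain Y Y') :
  homotopic (chain_comp b u) (chain_comp u' a) ->
  Dmap b \oc Dmap u =~ Dmap u' \oc Dmap a.
Proof. by move=> h; rewrite -!Dmap_comp; apply: Dmap_homotopic. Qed.

Lemma Dmap_iso X Y (s : chain X Y) : qis s -> is_iso (Dmap s).
Proof.
move=> qs; exists (@winv (Kcat A) (@quasi_iso A) X Y s qs).
by split; [apply: weq_invl | apply: weq_invr].
Qed.

Lemma iso_qis X Y (s : chain X Y) : is_iso (Dmap s) -> qis s.
Proof. by move=> H i; apply: (co_iso (HD i) H). Qed.

Lemma qis_comp X Y Z (g : chain Y Z) (f : chain X Y) :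
  qis g -> qis f -> qis (chain_comp g f).
Proof.
move=> qg qf; apply: iso_qis; apply: is_iso_heq (heq_sym (Dmap_comp _ _)) _.
by apply: is_iso_comp; apply: Dmap_iso.
Qed.

Lemma qis_id X : qis (chain_id X).
Proof. by apply: iso_qis; apply: is_iso_id. Qed.

(** Calculus of fractions: a formal composite of chain maps and inverses of
    quasi-isomorphisms becomes a chain map after one quasi-isomorphism. A
    homotopy pullback moves an inverse past a chain map. *)
Lemma roof X Y (w : @hom (Dcat A) X Y) :
  exists (Z : cplx A) (s : chain Z X) (f : chain Z Y),
    qis s /\ w \oc Dmap s =~ Dmap f.
Proof.
elim: w => {X Y} [X Y f|X Y s qs|X Y Z v [W' [s' [f' [qs' E']]]]
    u [W [s [f [qs E]]]]].
- by exists X, (chain_id X), f; split; [exact: qis_id | exact: weq_comp1].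
- by exists X, s, (chain_id X); split=> //; exact: weq_invl.
exists (hpb f s'), (chain_comp s (hpb_fst f s')), (chain_comp f' (hpb_snd f s')).
split; first by apply: qis_comp => //; apply: hpb_fst_qis.
have H := Dmap_square (hpb_homotopic f s').
apply: heq_trans (comp_heq (heq_refl _) (Dmap_comp _ _)) _.
apply: heq_trans _ (heq_sym (Dmap_comp _ _)).
exact: zigzag_comp E E' H.
Qed.

(** A fraction with invertible cohomology has a quasi-isomorphism as
    numerator. *)
Lemma Diso_coh X Y (w : @hom (Dcat A) X Y) :
  (forall i, @is_iso (acat A) _ _ (HD_map i w)) -> is_iso w.
Proof.
move=> H; have [Z [s [f [qs E]]]] := roof w.
apply: (is_iso_left (Dmap_iso qs)).
apply: is_iso_heq (heq_sym E) _; apply: Dmap_iso => i.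
have := is_iso_comp (H i) (qs i).
by apply: is_iso_heq; apply: (HD_weq i E).
Qed.

Lemma Diso_cohomology0 X Y (w : @hom (Dcat A) X Y) i :
  is_iso w -> is_zero (cohomology X i) <-> is_zero (cohomology Y i).
Proof.
move=> iw; have := co_iso (HD i) iw => /= iH; split.
  exact: is_zero_epi (iso_epi iH).
exact: is_zero_mono (iso_mono iH).
Qed.

End DerivedCategory.

(** ** The shift as an autoequivalence *)

Section ShiftFunctor.
Variable A : abelian.
Implicit Types X Y Z : cplx A.

Lemma shift_homotopic X Y (f g : chain X Y) k :
  homotopic f g -> homotopic (shift_chain f k) (shift_chain g k).
Proof.
case/homotopicP => s sP; apply/homotopicP.
exists (fun i j =>
  if odd `|k|%N then - s (i + k) (j + k) else s (i + k) (j + k)).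
move=> i j l ji il /=; rewrite (sP _ (j + k) (l + k)); try by lia.
by case: ifP => _; rewrite ?acompNl ?acompNr ?opprK.
Qed.

Fixpoint shift_word k X Y (w : @word (Kcat A) (@quasi_iso A) X Y) :
    @word (Kcat A) (@quasi_iso A) (shift X k) (shift Y k) :=
  match w with
  | wmap X Y f => @wmap (Kcat A) (@quasi_iso A) _ _ (@shift_chain A X Y f k)
  | winv X Y s qs =>
      @winv (Kcat A) (@quasi_iso A) _ _ (@shift_chain A X Y s k)
        (@shift_qis A X Y s k qs)
  | wcomp _ _ _ v u => wcomp (shift_word k v) (shift_word k u)
  end.

Lemma shift_word_id k X : Dmap (shift_chain (chain_id X) k) =~ idc _.
Proof. exact: (@Dmap_eq _ _ _ _ (chain_id _)). Qed.

Lemma shift_word_weq k X Y (w w' : @word (Kcat A) (@quasi_iso A) X Y) :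
  weq w w' -> weq (shift_word k w) (shift_word k w').
Proof.
elim=> {X Y w w'} /=.
- by move=> X Y u; apply: weq_refl.
- by move=> X Y u v _; apply: weq_sym.
- by move=> X Y u v w _ H1 _ H2; apply: weq_trans H1 H2.
- by move=> X Y Z v v' u u' _ H1 _ H2; apply: weq_comp.
- by move=> X Y Z T w v u; apply: weq_compA.
- move=> X Y u; apply: weq_trans (weq_1comp _).
  by apply: weq_comp; [apply: shift_word_id | apply: weq_refl].
- move=> X Y u; apply: weq_trans (weq_comp1 _).
  by apply: weq_comp; [apply: weq_refl | apply: shift_word_id].
- by move=> X Y f f' h; apply: weq_map; apply: shift_homotopic.
- move=> X Y Z g f; apply: weq_trans (weq_mapM _ _ _).
  by apply: weq_map; apply: homotopic_eq.
- move=> X Y s qs; apply: weq_trans (weq_invl _) _; apply: weq_sym.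
  exact: shift_word_id.
- move=> X Y s qs; apply: weq_trans (weq_invr _) _; apply: weq_sym.
  exact: shift_word_id.
Qed.

Definition shiftD k : cofunctor (Dcat A) (Dcat A) :=
  @Cofunctor (Dcat A) (Dcat A) (fun X => shift X k) (@shift_word k)
    (@shift_word_weq k) (shift_word_id k)
    (fun _ _ _ _ _ => heq_refl _).

Lemma shiftD_map k X Y (f : chain X Y) :
  co_map (shiftD k) (Dmap f) = Dmap (shift_chain f k).
Proof. by []. Qed.

Definition unshift X k l (kl : k + l = 0) : chain (shift (shift X k) l) X.
Proof.
exists (fun i => idd X (i + l + k) i) => i j /=.
have ei : i + l + k = i by lia.
have ej : j + l + k = j by lia.
have -> /= : odd `|l|%N = odd `|k|%N by lia.
apply: ahom_ext => T x; rewrite -!acompA.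
by case: (odd _); rewrite ?opprK cd_idd // idd_cd.
Defined.

Definition reshift X k l (kl : k + l = 0) : chain X (shift (shift X k) l).
Proof.
exists (fun i => idd X i (i + l + k)) => i j /=.
have ei : i + l + k = i by lia.
have ej : j + l + k = j by lia.
have -> /= : odd `|l|%N = odd `|k|%N by lia.
apply: ahom_ext => T x; rewrite -!acompA.
by case: (odd _); rewrite ?opprK cd_idd // idd_cd.
Defined.

Lemma unshift_iso X k l (kl : k + l = 0) : is_iso (Dmap (unshift X kl)).
Proof.
exists (Dmap (reshift X kl)); split; rewrite -Dmap_comp.
  apply: (@Dmap_eq _ _ _ _ (chain_id _)) => i /=.
  by rewrite idd_trans ?idd_refl //; lia.
apply: (@Dmap_eq _ _ _ _ (chain_id _)) => i /=.
by rewrite idd_trans ?idd_refl //; lia.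
Qed.

(** Naturality extends from chain maps to formal composites, since a square
    with invertible horizontal maps can be read backwards. *)
Lemma unshift_nat X Y (w : @hom (Dcat A) X Y) k l (kl : k + l = 0) :
  Dmap (unshift Y kl) \oc co_map (shiftD l) (co_map (shiftD k) w) =~
  w \oc Dmap (unshift X kl).
Proof.
elim: w => {X Y} [X Y f|X Y s qs|X Y Z v IHv u IHu].
- apply: (@Dmap_square A _ _ _ _ (shift_chain (shift_chain f k) l) f).
  by apply: homotopic_eq => i /=; rewrite chain_idd.
- apply: heq_sym; apply: (@square_inv (Dcat A) _ _ _ _ (Dmap (unshift X kl))
    (Dmap (unshift Y kl)) (Dmap (shift_chain (shift_chain s k) l)) (Dmap s)).
  + by apply: Dmap_square; apply: homotopic_eq => i /=; rewrite chain_idd.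
  + exact: weq_invr.
  + exact: weq_invl.
- apply: heq_trans (compcA _ _ _) _.
  apply: heq_trans (comp_heq IHv (heq_refl _)) _.
  apply: heq_trans (heq_sym (compcA _ _ _)) _.
  apply: heq_trans (comp_heq (heq_refl _) IHu) _.
  exact: compcA.
Qed.

Lemma shiftD_faithful k X Y (w w' : @hom (Dcat A) X Y) :
  co_map (shiftD k) w =~ co_map (shiftD k) w' -> w =~ w'.
Proof.
move=> E; have kl : k + - k = 0 by rewrite subrr.
apply: (iso_cancelr (unshift_iso X kl)).
by rewrite -!unshift_nat (co_heq (shiftD (- k)) E).
Qed.

Lemma shiftD_full k X Y (h : @hom (Dcat A) (shift X k) (shift Y k)) :
  exists w : @hom (Dcat A) X Y, co_map (shiftD k) w =~ h.
Proof.
have kl : k + - k = 0 by rewrite subrr.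
have [z [z1 z2]] := unshift_iso X kl.
exists ((Dmap (unshift Y kl) \oc co_map (shiftD (- k)) h) \oc z).
apply: (@shiftD_faithful (- k)); apply: (iso_cancell (unshift_iso Y kl)).
by rewrite unshift_nat -compcA z1 compc1.
Qed.

End ShiftFunctor.

(** * Truncations *)

Section Cut.
Variables (A : abelian) (a b : int -> bool).
Implicit Types X : cplx A.

(** The kernel of this map consists of the [x] in [X_i] such that [x = 0] if
    [a i], and [d x = 0] if [b i]. Brutal and canonical truncations are both of
    this form, for different [a] and [b], and no case analysis on the degree
    enters the definition of the objects. *)
Definition cut_map (X : cplx A) i : ahom (X i) (abip (X i) (X (i + 1))) :=
  apair (if a i then aid (X i) else 0) (if b i then cd X i (i + 1) else 0).

Lemma cut_mapP X i T (x : ahom T (X i)) :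
  cut_map X i \oa x = 0 <->
  (a i -> x = 0) /\ (b i -> cd X i (i + 1) \oa x = 0).
Proof.
rewrite /cut_map apair_pre; split=> [/apair_eq0[]|[Ha Hb]].
  by case: (a i) (b i) => [] []; rewrite ?acomp1l.
have -> : (if a i then aid (X i) else 0) \oa x = 0.
  by case: (a i) Ha => H; rewrite ?acomp0l // acomp1l H.
have -> : (if b i then cd X i (i + 1) else 0) \oa x = 0.
  by case: (b i) Hb => H; rewrite ?acomp0l // H.
exact: apair0.
Qed.

Hypothesis ab : forall i, a (i + 1) -> a i || b i.

Lemma cut_map_cd X i j : cut_map X j \oa (cd X i j \oa kinc (cut_map X i)) = 0.
Proof.
apply/cut_mapP; split=> [aj|_]; last by rewrite cd_cd.
have [ij|ij] := eqVneq (i + 1) j; last by rewrite (cd_shape X ij) acomp0l.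
subst j; have /cut_mapP[Ha Hb] := kinc0 (cut_map X i).
by case/orP: (ab aj) => [/Ha->|/Hb//]; rewrite acomp0r.
Qed.

Section OneComplex.
Variable X : cplx A.

Definition sub : cplx A.
Proof.
refine (@Cplx A (fun i => ker (cut_map X i))
  (fun i j => klift (cut_map_cd X i j)) _ _).
  move=> i j ij; apply: kinc_mono.
  by rewrite kinc_lift acomp0r (cd_shape X ij) acomp0l.
by move=> i j k; apply: kinc_mono; rewrite acompA !kinc_lift -acompA kinc_lift
  acompA cd_sq acomp0l acomp0r.
Defined.

Definition sub_inc : chain sub X.
Proof. by exists (fun i => kinc (cut_map X i)) => i j; rewrite /= kinc_lift. Defined.

Lemma quo_dP i j :
  cproj (kinc (cut_map X j)) \oa cd X i j \oa kinc (cut_map X i) = 0.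
Proof.
by rewrite -acompA -(kinc_lift (cut_map_cd X i j)) acompA cproj0 acomp0l.
Qed.

Definition quo : cplx A.
Proof.
refine (@Cplx A (fun i => coker (kinc (cut_map X i)))
  (fun i j => cdesc (quo_dP i j)) _ _).
  move=> i j ij; apply: cproj_epi.
  by rewrite cdesc_proj acomp0l (cd_shape X ij) acomp0r.
by move=> i j k; apply: cproj_epi; rewrite -acompA !cdesc_proj acompA cdesc_proj
  -acompA cd_sq acomp0l acomp0r.
Defined.

Definition quo_proj : chain X quo.
Proof.
by exists (fun i => cproj (kinc (cut_map X i))) => i j; rewrite /= cdesc_proj.
Defined.

Lemma sub_lift i T (x : ahom T (X i)) :
  (a i -> x = 0) -> (b i -> cd X i (i + 1) \oa x = 0) ->
  exists u : ahom T (sub i), sub_inc i \oa u = x.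
Proof.
move=> Ha Hb; have x0 : cut_map X i \oa x = 0 by apply/cut_mapP.
by exists (klift x0); rewrite kinc_lift.
Qed.

Lemma sub_inc_cond i T (u : ahom T (sub i)) :
  (a i -> sub_inc i \oa u = 0) /\
  (b i -> cd X i (i + 1) \oa (sub_inc i \oa u) = 0).
Proof. by apply/cut_mapP; rewrite acompA kinc0 acomp0l. Qed.

Lemma sub_quo_ses : short_exact sub_inc quo_proj.
Proof.
move=> i; split; [exact: kinc_is_mono | exact: cproj_is_epi | exact: cproj0 |].
by move=> T x; apply: mono_normal; apply: kinc_is_mono.
Qed.

Lemma sub_term0 i : a i -> is_zero (sub i).
Proof.
move=> ai; apply: (mono_eq0 (@kinc_is_mono _ _ _ (cut_map X i))).
by have [/(_ ai)] := sub_inc_cond (aid (sub i)).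
Qed.

Lemma sub_term_iso i : ~~ a i -> ~~ b i ->
  @is_iso (acat A) _ _ (sub_inc i).
Proof.
move=> ai bi; apply: mono_epi_iso; first exact: kinc_is_mono.
have [| |u Eu] := @sub_lift i _ (aid (X i)); rewrite ?(negbTE ai) ?(negbTE bi) //.
exact: split_epi Eu.
Qed.

Lemma quo_term0 i : ~~ a i -> ~~ b i -> is_zero (quo i).
Proof.
move=> ai bi; apply: (epi_eq0 (@cproj_is_epi _ _ _ (kinc (cut_map X i)))).
apply: (epi_eq0 (iso_epi (sub_term_iso ai bi))).
by rewrite acomp1l cproj0.
Qed.

Lemma quo_term_iso i : a i -> @is_iso (acat A) _ _ (quo_proj i).
Proof.
move=> ai; apply: mono_epi_iso; last exact: cproj_is_epi.
apply: mono0 => Z x; have [mf _ _ lift] := sub_quo_ses i => /lift[u <-].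
by have [/(_ ai)] := sub_inc_cond u.
Qed.

Lemma sub_term_zero i : is_zero (X i) -> is_zero (sub i).
Proof. exact: is_zero_mono (@kinc_is_mono _ _ _ (cut_map X i)). Qed.

Lemma quo_term_zero i : is_zero (X i) -> is_zero (quo i).
Proof. exact: is_zero_epi (@cproj_is_epi _ _ _ (kinc (cut_map X i))). Qed.

End OneComplex.

Section Functoriality.
Variables (X Y : cplx A) (f : chain X Y).

Lemma sub_mapP i : cut_map Y i \oa (f i \oa kinc (cut_map X i)) = 0.
Proof.
have /cut_mapP[Ha Hb] := kinc0 (cut_map X i); apply/cut_mapP; split.
  by move=> /Ha->; rewrite acomp0r.
by move=> /Hb H; rewrite chain_cd H acomp0r.
Qed.

Definition sub_map : chain (sub X) (sub Y).
Proof.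
exists (fun i => klift (sub_mapP i)) => i j; apply: kinc_mono.
by rewrite /= !acompA !kinc_lift -!acompA !kinc_lift !acompA cmapP.
Defined.

Lemma sub_map_inc i : sub_inc Y i \oa sub_map i = f i \oa sub_inc X i.
Proof. exact: kinc_lift. Qed.

Lemma quo_mapP i : cproj (kinc (cut_map Y i)) \oa f i \oa kinc (cut_map X i) = 0.
Proof. by rewrite -acompA -(kinc_lift (sub_mapP i)) acompA cproj0 acomp0l. Qed.

Definition quo_map : chain (quo X) (quo Y).
Proof.
exists (fun i => cdesc (quo_mapP i)) => i j; apply: cproj_epi.
by rewrite /= -!acompA !cdesc_proj !acompA !cdesc_proj -!acompA cmapP.
Defined.

Lemma quo_map_proj i : quo_map i \oa quo_proj X i = quo_proj Y i \oa f i.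
Proof. exact: cdesc_proj. Qed.

End Functoriality.
End Cut.

(** ** Brutal and canonical truncation *)

Section Truncation.
Variable A : abelian.
Implicit Types (X Y : cplx A) (m i : int).

(** For [brutal_a m] and [brutal_b], [sub] keeps the terms of degree [> m]. *)
Definition brutal_a (m i : int) : bool := i <= m.
Definition brutal_b (i : int) : bool := false.

Lemma brutalP (m i : int) : brutal_a m (i + 1) -> brutal_a m i || brutal_b i.
Proof. by rewrite /brutal_a orbF; lia. Qed.

(** For [tau_a m] and [tau_b m], [sub] is the canonical truncation in degrees
    [<= m]: all of [X_i] for [i < m], the cycles for [i = m], and [0] above. *)
Definition tau_a (m i : int) : bool := m < i.
Definition tau_b (m i : int) : bool := m <= i.

Lemma tauP (m i : int) : tau_a m (i + 1) -> tau_a m i || tau_b m i.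
Proof. by rewrite /tau_a /tau_b; lia. Qed.

Section Tau.
Variables (m : int) (ab : forall i, tau_a m (i + 1) -> tau_a m i || tau_b m i).

Lemma tau_sub_coh_iso X i : i <= m -> coh_iso (sub_inc ab X) i.
Proof.
move=> im; apply: coh_isoI => T.
  move=> u cu /bnd_prev[T' [p [w [ep Ew]]]].
  have [|| v Ev] := @sub_lift _ _ _ ab X (i - 1) _ w.
  - by rewrite /tau_a; lia.
  - by rewrite /tau_b; lia.
  exists T', p, (i - 1), v; split=> //.
  apply: (@kinc_is_mono _ _ _ (cut_map _ _ X i)).
  by have := chain_cd (sub_inc ab X) i v; rewrite Ev Ew => <-; rewrite acompA.
move=> x cx; have [|| u Eu] := @sub_lift _ _ _ ab X i _ x.
- by rewrite /tau_a; lia.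
- by rewrite cx.
exists T, (aid T), u; split; first exact: epi_id.
  move=> j; apply: (@kinc_is_mono _ _ _ (cut_map _ _ X j)).
  by rewrite acomp0r; have := chain_cd (sub_inc ab X) j u; rewrite Eu cx => <-.
by rewrite acomp1r Eu subrr; apply: bnd0.
Qed.

Lemma tau_sub_coh0 X i : m < i -> is_zero (cohomology (sub ab X) i).
Proof. by move=> mi; apply: cohomology_term0; apply: sub_term0. Qed.

Lemma tau_quo_coh0 X i : i <= m -> is_zero (cohomology (quo ab X) i).
Proof.
move=> im; apply/cohomology_eq0 => T z cz.
have [T1 [p [x [ep Ex]]]] :=
  epi_pullback z (@cproj_is_epi _ _ _ (kinc (cut_map _ _ X i))).
apply: (bnd_loc ep); rewrite -Ex.
have : quo_proj ab X (i + 1) \oa (cd X i (i + 1) \oa x) = 0.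
  rewrite -chain_cd; have -> : quo_proj ab X i \oa x = z \oa p by [].
  by rewrite acompA cz acomp0l.
have [_ _ _ lift] := sub_quo_ses ab X (i + 1) => /lift[u Eu].
have [||v Ev] := @sub_lift _ _ _ ab X i _ x.
- by rewrite /tau_a; lia.
- move=> mi; rewrite -Eu; have [H _] := sub_inc_cond u; apply: H.
  by move: mi; rewrite /tau_a /tau_b; lia.
have [_ _ E0 _] := sub_quo_ses ab X i.
by apply: bnd_eq0; rewrite -Ev acompA E0 acomp0l.
Qed.

Lemma tau_quo_coh_iso X i : m < i -> coh_iso (quo_proj ab X) i.
Proof.
move=> mi; apply: coh_isoI => T z cz.
  move=> /bnd_prev[T1 [p1 [w [ep1 Ew]]]].
  have [T2 [p2 [y [ep2 Ey]]]] :=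
    epi_pullback w (@cproj_is_epi _ _ _ (kinc (cut_map _ _ X (i - 1)))).
  have iq := quo_term_iso ab X mi.
  exists T2, (p1 \oa p2), (i - 1), y; split; first exact: epi_comp.
  apply: (iso_mono iq); have E := chain_cd (quo_proj ab X) i y.
  by rewrite -E [X in _ \oa X]Ey acompA Ew -!acompA.
have [v [_ v2]] := quo_term_iso ab X mi.
have {}v2 : quo_proj ab X i \oa v = aid _ := v2.
have m1 : tau_a m (i + 1) by move: mi; rewrite /tau_a; lia.
exists T, (aid T), (v \oa z); split; first exact: epi_id.
  apply: cyc_next; apply: (mono_eq0 (iso_mono (quo_term_iso ab X m1))).
  by rewrite -chain_cd [quo_proj _ _ _ \oa _]acompA v2 acomp1l cz.
by rewrite acompA v2 acomp1l acomp1r subrr; apply: bnd0.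
Qed.

End Tau.
End Truncation.

Arguments brutalP : clear implicits.
Arguments tauP : clear implicits.


(** ** Replacing cohomologically bounded complexes by bounded ones *)

Definition has_below (s : boundedness) : bool :=
  match s with BoundedBelow | Bounded => true | _ => false end.
Definition has_above (s : boundedness) : bool :=
  match s with BoundedAbove | Bounded => true | _ => false end.

Section Boundedness.
Variable A : abelian.
Implicit Types X Y Z : cplx A.

Lemma boundedP s X :
  bounded s X <->
  (has_below s -> bounded_below X) /\ (has_above s -> bounded_above X).
Proof.
by case: s => /=; split=> [H|[H1 H2]]; try split=> //; try (by case: H);
  [exact: H1 | exact: H2 | exact: H1 | exact: H2].
Qed.

Lemma bounded_terms s X Y Z (k : int) :
  (forall i, is_zero (X (i + k)) -> is_zero (Y i) -> is_zero (Z i)) ->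
  bounded s X -> bounded s Y -> bounded s Z.
Proof.
move=> H /boundedP[bX aX] /boundedP[bY aY]; apply/boundedP; split=> h.
  have [n Hn] := bX h; have [m Hm] := bY h.
  exists (Num.min (n - k) m) => i; rewrite lt_min => /andP[i1 i2].
  by apply: H; [apply: Hn; lia | apply: Hm].
have [n Hn] := aX h; have [m Hm] := aY h.
exists (Num.max (n - k) m) => i; rewrite gt_max => /andP[i1 i2].
by apply: H; [apply: Hn; lia | apply: Hm].
Qed.

Lemma cone_bounded s X Y (f : chain X Y) :
  bounded s X -> bounded s Y -> bounded s (cone f).
Proof.
by move=> bX bY; apply: (@bounded_terms s X Y (cone f) 1 _ bX bY) => i;
  apply: is_zero_bip.
Qed.

Lemma shift_bounded s X k : bounded s X -> bounded s (shift X k).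
Proof.
by move=> bX; apply: (@bounded_terms s X X (shift X k) k _ bX bX) => i.
Qed.

Lemma hpb_bounded s X Y Z (f : chain X Y) (g : chain Z Y) :
  bounded s X -> bounded s Y -> bounded s Z -> bounded s (hpb f g).
Proof.
move=> bX bY bZ.
have bXZ : bounded s (cone (@Chain _ (shift X (-1)) Z (fun _ => 0)
    (fun _ _ => etrans (acomp0r _ _) (esym (acomp0l _ _))))).
  by apply: cone_bounded => //; apply: shift_bounded.
apply: (bounded_terms (k := -1) _ bY bXZ) => i Y0 XZ0.
apply: is_zero_bip => //; move: XZ0 => /=.
by rewrite addrK.
Qed.

Lemma term_iso_qis X Y (f : chain X Y) :
  (forall i, @is_iso (acat A) _ _ (f i)) -> qis f.
Proof.
move=> H i; apply: coh_isoI => T z cz.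
  move=> [T1 [p1 [j [w [ep1 Ew]]]]].
  have [T2 [p2 [v [ep2 Ev]]]] := epi_pullback w (iso_epi (H j)).
  exists T2, (p1 \oa p2), j, v; split; first exact: epi_comp.
  by apply: (iso_mono (H i)); rewrite -chain_cd Ev !acompA Ew.
have [T1 [p1 [x [ep1 Ex]]]] := epi_pullback z (iso_epi (H i)).
exists T1, p1, x; split=> //.
  move=> j; apply: (mono_eq0 (iso_mono (H j))).
  by rewrite -chain_cd Ex acompA cz acomp0l.
by rewrite Ex subrr; apply: bnd0.
Qed.

Lemma coh_iso0 X Y (f : chain X Y) i : coh_iso f i ->
  is_zero (cohomology X i) <-> is_zero (cohomology Y i).
Proof.
by move=> H; split;
  [apply: is_zero_epi (iso_epi H) | apply: is_zero_mono (iso_mono H)].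
Qed.

Lemma sub_bounded (a b : int -> bool)
    (ab : forall i, a (i + 1) -> a i || b i) s X :
  bounded s X -> bounded s (sub ab X).
Proof.
by move=> bX; apply: (@bounded_terms s X X _ 0 _ bX bX) => i _;
  apply: sub_term_zero.
Qed.

Lemma quo_bounded (a b : int -> bool)
    (ab : forall i, a (i + 1) -> a i || b i) s X :
  bounded s X -> bounded s (quo ab X).
Proof.
by move=> bX; apply: (@bounded_terms s X X _ 0 _ bX bX) => i _;
  apply: quo_term_zero.
Qed.

Definition coh_bounded s (m M : int) X : Prop :=
  (has_below s -> coh_ge m X) /\ (has_above s -> coh_le M X).

Lemma coh_bounded_le s m M m' M' X :
  m' <= m -> M <= M' -> coh_bounded s m M X -> coh_bounded s m' M' X.
Proof.
move=> mm MM [H1 H2]; split=> h i hi; [apply: H1 => // | apply: H2 => //].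
  exact: lt_le_trans mm.
exact: le_lt_trans hi.
Qed.

Lemma in_D_coh_bounded s X : in_D s X -> exists m M, coh_bounded s m M X.
Proof.
move=> [Y [/boundedP[bY aY] [w iw]]].
have [m Hm] : exists m, has_below s -> coh_ge m X.
  case: (has_below s) bY => [[//|m Hm]|_]; last by exists 0.
  by exists m => _ i /Hm/cohomology_term0; apply: proj2 (Diso_cohomology0 i iw).
have [M HM] : exists M, has_above s -> coh_le M X.
  case: (has_above s) aY => [[//|M HM]|_]; last by exists 0.
  by exists M => _ i /HM/cohomology_term0; apply: proj2 (Diso_cohomology0 i iw).
by exists m, M.
Qed.

Lemma in_D_coh_bounded2 s X Y : in_D s X -> in_D s Y ->
  exists m M, coh_bounded s m M X /\ coh_bounded s m M Y.
Proof.
move=> /in_D_coh_bounded[m1 [M1 H1]] /in_D_coh_bounded[m2 [M2 H2]].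
exists (Num.min m1 m2), (Num.max M1 M2).
by split; [apply: coh_bounded_le H1 | apply: coh_bounded_le H2];
  rewrite ?ge_min ?le_max lexx ?orbT.
Qed.

Lemma bounded_in_D s X : bounded s X -> in_D s X.
Proof. by move=> bX; exists X; split=> //; apply: isomorphic_refl. Qed.

(** When [s] imposes no bound on one side, the parameters of the truncation on
    that side are chosen so that it does nothing. The four kinds of boundedness
    thus share a single truncation functor. *)
Section TruncateBetween.
Variables (s : boundedness) (m M : int).

Definition lo_a i := has_above s && tau_a M i.
Definition lo_b i := has_above s && tau_b M i.
Definition hi_a i := ~~ has_below s || tau_a (m - 1) i.
Definition hi_b i := ~~ has_below s || tau_b (m - 1) i.

Lemma loP i : lo_a (i + 1) -> lo_a i || lo_b i.
Proof. by rewrite /lo_a /lo_b -andb_orr => /andP[-> /tauP]. Qed.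

Lemma hiP i : hi_a (i + 1) -> hi_a i || hi_b i.
Proof. by rewrite /hi_a /hi_b; case: (has_below s) => //=; apply: tauP. Qed.

Definition lo X := sub loP X.
Definition lo_inc X : chain (lo X) X := sub_inc loP X.
Definition lo_map X Y (f : chain X Y) : chain (lo X) (lo Y) := sub_map loP f.
Definition trunc X := quo hiP (lo X).
Definition trunc_proj X : chain (lo X) (trunc X) := quo_proj hiP (lo X).
Definition trunc_map X Y (f : chain X Y) : chain (trunc X) (trunc Y) :=
  quo_map hiP (lo_map f).

Lemma lo_inc_nat X Y (f : chain X Y) :
  Dmap (lo_inc Y) \oc Dmap (lo_map f) =~ Dmap f \oc Dmap (lo_inc X).
Proof. by apply: Dmap_square; apply: homotopic_eq => i; apply: sub_map_inc. Qed.

Lemma trunc_proj_nat X Y (f : chain X Y) :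
  Dmap (trunc_map f) \oc Dmap (trunc_proj X) =~
  Dmap (trunc_proj Y) \oc Dmap (lo_map f).
Proof. by apply: Dmap_square; apply: homotopic_eq => i; apply: quo_map_proj. Qed.

Lemma lo_inc_qis X : coh_bounded s m M X -> qis (lo_inc X).
Proof.
rewrite /lo_inc /lo => -[_ H]; move: (loP); rewrite /lo_a /lo_b.
case: (has_above s) H => /= [/(_ isT) H|_] P; last first.
  by apply: term_iso_qis => i; apply: sub_term_iso.
move=> i; have [iM|Mi] := leP i M; first exact: tau_sub_coh_iso.
by apply: coh_iso_zero; [apply: tau_sub_coh0 | apply: H].
Qed.

Lemma trunc_proj_qis X : coh_bounded s m M X -> qis (trunc_proj X).
Proof.
move=> H0; have qi := lo_inc_qis H0; case: H0 => H _.
rewrite /trunc_proj /trunc; move: (hiP); rewrite /hi_a /hi_b.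
case: (has_below s) H => /= [/(_ isT) H|_] P; last first.
  by apply: term_iso_qis => i; apply: quo_term_iso.
move=> i; have [im|mi] := leP i (m - 1); last exact: tau_quo_coh_iso.
apply: coh_iso_zero; last exact: tau_quo_coh0.
by apply/(coh_iso0 (qi i)); apply: H; lia.
Qed.

Lemma lo_bounded X : bounded s X -> bounded s (lo X).
Proof. exact: sub_bounded. Qed.

Lemma trunc_bounded X : bounded s (trunc X).
Proof.
apply/boundedP; split=> h.
  exists (m - 1) => i im; apply: quo_term0; rewrite /hi_a /hi_b h /=.
    by rewrite /tau_a; lia.
  by rewrite /tau_b; lia.
exists M => i im; apply: is_zero_epi (@cproj_is_epi _ _ _ _) _.
by apply: sub_term0; rewrite /lo_a h.
Qed.

End TruncateBetween.

(** The comparison runs through [lo X], which maps to [X] and to its truncation;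
    the equation determines it, whence the naturality below. *)
Lemma trunc_cmp s m M X : coh_bounded s m M X ->
  exists r : @hom (Dcat A) X (trunc s m M X),
    is_iso r /\ r \oc Dmap (lo_inc s M X) =~ Dmap (trunc_proj s m M X).
Proof.
move=> hX; have [i [i1 i2]] := Dmap_iso (lo_inc_qis hX).
exists (Dmap (trunc_proj s m M X) \oc i); split.
  apply: is_iso_comp; first exact: Dmap_iso (trunc_proj_qis hX).
  exact: inv_iso i1 i2.
by rewrite -compcA i1 compc1.
Qed.

Lemma trunc_cmp_nat s m M X Y (f : chain X Y)
    (rX : @hom (Dcat A) X (trunc s m M X))
    (rY : @hom (Dcat A) Y (trunc s m M Y)) :
  coh_bounded s m M X ->
  rX \oc Dmap (lo_inc s M X) =~ Dmap (trunc_proj s m M X) ->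
  rY \oc Dmap (lo_inc s M Y) =~ Dmap (trunc_proj s m M Y) ->
  rY \oc Dmap f =~ Dmap (trunc_map s m M f) \oc rX.
Proof.
move=> hX EX EY; apply: (iso_cancelr (Dmap_iso (lo_inc_qis hX))).
by rewrite -!compcA -lo_inc_nat EX trunc_proj_nat compcA EY.
Qed.

(** Morphisms of [D^s] are defined with roofs whose top may be unbounded;
    truncating the top shows that they are generated by chain maps between
    objects of [K^s] and inverses of such. *)
Lemma Dstar_generated s (Pr : forall X Y : Dstar s A, hom X Y -> Prop) :
  (forall (X Y : Dstar s A) (u v : hom X Y), u =~ v -> Pr X Y u -> Pr X Y v) ->
  (forall (X Y Z : Dstar s A) (v : hom Y Z) (u : hom X Y),
     Pr Y Z v -> Pr X Y u -> Pr X Z (v \oc u)) ->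
  (forall (X Y : Dstar s A) (u : hom X Y) (v : hom Y X),
     v \oc u =~ idc X -> u \oc v =~ idc Y -> Pr X Y u -> Pr Y X v) ->
  (forall (X Y : Dstar s A) (f : chain (proj1_sig X) (proj1_sig Y)),
     Pr X Y (Dmap f)) ->
  forall (X Y : Dstar s A) (w : hom X Y), Pr X Y w.
Proof.
move=> Pheq Pcomp Pinv Pmap [X bX] [Y bY] w.
have [Z [p [f [qp E]]]] := @roof A X Y w.
have [m [M [hX hY]]] := in_D_coh_bounded2 (bounded_in_D bX) (bounded_in_D bY).
have hZ : coh_bounded s m M Z.
  by case: hX => H1 H2; split=> h i hi; apply/(coh_iso0 (qp i));
    [apply: H1 | apply: H2].
have bT V := @trunc_bounded s m M V.
pose T V : Dstar s A := exist _ (trunc s m M V) (bT V).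
have Pcmp V (bV : bounded s V) (r : @hom (Dcat A) V (trunc s m M V)) :
    coh_bounded s m M V ->
    r \oc Dmap (lo_inc s M V) =~ Dmap (trunc_proj s m M V) ->
    Pr (exist _ V bV) (T V) r.
  move=> hV Er; pose L : Dstar s A := exist _ (lo s M V) (lo_bounded M bV).
  have [i [i1 i2]] := Dmap_iso (lo_inc_qis hV).
  apply: (Pheq (exist _ V bV) (T V) (Dmap (trunc_proj s m M V) \oc i)).
    apply: heq_trans (comp_heq (heq_sym Er) (heq_refl i)) _.
    apply: heq_trans (heq_sym (compcA _ _ _)) _.
    by apply: heq_trans (comp_heq (heq_refl r) i2) (compc1 _).
  apply: (Pcomp _ L); first exact: (Pmap L (T V)).
  by apply: (Pinv L (exist _ V bV) _ _ i1 i2); apply: (Pmap L (exist _ V bV)).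
have [rX [iX EX]] := trunc_cmp hX; have [rY [iY EY]] := trunc_cmp hY.
have [rZ [iZ EZ]] := trunc_cmp hZ.
have Np := trunc_cmp_nat p hZ EZ EX; have Nf := trunc_cmp_nat f hZ EZ EY.
have [ti [ti1 ti2]] : is_iso (Dmap (trunc_map s m M p)).
  apply: (is_iso_left iZ); apply: is_iso_heq Np _.
  by apply: is_iso_comp => //; apply: Dmap_iso.
have [ry [ry1 ry2]] := iY.
apply: (Pheq (exist _ X bX) (exist _ Y bY)
  (ry \oc (Dmap (trunc_map s m M f) \oc (ti \oc rX)))).
  apply: (iso_cancelr (Dmap_iso qp)); apply: (iso_cancell iY).
  rewrite -!compcA (compcA rY) ry2 comp1c Np (compcA ti) ti1 comp1c.
  by apply: heq_trans (heq_sym Nf) (comp_heq (heq_refl rY) (heq_sym E)).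
apply: (Pcomp _ (T Y)).
  exact: (Pinv (exist _ Y bY) (T Y) _ _ ry1 ry2 (Pcmp _ _ _ hY EY)).
apply: (Pcomp _ (T Z)); first exact: (Pmap (T Z) (T Y)).
apply: (Pcomp _ (T X)); last exact: Pcmp.
exact: (Pinv (T Z) (T X) _ _ ti1 ti2 (Pmap (T Z) (T X) _)).
Qed.

End Boundedness.

(** * Derived functors and triangles *)

Section OnComplexes.
Variables (A B : abelian) (F : additive_contrafunctor A B).
Implicit Types X Y Z : cplx A.

Lemma fmap_comp (X Y Z : A) (g : ahom Y Z) (f : ahom X Y) :
  fmap F (g \oa f) = fmap F f \oa fmap F g.
Proof. exact: (ct_comp F). Qed.

Lemma fmap_id (X : A) : fmap F (aid X) = aid _.
Proof. exact: (ct_id F). Qed.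

Lemma fmapD (X Y : A) (f g : ahom X Y) : fmap F (f + g) = fmap F f + fmap F g.
Proof. exact: (ac_add F). Qed.

Lemma fmapN (X Y : A) (f : ahom X Y) : fmap F (- f) = - fmap F f.
Proof.
by apply/eqP; rewrite -addr_eq0 -fmapD addNr fmap0.
Qed.

(** The sequence [Y -> cone f -> X[1]] splits in each degree, and additive
    functors preserve split sequences. *)
Lemma on_cone_ses X Y (f : chain X Y) :
  short_exact (on_chain F (cone_out f)) (on_chain F (cone_in f)).
Proof.
move=> n /=; split.
- apply: (@split_mono _ _ _ _ (fmap F (ainl _ _))).
  by rewrite -fmap_comp afst_inl fmap_id.
- apply: (@split_epi _ _ _ _ (fmap F (asnd _ _))).
  by rewrite -fmap_comp asnd_inr fmap_id.
- by rewrite -fmap_comp afst_inr fmap0.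
move=> T x x0; exists (fmap F (ainl _ _) \oa x).
rewrite -[RHS]acomp1l -fmap_id -abipP fmapD acompDl !fmap_comp.
by rewrite -[X in _ = _ + X]acompA x0 acomp0r addr0 acompA.
Qed.

Lemma cone_cd_gen X Y (f : chain X Y) i j T (x : ahom T (X (i + 1)))
    (y : ahom T (Y i)) :
  cd (cone f) i j \oa apair x y =
  apair (- (cd X (i + 1) (j + 1) \oa x))
        (idd Y (i + 1) j \oa (f (i + 1) \oa x) + cd Y i j \oa y).
Proof.
rewrite /= acompDl -!acompA acompDl -!acompA.
by rewrite !fst_apair snd_apair acompNl.
Qed.

(** A contravariant additive functor applied to [X -> Y -> cone f]: the
    composite of the two maps stays homotopic to zero, and a cycle of [F Y]
    that becomes a boundary in [F X] is completed to one of [F (cone f)]. *)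
Lemma on_cone_exact X Y (f : chain X Y) n :
  exact_pair (cohomology_map (on_chain F (cone_in f)) n)
             (cohomology_map (on_chain F f) n).
Proof.
have e1 : - n = - (n + 1) + 1 by lia.
have e2 : - n + 1 = - (n - 1) by lia.
apply: coh_exact => T.
  move=> x cx; pose c := ainl (X (- (n + 1) + 1)) (Y (- (n + 1))) \oa
    idd X (- n) (- (n + 1) + 1).
  have Ec : cd (cone f) (- (n + 1)) (- n) \oa c =
      apair (- cd X (- n) (- n + 1)) (f (- n)).
    rewrite /c ainlE cone_cd_gen acomp0r addr0; congr apair.
      by rewrite -[idd _ _ _]acomp1r cd_idd // acomp1r.
    rewrite chain_idd idd_transK //.
  have cx1 : fmap F (cd (cone f) (- (n + 1)) (- n)) \oa x = 0 := cx (n + 1).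
  have E : fmap F (f (- n)) \oa (fmap F (ainr _ _) \oa x) =
      fmap F (cd X (- n) (- n + 1)) \oa (fmap F (ainl _ _) \oa x).
    have := congr1 (fun u => fmap F c \oa u) cx1.
    rewrite acomp0r acompA -fmap_comp Ec /apair fmapD !fmap_comp fmapN acompDl.
    move=> E0; apply/eqP; rewrite -subr_eq0; apply/eqP.
    by rewrite -[RHS]E0 !acompNl !acompA; abel.
  exists T, (aid T), (n - 1).
  exists (fmap F (idd X (- (n - 1)) (- n + 1)) \oa (fmap F (ainl _ _) \oa x)).
  split; first exact: epi_id.
  have Ed : idd X (- (n - 1)) (- n + 1) \oa cd X (- n) (- (n - 1)) =
      cd X (- n) (- n + 1).
    by rewrite -[cd X _ (- (n - 1))]acomp1r idd_cd // acomp1r.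
  by rewrite acomp1r [RHS]E -Ed fmap_comp -[RHS]acompA.
move=> y cy /bnd_prev[T' [p [w [ep Ew]]]].
pose x := fmap F (asnd (X (- n + 1)) (Y (- n))) \oa (y \oa p) +
  fmap F (idd X (- n + 1) (- (n - 1)) \oa afst (X (- n + 1)) (Y (- n))) \oa w.
exists T', p, x; split=> //.
  apply: cyc_next; rewrite /x acompDr !acompA -!fmap_comp.
  have Es : asnd (X (- n + 1)) (Y (- n)) \oa cd (cone f) (- (n + 1)) (- n) =
      idd Y (- (n + 1) + 1) (- n) \oa f _ \oa afst _ _ +
      cd Y (- (n + 1)) (- n) \oa asnd _ _.
    apply: ahom_ext => U; apply: apair_ind => u v.
    by rewrite acompDl -!acompA cone_cd_gen !snd_apair fst_apair.
  have Ef : afst (X (- n + 1)) (Y (- n)) \oa cd (cone f) (- (n + 1)) (- n) =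
      - (cd X (- (n + 1) + 1) (- n + 1) \oa afst _ _).
    apply: ahom_ext => U; apply: apair_ind => u v.
    by rewrite acompNl -!acompA cone_cd_gen !fst_apair.
  rewrite -[idd _ _ _ \oa _ \oa _]acompA Ef Es acompNr fmapD fmapN.
  rewrite -chain_idd !fmap_comp !acompDl !acompNl -!acompA.
  have -> : fmap F (cd Y (- (n + 1)) (- n)) \oa (y \oa p) = 0.
    by rewrite acompA [_ \oa y]cy acomp0l.
  rewrite acomp0r addr0.
  have -> : fmap F (f (- n)) \oa (y \oa p) =
      fmap F (cd X (- n) (- (n - 1))) \oa w by rewrite Ew acompA.
  rewrite -acompBr [X in _ \oa X](_ : _ = 0) ?acomp0r //.
  rewrite !acompA -!fmap_comp; apply/eqP; rewrite subr_eq0; apply/eqP.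
  congr (fmap F _ \oa w).
  have := @cd_idd _ X (- (n + 1) + 1) (- n) (- (n - 1)) _ (aid _) (esym e1).
  rewrite !acomp1r => ->.
  have := @idd_cd _ X (- (n + 1) + 1) (- n + 1) (- (n - 1)) _ (aid _) e2.
  by rewrite !acomp1r.
rewrite /x /= acompDr !acompA -!fmap_comp asnd_inr fmap_id acomp1l.
rewrite -acompA afst_inr acomp0r fmap0 acomp0l addr0 subrr.
exact: bnd0.
Qed.

Definition on_shift X k : chain (on_cplx F (shift X k)) (shift (on_cplx F X) (- k)).
Proof.
exists (fun n => fmap F (idd X (- (n - k)) (- n + k))) => i j /=.
have ei : - (i - k) = - i + k by lia.
have ej : - (j - k) = - j + k by lia.
have -> : odd `|- k|%N = odd `|k|%N by lia.
have E : cd X (- j + k) (- i + k) \oa idd X (- (j - k)) (- j + k) =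
    idd X (- (i - k)) (- i + k) \oa cd X (- (j - k)) (- (i - k)).
  apply: ahom_ext => T x.
  by rewrite -!acompA idd_cd // cd_idd.
by case: (odd _); rewrite ?fmapN ?acompNl ?acompNr -!fmap_comp E.
Defined.

Lemma on_shift_qis X k : qis (on_shift X k).
Proof.
apply: term_iso_qis => n; have e : - (n - k) = - n + k by lia.
have K i j : i = j -> fmap F (idd X j i) \oa fmap F (idd X i j) = aid _.
  by move=> ij; rewrite -fmap_comp idd_trans ?idd_refl ?fmap_id.
by exists (fmap F (idd X (- n + k) (- (n - k)))); split; apply: K.
Qed.

Lemma on_shift_nat X Y (f : chain X Y) k :
  Dmap (on_shift X k) \oc Dmap (on_chain F (shift_chain f k)) =~
  Dmap (shift_chain (on_chain F f) (- k)) \oc Dmap (on_shift Y k).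
Proof.
apply: Dmap_square; apply: homotopic_eq => n /=.
by rewrite -!fmap_comp chain_idd.
Qed.

End OnComplexes.

Section DerivedFunctor.
Variables (A B : abelian) (F : additive_contrafunctor A B) (s : boundedness).
Variables (P : cplx A -> Prop) (hP : adapted F s P) (RF : right_derived hP).

Definition dob X (bX : bounded s X) : Dstar s A := exist _ X bX.
Definition pob R (pR : P R) : Dstar s A := dob (ad_bounded hP pR).

(** Chain maps resolve: a resolution of the target is pulled back along the
    map, and the homotopy pullback is resolved in turn. *)
Lemma resolve_map (X Y R' : cplx A) (f : chain X Y) (q' : chain R' Y) :
  bounded s X -> bounded s Y -> P R' -> qis q' ->
  exists (R : cplx A) (q : chain R X) (g : chain R R'),
    [/\ P R, qis q & homotopic (chain_comp f q) (chain_comp q' g)].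
Proof.
move=> bX bY pR' qq'.
have bH := hpb_bounded f q' bX bY (ad_bounded hP pR').
have [R [r [pR qr]]] := ad_resolve hP bH.
exists R, (chain_comp (hpb_fst f q') r), (chain_comp (hpb_snd f q') r); split=> //.
  by apply: qis_comp => //; apply: hpb_fst_qis.
have := @homotopic_comp A _ _ _ _ _ r r (hpb_homotopic f q') (homotopic_refl r).
case=> h hP'; exists h => i; rewrite -hP' /=.
by rewrite !acompA.
Qed.

(** [a] is the isomorphism [F R = RF X] defined by the resolution [q]. *)
Definition computes (X : Dstar s A) R (pR : P R) (q : chain R (proj1_sig X))
    (a : @hom (Dcat B) (on_cplx F R) (RF X)) : Prop :=
  ct_map RF (Dmap q : @hom (Dstar s A) (pob pR) X) \oc a =~ rd_can RF pR.

Lemma computes_exists (X : Dstar s A) R (pR : P R) (q : chain R (proj1_sig X)) :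
  qis q -> exists a, computes pR q a /\ is_iso a.
Proof.
move=> qq; have iq : @is_iso (Dstar s A) (pob pR) X (Dmap q) := Dmap_iso qq.
have [r [r1 r2]] := ct_iso RF iq.
exists (r \oc rd_can RF pR); split.
  by rewrite /computes compcA r2 comp1c.
by apply: is_iso_comp; [apply: inv_iso r1 r2 | apply: rd_can_iso].
Qed.

Lemma computes_nat (X Y : Dstar s A) R R' (pR : P R) (pR' : P R')
    (q : chain R (proj1_sig X)) (q' : chain R' (proj1_sig Y)) a a'
    (f : chain (proj1_sig X) (proj1_sig Y)) (g : chain R R') :
  computes pR q a -> computes pR' q' a' -> qis q ->
  homotopic (chain_comp f q) (chain_comp q' g) ->
  a \oc Dmap (on_chain F g) =~ ct_map RF (Dmap f : hom X Y) \oc a'.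
Proof.
move=> Ea Ea' qq h.
have iq : @is_iso (Dstar s A) (pob pR) X (Dmap q) := Dmap_iso qq.
apply: (iso_cancell (ct_iso RF iq)).
rewrite /computes in Ea Ea'.
rewrite compcA Ea (rd_can_nat RF pR pR' g) -Ea' !compcA -!ct_comp.
apply: comp_heq; last exact: heq_refl.
by apply: ct_heq; apply: heq_sym (Dmap_square h).
Qed.

Lemma on_chain_iso R R' (pR : P R) (pR' : P R') (g : chain R R') :
  qis g -> is_iso (Dmap (on_chain F g)).
Proof.
move=> qg; apply: (is_iso_right (rd_can_iso RF pR)).
apply: is_iso_heq (heq_sym (rd_can_nat RF pR pR' g)) _.
apply: is_iso_comp; last exact: rd_can_iso.
by apply: ct_iso; apply: Dmap_iso qg.
Qed.

(** A triangulated subcategory contains the cone of the resolved map, so the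
    whole triangle is resolved at once. *)
Lemma resolve_cone (X Y : cplx A) (f : chain X Y) :
  bounded s X -> bounded s Y ->
  exists (RX RY : cplx A) (g : chain RX RY) (p : chain RX X) (q : chain RY Y)
      (c : chain (cone g) (cone f)),
    [/\ [/\ P RX, P RY & P (cone g)], [/\ qis p, qis q & qis c],
      homotopic (chain_comp f p) (chain_comp q g),
      homotopic (chain_comp (cone_in f) q) (chain_comp c (cone_in g)) &
      homotopic (chain_comp (cone_out f) c)
                (chain_comp (shift_chain p 1) (cone_out g))].
Proof.
move=> bX bY; have [RY [q [pY qq]]] := ad_resolve hP bY.
have [RX [p [g [pX qp h]]]] := resolve_map f bX bY pY qq.
have h' := homotopic_sym h.
have [c [cin cout]] := cone_map_exists h'.
exists RX, RY, g, p, q, c; split=> //.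
- by split=> //; apply: (tri_cone (ad_tri hP)).
- by split=> //; apply: cone_map_qis h' cin cout qp qq.
- by apply: homotopic_eq => i /=; rewrite cin.
- by apply: homotopic_eq => i /=; rewrite cout.
Qed.

Lemma ses_pair_iso (V X W : cplx B) (f : chain V X) (g : chain X W) :
  short_exact f g -> @pair_iso (Dcat B) _ _ _ _ _ _
    (Dmap f) (Dmap (cone_in f)) (Dmap f) (Dmap g).
Proof.
move=> fg; have gf0 i : g i \oa f i = 0 by have [] := fg i.
exists (Dmap (chain_id V)), (Dmap (chain_id X)), (Dmap (cone_desc gf0)).
split; try exact: is_iso_id.
- by apply: Dmap_iso; apply: ses_cone_qis fg.
- by apply: heq_trans (comp1c _) (heq_sym (compc1 _)).
apply: heq_trans _ (heq_sym (compc1 _)); rewrite -Dmap_comp.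
by apply: Dmap_eq => i; rewrite -(cone_desc_in gf0).
Qed.

(** On resolutions, [Y -> cone f -> X[1]] becomes the short exact sequence of
    [on_cone_ses], whose last term is the cone of its first map. *)
Lemma rd_triangle (X Y : cplx A) (f : chain X Y) (bX : bounded s X)
    (bY : bounded s Y) (bC : bounded s (cone f)) (bS : bounded s (shift X 1)) :
  exists (V E : cplx B) (u : chain V E),
    @pair_iso (Dcat B) _ _ _ _ _ _
      (ct_map RF (Dmap (cone_out f) : hom (dob bC) (dob bS)))
      (ct_map RF (Dmap (cone_in f) : hom (dob bY) (dob bC)))
      (Dmap u) (Dmap (cone_in u)).
Proof.
have [RX [RY [g [p [q [c [[pX pY pC] [qp qq qc] h1 h2 h3]]]]]]] :=
  resolve_cone f bX bY.
have pS : P (shift RX 1) := tri_shift (ad_tri hP) 1 pX.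
have [aY [EaY iaY]] := computes_exists (X := dob bY) pY qq.
have [aC [EaC iaC]] := computes_exists (X := dob bC) pC qc.
have [aS [EaS iaS]] := computes_exists (X := dob bS) pS (shift_qis 1 qp).
exists _, _, (on_chain F (cone_out g)).
apply: pair_iso_trans (pair_iso_sym (ses_pair_iso (on_cone_ses F g))).
apply: pair_iso_sym; exists aS, aC, aY; split=> //.
  exact: (computes_nat EaC EaS qc h3).
exact: (computes_nat EaY EaC qq h2).
Qed.

Lemma HD_exact_transport (C : abelian) (X Y Z X' Y' Z' : cplx C)
    (u : @hom (Dcat C) X Y) (v : @hom (Dcat C) Y Z)
    (u' : @hom (Dcat C) X' Y') (v' : @hom (Dcat C) Y' Z') i :
  pair_iso u v u' v' -> exact_pair (HD_map i u') (HD_map i v') ->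
  exact_pair (HD_map i u) (HD_map i v).
Proof.
move=> [a [b [c [ia ib ic E1 E2]]]] [vu0 H].
have := HD_weq i E1; have := HD_weq i E2; rewrite /= => E2' E1'.
have ma := iso_mono (co_iso (HD C i) ia); have ea := iso_epi (co_iso (HD C i) ia).
have mb := iso_mono (co_iso (HD C i) ib); have mc := iso_mono (co_iso (HD C i) ic).
split=> [|T y vy0].
  by apply: (mono_eq0 mc); rewrite acompA [_ \oa HD_map i v]E2' -acompA E1'
    acompA vu0 acomp0l.
have [|T1 [p1 [x [ep1 Ex]]]] := H _ (HD_map i b \oa y).
  by rewrite acompA -E2' -acompA vy0 acomp0r.
have [T2 [p2 [x' [ep2 Ex']]]] := epi_pullback x ea.
exists T2, (p1 \oa p2), x'; split; first exact: epi_comp.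
apply: mb; rewrite [LHS]acompA [_ \oa HD_map i u]E1' -acompA [_ \oa x']Ex'.
by rewrite acompA Ex -!acompA.
Qed.

Lemma cone_square_pair_iso (C : abelian) (X Y X' Y' : cplx C) (f : chain X Y)
    (f' : chain X' Y') (a : chain X X') (b : chain Y Y') :
  homotopic (chain_comp b f) (chain_comp f' a) -> qis a -> qis b ->
  @pair_iso (Dcat C) _ _ _ _ _ _ (Dmap f) (Dmap (cone_in f))
    (Dmap f') (Dmap (cone_in f')).
Proof.
move=> h qa qb; have [c [cin cout]] := cone_map_exists h.
exists (Dmap a), (Dmap b), (Dmap c); split; try exact: Dmap_iso.
- exact/Dmap_iso/(cone_map_qis h cin cout qa qb).
- exact: Dmap_square.
- by apply: Dmap_square; apply: homotopic_eq => i /=; rewrite cin.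
Qed.

(** The derived functor is cohomological. The chain map [f] that presents the
    triangle may be one between unbounded complexes, which happens when the
    triangle is itself the image of a triangle under a derived functor; it is
    first truncated, which is possible because its terms are isomorphic in the
    derived category to objects of [D^s], and then resolved. *)
Lemma rd_exact (X Y Z : Dstar s A) (u : hom X Y) (v : hom Y Z) (V E : cplx A)
    (f : chain V E) i :
  @pair_iso (Dcat A) _ _ _ _ _ _ u v (Dmap f) (Dmap (cone_in f)) ->
  exact_pair (HD_map i (ct_map RF v)) (HD_map i (ct_map RF u)).
Proof.
move=> uvf.
have [m [M [hV hE]]] : exists m M, coh_bounded s m M V /\ coh_bounded s m M E.
  case: uvf => a [b [_ [ia ib _ _ _]]].
  have dV : in_D s V.
    exists (proj1_sig X); split; first exact: proj2_sig.
    by apply: isomorphic_sym; exists a.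
  have dE : in_D s E.
    exists (proj1_sig Y); split; first exact: proj2_sig.
    by apply: isomorphic_sym; exists b.
  exact: in_D_coh_bounded2 dV dE.
pose f2 := trunc_map s m M f.
have bV := @trunc_bounded A s m M V; have bE := @trunc_bounded A s m M E.
have bC := cone_bounded f2 bV bE.
have {}uvf : @pair_iso (Dstar s A) _ _ _ (dob bV) (dob bE) (dob bC) u v
    (Dmap f2) (Dmap (cone_in f2)).
  apply: (pair_iso_trans uvf).
  have H1 : homotopic (chain_comp (lo_inc s M E) (lo_map s M f))
      (chain_comp f (lo_inc s M V)).
    by apply: homotopic_eq => j; apply: sub_map_inc.
  have H2 : homotopic (chain_comp (trunc_proj s m M E) (lo_map s M f))
      (chain_comp f2 (trunc_proj s m M V)).
    by apply: homotopic_eq => j; apply: esym; apply: quo_map_proj.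
  apply: (@pair_iso_trans (Dcat A)).
    apply: (@pair_iso_sym (Dcat A)).
    exact: cone_square_pair_iso H1 (lo_inc_qis hV) (lo_inc_qis hE).
  exact: cone_square_pair_iso H2 (trunc_proj_qis hV) (trunc_proj_qis hE).
apply: (HD_exact_transport (ct_pair_iso RF uvf)).
have [RX [RY [g [p [q [c [[pX pY pC] [qp qq qc] h1 h2 _]]]]]]] :=
  resolve_cone f2 bV bE.
have [aV [EaV iaV]] := computes_exists (X := dob bV) pX qp.
have [aE [EaE iaE]] := computes_exists (X := dob bE) pY qq.
have [aC [EaC iaC]] := computes_exists (X := dob bC) pC qc.
apply: (@HD_exact_transport B _ _ _ _ _ _ _ _ (Dmap (on_chain F (cone_in g)))
  (Dmap (on_chain F g)) i _ (on_cone_exact F g i)).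
apply: (@pair_iso_sym (Dcat B)); exists aC, aE, aV; split=> //.
  exact: (computes_nat EaE EaC qq h2).
exact: (computes_nat EaV EaE qp h1).
Qed.

End DerivedFunctor.

(** ** Derived functors commute with shifts *)

Section DerivedShift.
Variables (A B : abelian) (F : additive_contrafunctor A B) (s : boundedness).
Variables (P : cplx A -> Prop) (hP : adapted F s P) (RF : right_derived hP).
Variable k : int.

Definition shiftS : cofunctor (Dstar s A) (Dstar s A) :=
  @Cofunctor (Dstar s A) (Dstar s A)
    (fun X => exist _ (shift (proj1_sig X) k) (shift_bounded k (proj2_sig X)))
    (fun X Y => @shift_word A k (proj1_sig X) (proj1_sig Y))
    (fun X Y => @shift_word_weq A k (proj1_sig X) (proj1_sig Y))
    (fun X => shift_word_id k (proj1_sig X))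
    (fun _ _ _ _ _ => heq_refl _).

(** The identification of [RF (X[k])] with [(RF X)[-k]] defined by some
    resolution of [X]; it is kept as a relation, naturality showing that it
    does not depend on the resolution. *)
Definition rd_shift (X : Dstar s A)
    (sg : @hom (Dcat B) (RF (shiftS X)) (shift (RF X) (- k))) : Prop :=
  exists (R : cplx A) (pR : P R) (pRk : P (shift R k))
      (q : chain R (proj1_sig X)) a (b : @hom (Dcat B) _ (RF (shiftS X))),
    [/\ qis q, @computes _ _ _ _ _ _ RF X _ pR q a,
        @computes _ _ _ _ _ _ RF (shiftS X) _ pRk (shift_chain q k) b &
        sg \oc b =~ co_map (shiftD B (- k)) a \oc Dmap (on_shift F R k)].

Lemma rd_shift_exists (X : Dstar s A) : exists sg, @rd_shift X sg /\ is_iso sg.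
Proof.
have [R [q [pR qq]]] := ad_resolve hP (proj2_sig X).
have pRk := tri_shift (ad_tri hP) k pR.
have [a [Ea ia]] := computes_exists RF pR qq.
have [b [Eb ib]] := computes_exists RF (X := shiftS X) pRk (shift_qis k qq).
have [b' [b1 b2]] := ib.
exists ((co_map (shiftD B (- k)) a \oc Dmap (on_shift F R k)) \oc b'); split.
  exists R, pR, pRk, q, a, b; split=> //.
  by rewrite -!compcA b1 compc1.
apply: is_iso_comp; last exact: inv_iso b1 b2.
apply: is_iso_comp; first exact: co_iso.
by apply: Dmap_iso; apply: on_shift_qis.
Qed.

(** The map between the two resolutions is a quasi-isomorphism in [P], and
    [F] makes it an isomorphism that can be cancelled. *)
Lemma rd_shift_refine (X : Dstar s A) sg R R' (pR : P R) (pR' : P R')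
    (pRk : P (shift R k)) (pRk' : P (shift R' k)) (q : chain R (proj1_sig X))
    (q' : chain R' (proj1_sig X)) (h : chain R' R) a a' b b' :
  qis q -> qis q' -> homotopic (chain_comp q h) q' ->
  @computes _ _ _ _ _ _ RF X _ pR q a -> @computes _ _ _ _ _ _ RF X _ pR' q' a' ->
  @computes _ _ _ _ _ _ RF (shiftS X) _ pRk (shift_chain q k) b ->
  @computes _ _ _ _ _ _ RF (shiftS X) _ pRk' (shift_chain q' k) b' ->
  sg \oc b =~ co_map (shiftD B (- k)) a \oc Dmap (on_shift F R k) ->
  sg \oc b' =~ co_map (shiftD B (- k)) a' \oc Dmap (on_shift F R' k).
Proof.
move=> qq qq' hq Ea Ea' Eb Eb' E.
have qh : qis h.
  apply: iso_qis; apply: (is_iso_right (Dmap_iso qq)).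
  apply: is_iso_heq (Dmap_comp _ _) _.
  exact: is_iso_heq (heq_sym (Dmap_homotopic hq)) (Dmap_iso qq').
have hid : homotopic (chain_comp (chain_id (proj1_sig X)) q') (chain_comp q h).
  apply: homotopic_trans (homotopic_sym hq).
  by apply: homotopic_eq => i; rewrite /= acomp1l.
have Na := computes_nat Ea' Ea qq' hid.
have hidk : homotopic (chain_comp (chain_id (proj1_sig (shiftS X)))
    (shift_chain q' k)) (chain_comp (shift_chain q k) (shift_chain h k)).
  apply: homotopic_trans (homotopic_trans (shift_homotopic k hid) _).
    by apply: homotopic_eq => i; rewrite /= acomp1l.
  exact: homotopic_eq.
have Nb := @computes_nat _ _ _ _ _ _ _ (shiftS X) (shiftS X) _ _ _ _ _ _ _ _ _ _
  Eb' Eb (shift_qis k qq') hidk.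
have {}Na : a' \oc Dmap (on_chain F h) =~ a.
  apply: heq_trans Na _; apply: heq_trans (comp_heq (ct_id RF X) (heq_refl a)) _.
  exact: comp1c.
have {}Nb : b' \oc Dmap (on_chain F (shift_chain h k)) =~ b.
  apply: heq_trans Nb _.
  apply: heq_trans (comp_heq (ct_id RF (shiftS X)) (heq_refl b)) _.
  exact: comp1c.
have ih : is_iso (Dmap (on_chain F (shift_chain h k))).
  by apply: (on_chain_iso RF pRk' pRk); apply: shift_qis.
apply: (iso_cancelr ih); rewrite -!compcA Nb (on_shift_nat F h k) E compcA.
rewrite -(co_heq (shiftD B (- k)) Na) co_comp shiftD_map.
exact: heq_refl.
Qed.

(** By [Dstar_generated] it is enough to treat a chain map in [K^s], and that is
    compared with a chain map between resolutions. *)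
Lemma rd_shift_nat (X Y : Dstar s A) (w : hom X Y) sX sY :
  @rd_shift X sX -> @rd_shift Y sY ->
  co_map (shiftD B (- k)) (ct_map RF w) \oc sY =~
  sX \oc ct_map RF (co_map shiftS w).
Proof.
move: X Y w sX sY; apply: Dstar_generated.
- move=> X Y u v uv H sX sY hX hY; have := H sX sY hX hY.
  by rewrite (co_heq (shiftD B (- k)) (ct_heq RF uv))
    (ct_heq RF (co_heq shiftS uv)).
- move=> X Y Z v u Hv Hu sX sZ hX hZ.
  have [sY [hY _]] := rd_shift_exists Y.
  rewrite (co_heq (shiftD B (- k)) (ct_comp RF v u)) co_comp -compcA (Hv sY sZ hY hZ).
  rewrite compcA (Hu sX sY hX hY) -compcA; apply: comp_heq; first exact: heq_refl.
  rewrite -ct_comp; apply: ct_heq; apply: heq_sym; exact: (co_comp shiftS).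
- move=> X Y u v vu uv Hu sY sX hY hX.
  have E := Hu sX sY hX hY.
  have E1 : co_map (shiftD B (- k)) (ct_map RF v) \oc
      co_map (shiftD B (- k)) (ct_map RF u) =~ idc _.
    rewrite -co_comp (co_heq _ (heq_sym (ct_comp RF u v))).
    by rewrite (co_heq _ (ct_heq RF uv)) (co_heq _ (ct_id RF _)) co_id.
  have E2 : ct_map RF (co_map shiftS u) \oc ct_map RF (co_map shiftS v) =~ idc _.
    rewrite -ct_comp (ct_heq RF (heq_sym (co_comp shiftS v u))).
    by rewrite (ct_heq RF (co_heq shiftS vu)) (ct_heq RF (co_id shiftS _)) ct_id.
  exact: square_inv E E2 E1.
move=> X Y f sX sY [R [pR [pRk [q [a [b [qq Ea Eb Es]]]]]]].
move=> [R' [pR' [pRk' [q' [a' [b' [qq' Ea' Eb' Es']]]]]]].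
have [R1 [h [g [pR1 qh hg]]]] := resolve_map hP (chain_comp f q)
  (ad_bounded hP pR) (proj2_sig Y) pR' qq'.
have pRk1 := tri_shift (ad_tri hP) k pR1.
have qq1 := qis_comp qq qh; set q1 := chain_comp q h in qq1.
have [a1 [Ea1 ia1]] := computes_exists RF pR1 qq1.
have [b1 [Eb1 ib1]] := computes_exists RF (X := shiftS X) pRk1 (shift_qis k qq1).
have Es1 := rd_shift_refine qq qq1 (homotopic_refl q1) Ea Ea1 Eb Eb1 Es.
have hg1 : homotopic (chain_comp f q1) (chain_comp q' g).
  by apply: homotopic_trans hg; apply: homotopic_eq => i; rewrite /= acompA.
have Na := computes_nat Ea1 Ea' qq1 hg1.
have hgk : homotopic (chain_comp (shift_chain f k) (shift_chain q1 k))
    (chain_comp (shift_chain q' k) (shift_chain g k)).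
  apply: homotopic_trans (homotopic_trans (shift_homotopic k hg1) _);
    exact: homotopic_eq.
have Nb := @computes_nat _ _ _ _ _ _ _ (shiftS X) (shiftS Y) _ _ _ _ _ _ _ _ _ _
  Eb1 Eb' (shift_qis k qq1) hgk.
have ib' : is_iso b'.
  have [b2 [Eb2 ib2]] := computes_exists RF (X := shiftS Y) pRk' (shift_qis k qq').
  apply: is_iso_heq ib2.
  have iq : @is_iso (Dstar s A) (pob hP pRk') (shiftS Y) (Dmap (shift_chain q' k)).
    exact: Dmap_iso (shift_qis k qq').
  by apply: (iso_cancell (ct_iso RF iq)); apply: heq_trans Eb2 (heq_sym Eb').
apply: (iso_cancelr ib').
rewrite -!compcA Es' -Nb compcA -co_comp -(co_heq _ Na) co_comp shiftD_map.
by rewrite -compcA -on_shift_nat !compcA Es1.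
Qed.

End DerivedShift.

(** * Reflexive objects *)

Section UnitAndFullness.
Variables (C D : category) (F : contrafunctor C D) (G : contrafunctor D C).
Variable a : right_adjoint_pair F G.

Lemma adj_adj_unit X : adj a (adj_unit a X) =~ idc (F X).
Proof. exact: adjVK. Qed.

Lemma adj_inj X Y (f g : hom X (G Y)) : adj a f =~ adj a g -> f =~ g.
Proof. by move=> E; rewrite -(adjK a f) -(adjK a g); apply: adjV_heq. Qed.

Lemma adj_unit_comp X Y (w : hom X Y) : adj a (adj_unit a Y \oc w) =~ ct_map F w.
Proof. by rewrite adj_natl adj_adj_unit compc1. Qed.

Lemma adj_unit_nat X Y (w : hom X Y) :
  adj_unit a Y \oc w =~ ct_map G (ct_map F w) \oc adj_unit a X.
Proof.
by apply: adj_inj; rewrite adj_unit_comp adj_natr adj_adj_unit comp1c.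
Qed.

(** The unit at [X] is an isomorphism exactly when [F] is bijective on the
    morphisms into [X], as [F] corresponds under the adjunction to composition
    with the unit. In this form reflexivity is visibly invariant under every
    autoequivalence that commutes with [F], such as the shift. *)
Definition full_towards X : Prop :=
  (forall W (h : hom (F X) (F W)), exists m : hom W X, ct_map F m =~ h) /\
  (forall W (m m' : hom W X), ct_map F m =~ ct_map F m' -> m =~ m').

Lemma unit_iso_full X : is_iso (adj_unit a X) -> full_towards X.
Proof.
move=> iX; split=> [W h|W m m' E].
  have [v [v1 v2]] := iX; exists (v \oc adjV a h).
  rewrite -adj_unit_comp; apply: heq_trans (adjVK a h); apply: adj_heq.
  by rewrite compcA v2 comp1c.
by apply: (iso_cancell iX); apply: adj_inj; rewrite !adj_unit_comp.
Qed.

Lemma full_unit_iso X : full_towards X -> is_iso (adj_unit a X).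
Proof.
case=> full faith; have [m Em] := full _ (adj a (idc (G (F X)))).
exists m; split.
  apply: faith; rewrite ct_comp Em ct_id -adj_natl.
  by apply: heq_trans (adj_heq a (comp1c _)) (adj_adj_unit X).
by apply: adj_inj; rewrite adj_unit_comp.
Qed.

End UnitAndFullness.

(** * Stalk complexes *)

Lemma cohomology_d0 (C : abelian) (Z : cplx C) i :
  (forall j k, cd Z j k = 0) -> @isomorphic (acat C) (Z i) (cohomology Z i).
Proof.
move=> d0; have c1 : cyc (aid (Z i)) by move=> j; rewrite d0 acomp0l.
exists (cls c1); apply: mono_epi_iso.
  apply: mono0 => U x; have cx : cyc (aid (Z i) \oa x) by apply: cyc_pre.
  rewrite (cls_pre c1 cx) => /cls_eq0[U' [p [j [w [ep Ew]]]]].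
  by apply: (epi_eq0 ep); rewrite -[x]acomp1l -Ew d0 acomp0l.
apply: epi0 => V g g0; apply: cohomology_ext => U z cz.
have cz' : cyc (aid (Z i) \oa z) by apply: cyc_pre.
rewrite acomp0l (cls_irr cz cz') ?acomp1l // -(cls_pre c1) acompA g0.
exact: acomp0l.
Qed.

(** The terms of a stalk complex are given by a test on the degree; keeping the
    test as a variable [b] avoids casts when a map into one is defined. *)
Definition to_stalk (C : abelian) (b : bool) (X K : C) (f : ahom X K) :
    ahom X (if b then K else azero) :=
  if b as b' return ahom X (if b' then K else azero) then f else 0.

Lemma to_stalk_comp0 (C : abelian) (b : bool) (U X K : C) (f : ahom X K)
    (z : ahom U X) : (b -> f \oa z = 0) -> to_stalk b f \oa z = 0.
Proof. by case: b => [/(_ isT)|_] //=; rewrite acomp0l. Qed.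

Lemma to_stalk_eq0 (C : abelian) (b : bool) (U X K : C) (f : ahom X K)
    (z : ahom U X) : b -> to_stalk b f \oa z = 0 -> f \oa z = 0.
Proof. by case: b. Qed.

Lemma to_stalk_epi (C : abelian) (b : bool) (X K : C) (f : ahom X K) :
  b -> epi f -> epi (to_stalk b f).
Proof. by case: b. Qed.

Definition stalk_map (C : abelian) (M N : C) (f : ahom M N) :
  chain (stalk M) (stalk N).
Proof.
exists (fun i : int => if (i == 0) as b return
    ahom (if b then M else azero) (if b then N else azero) then f else 0).
by move=> i j /=; rewrite acomp0l acomp0r.
Defined.

Lemma stalk_map_qis (C : abelian) (M N : C) (f : ahom M N) :
  @is_iso (acat C) _ _ f -> qis (stalk_map f).
Proof.
move=> fi; apply: term_iso_qis => i /=; case: (i == 0) => //.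
by apply: zero_iso; apply: azeroP.
Qed.

(** The canonical truncation of [Y] in degrees [<= m] is quasi-isomorphic to
    [Y], and it maps onto the cokernel of its last differential, which carries
    all the cohomology there is. *)
Lemma concentrated_stalk (C : abelian) (Y : cplx C) (m : int) :
  (forall i, i != m -> is_zero (cohomology Y i)) ->
  @isomorphic (Dcat C) Y (shift (stalk (cohomology Y m)) (- m)).
Proof.
move=> Y0; pose V := sub (tauP m) Y.
have qV : qis (sub_inc (tauP m) Y).
  move=> i; have [im|mi] := leP i m; first exact: tau_sub_coh_iso.
  by apply: coh_iso_zero; [apply: tau_sub_coh0 | apply: Y0; rewrite gt_eqF].
pose K := coker (cd V (m - 1) m); pose S := shift (stalk K) (- m).
have S_d0 j k : cd S j k = 0 by rewrite /= oppr0 if_same.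
pose f i : ahom (V i) (S i) :=
  to_stalk (i + - m == 0) (cproj (cd V (m - 1) m) \oa idd V i m).
have fP i j : cd S i j \oa f i = f j \oa cd V i j.
  rewrite S_d0 acomp0l; apply/esym/to_stalk_comp0 => /eqP jm.
  have {}jm : j = m by lia.
  subst j; rewrite idd_refl acomp1r.
  have [im|im] := eqVneq i (m - 1); first by rewrite im cproj0.
  have -> : cd V i m = 0 by apply: cd_shape; lia.
  by rewrite acomp0r.
have mm : m + - m == 0 by rewrite subrr.
have qf : qis (Chain fP).
  move=> i; have [im|im] := eqVneq i m; last first.
    apply: coh_iso_zero; first by apply/(coh_iso0 (qV i)); apply: Y0.
    apply: cohomology_term0; rewrite /=.
    by case: eqP => [?|_]; [lia | apply: azeroP].
  subst i; apply: coh_isoI => U z cz.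
    move=> [U' [p [j [w [ep]]]]]; rewrite S_d0 acomp0l -acompA => /esym.
    move=> /(to_stalk_eq0 mm); rewrite idd_refl acomp1r.
    move=> /coker_eq0_lift[U2 [p2 [x [ep2 Ex]]]].
    exists U2, (p \oa p2), (m - 1), x; split; first exact: epi_comp.
    by rewrite Ex !acompA.
  have [U' [p [x [ep Ex]]]] : exists (U' : C) (p : ahom U' U) (x : ahom U' (V m)),
      epi p /\ f m \oa x = z \oa p.
    apply: epi_pullback; apply: (to_stalk_epi mm).
    by rewrite idd_refl acomp1r; apply: cproj_is_epi.
  exists U', p, x; split=> //; last by rewrite /= Ex subrr; apply: bnd0.
  by apply: cyc_next; apply: zero_cod; apply: sub_term0; rewrite /tau_a; lia.
have [v [v1 v2]] := Dmap_iso qV.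
have iw : is_iso (Dmap (Chain fP) \oc v).
  by apply: is_iso_comp; [apply: Dmap_iso qf | apply: inv_iso v1 v2].
have [g ig] : @isomorphic (acat C) K (cohomology Y m).
  apply: isomorphic_trans (isomorphic_sym _); last first.
    by exists (HD_map m (Dmap (Chain fP) \oc v)); apply: (co_iso (HD C m) iw).
  have := @cohomology_d0 C S m S_d0; rewrite /= -/S.
  by rewrite subrr eqxx.
exists (Dmap (shift_chain (stalk_map g) (- m)) \oc (Dmap (Chain fP) \oc v)).
apply: is_iso_comp iw; apply: Dmap_iso; apply: shift_qis.
exact: stalk_map_qis.
Qed.
(** * The subcategory of reflexive complexes *)

Section Reflexivity.
Variables (A B : abelian) (s t : boundedness).
Variables (Phi : additive_contrafunctor A B) (Psi : additive_contrafunctor B A).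
Variables (P : cplx A -> Prop) (Q : cplx B -> Prop).
Variables (hP : adapted Phi s P) (hQ : adapted Psi t Q).
Variables (RPhi : right_derived hP) (RPsi : right_derived hQ).
Variables (RPhi_t : forall X : Dstar s A, bounded t (RPhi X)).
Variables (RPsi_s : forall Y : Dstar t B, bounded s (RPsi Y)).
Variable ahat : right_adjoint_pair (corestrict RPhi_t) (corestrict RPsi_s).

Let T : cofunctor (Dstar s A) (Dcat A) := comp_contra RPsi (corestrict RPhi_t).

(** [RPhi] exchanges the shifts by [k] and [-k], both of which are bijective on
    morphisms; so it is bijective on the morphisms into [X[k]] if it is on those
    into [X]. *)
Lemma reflexive_shift k (X : Dstar s A) :
  D_reflexive ahat X -> D_reflexive ahat (shiftS A s k X).
Proof.
move=> /unit_iso_full[full faith]; apply: full_unit_iso.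
have [sX [hX iX]] := rd_shift_exists RPhi k X.
have kl : - k + k = 0 by rewrite addNr.
have lift (W : Dstar s A) :
    exists (W' : Dstar s A) (z : hom (shiftS A s k W') W), is_iso z.
  exists (shiftS A s (- k) W), (Dmap (unshift (proj1_sig W) kl)).
  exact: (unshift_iso (proj1_sig W) kl).
split=> [W h|W m1 m2 E].
  have [W' [z [z' [z1 z2]]]] := lift W.
  have [sW [hW iW]] := rd_shift_exists RPhi k W'.
  have [sX' [sX1 sX2]] := iX.
  have [l El] := shiftD_full ((sW \oc (ct_map RPhi z \oc h)) \oc sX').
  have [m Em] := full W' l.
  exists (co_map (shiftS A s k) m \oc z').
  have E : ct_map RPhi (co_map (shiftS A s k) m) =~ ct_map RPhi z \oc h.
    apply: (iso_cancell iW); rewrite -(rd_shift_nat m hW hX).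
    by rewrite (co_heq (shiftD B (- k)) Em) El -!compcA sX1 compc1.
  apply: heq_trans (ct_comp RPhi _ _) _; rewrite E compcA -ct_comp.
  by rewrite (ct_heq RPhi z2) ct_id comp1c.
have [W' [z iz]] := lift W; have [sW [hW iW]] := rd_shift_exists RPhi k W'.
have [l1 El1] := shiftD_full (m1 \oc z); have [l2 El2] := shiftD_full (m2 \oc z).
have E1 : co_map (shiftS A s k) (l1 : @hom (Dstar s A) W' X) =~ m1 \oc z := El1.
have E2 : co_map (shiftS A s k) (l2 : @hom (Dstar s A) W' X) =~ m2 \oc z := El2.
apply: (iso_cancelr iz); apply: heq_trans (heq_sym El1) (heq_trans _ El2).
apply: co_heq; apply: faith; apply: (@shiftD_faithful B (- k)).
apply: (iso_cancelr iX).
rewrite (rd_shift_nat l1 hW hX) (rd_shift_nat l2 hW hX).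
apply: comp_heq; first exact: heq_refl.
rewrite (ct_heq RPhi E1) (ct_heq RPhi E2) !ct_comp.
by apply: comp_heq; [exact: heq_refl | exact: E].
Qed.

Definition eta (X : Dstar s A) : @hom (Dcat A) (proj1_sig X) (T X) :=
  adj_unit ahat X.

Lemma eta_nat (X Y : Dstar s A) (w : hom X Y) :
  eta Y \oc (w : @hom (Dcat A) (proj1_sig X) (proj1_sig Y)) =~
  co_map T w \oc eta X.
Proof. exact: (adj_unit_nat ahat w). Qed.

Definition eta_iso_at i (X : Dstar s A) : Prop :=
  @is_iso (acat A) _ _ (HD_map i (eta X)).

Lemma reflexiveP X : D_reflexive ahat X <-> forall i, eta_iso_at i X.
Proof.
split=> [H i|H]; first exact: (co_iso (HD A i) H).
exact: (Diso_coh H).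
Qed.

Lemma eta_iso_at_iso i (X Y : Dstar s A) (w : hom X Y) :
  is_iso w -> eta_iso_at i X <-> eta_iso_at i Y.
Proof.
move=> iw; have E := HD_weq i (eta_nat w).
have i1 : is_iso (co_map (HD A i) w) := co_iso (HD A i) iw.
have i2 : is_iso (co_map (HD A i) (co_map T w)).
  by apply: co_iso; apply: co_iso.
split=> H.
  apply: (is_iso_left i1).
  exact: (@is_iso_heq (acat A) _ _ _ _ (esym E) (is_iso_comp i2 H)).
apply: (is_iso_right i2).
exact: (@is_iso_heq (acat A) _ _ _ _ E (is_iso_comp H i1)).
Qed.

Lemma eta_iso_at_qis i (X Y : cplx A) (bX : bounded s X) (bY : bounded s Y)
    (f : chain X Y) :
  qis f -> eta_iso_at i (dob bX) <-> eta_iso_at i (dob bY).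
Proof.
move=> qf; apply: (@eta_iso_at_iso i (dob bX) (dob bY) (Dmap f)).
exact: Dmap_iso.
Qed.

Lemma reflexive_iso (X Y : Dstar s A) (w : hom X Y) :
  is_iso w -> D_reflexive ahat X <-> D_reflexive ahat Y.
Proof.
by move=> iw; rewrite !reflexiveP; split=> H i; apply/(eta_iso_at_iso i iw).
Qed.

(** ** The unit on triangles *)

Lemma exact_mono (X Y Z Z' : A) (f : ahom X Y) (g : ahom Y Z) (h : ahom Z Z') :
  mono h -> exact_pair f (h \oa g) -> exact_pair f g.
Proof.
move=> mh [gf0 H]; split=> [|T' y gy0].
  by apply: (mono_eq0 mh); rewrite acompA.
by apply: H; rewrite -acompA gy0 acomp0r.
Qed.

Lemma cone_rot_exact (X Y : cplx A) (f : chain X Y) i :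
  exact_pair (cohomology_map (cone_in f) i)
             (cohomology_map (cone_in (cone_in f)) i).
Proof.
apply: (exact_mono (iso_mono (cone_rot_qis f i))).
rewrite -cohomology_map_comp.
rewrite (@homotopic_cohomology _ _ _ _ (cone_out f)); first exact: cone_exact_mid.
by apply: homotopic_eq => j; apply: cone_rot_in.
Qed.

(** [RPhi] turns the triangle around and [RPsi] turns it back. *)
Lemma T_cone_rot_exact (X Y : cplx A) (f : chain X Y) i (bX : bounded s X)
    (bY : bounded s Y) (bC : bounded s (cone f))
    (bD : bounded s (cone (cone_in f))) :
  exact_pair (HD_map i (co_map T (Dmap (cone_in f) : hom (dob bY) (dob bC))))
    (HD_map i (co_map T (Dmap (cone_in (cone_in f)) : hom (dob bC) (dob bD)))).
Proof.
have bS := shift_bounded 1 bX.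
have [V [E [u H]]] := rd_triangle RPhi bX bY bC bS.
pose FY : Dstar t B := corestrict RPhi_t (dob bY).
pose FC : Dstar t B := corestrict RPhi_t (dob bC).
pose FS : Dstar t B := corestrict RPhi_t (dob bS).
have ex := @rd_exact _ _ _ _ _ _ RPsi FS FC FY
  (ct_map RPhi (Dmap (cone_out f) : hom (dob bC) (dob bS)))
  (ct_map RPhi (Dmap (cone_in f) : hom (dob bY) (dob bC))) V E u i H.
have ir : @is_iso (Dstar s A) (dob bD) (dob bS) (Dmap (cone_rot f)).
  by apply: Dmap_iso; apply: cone_rot_qis.
apply: (exact_mono (iso_mono (co_iso (HD A i) (co_iso T ir)))).
have E1 : co_map T (Dmap (cone_rot f) : hom (dob bD) (dob bS)) \oc
    co_map T (Dmap (cone_in (cone_in f)) : hom (dob bC) (dob bD)) =~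
    co_map T (Dmap (cone_out f) : hom (dob bC) (dob bS)).
  rewrite -co_comp; apply: co_heq.
  apply: (@heq_trans (Dcat A) _ _ _ _ _ (heq_sym (Dmap_comp _ _))).
  by apply: Dmap_eq => j; apply: cone_rot_in.
have E2 := HD_weq i E1.
by move: E2 => /= ->.
Qed.

(** The five lemma along [Y -> C0 -> C1 -> C2 -> C3], each [C] being the cone of
    the preceding map. Up to quasi-isomorphism [C1], [C2] and [C3] are [X[1]],
    [Y[1]] and [(cone f)[1]]; the inclusions into the cones being chain maps,
    naturality of the unit makes every square commute. *)
Lemma eta_iso_at_rot (X Y : cplx A) (f : chain X Y) i (bX : bounded s X)
    (bY : bounded s Y) (bC : bounded s (cone f)) (bX1 : bounded s (shift X 1))
    (bY1 : bounded s (shift Y 1)) (bC1 : bounded s (shift (cone f) 1)) :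
  eta_iso_at i (dob bY) -> eta_iso_at i (dob bC) ->
  eta_iso_at i (dob bY1) -> eta_iso_at i (dob bC1) ->
  eta_iso_at i (dob bX1).
Proof.
move=> hY h0 hY1 hC1.
pose i0 := cone_in f; pose i1 := cone_in i0; pose i2 := cone_in i1.
pose i3 := cone_in i2.
have b1 : bounded s (cone i0) by apply: cone_bounded.
have b2 : bounded s (cone i1) by apply: cone_bounded.
have b3 : bounded s (cone i2) by apply: cone_bounded.
have h2 : eta_iso_at i (dob b2).
  by apply/(eta_iso_at_qis i b2 bY1 (cone_rot_qis i0)).
have h3 : eta_iso_at i (dob b3).
  by apply/(eta_iso_at_qis i b3 bC1 (cone_rot_qis i1)).
apply/(eta_iso_at_qis i b1 bX1 (cone_rot_qis f)).
have N0 := HD_weq i (@eta_nat (dob bY) (dob bC) (Dmap i0)).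
have N1 := HD_weq i (@eta_nat (dob bC) (dob b1) (Dmap i1)).
have N2 := HD_weq i (@eta_nat (dob b1) (dob b2) (Dmap i2)).
have N3 := HD_weq i (@eta_nat (dob b2) (dob b3) (Dmap i3)).
have [] := five_lemma (cone_rot_exact f i) (cone_rot_exact i0 i)
  (cone_rot_exact i1 i) (T_cone_rot_exact i bX bY bC b1)
  (T_cone_rot_exact i bY bC b1 b2) (T_cone_rot_exact i bC b1 b2 b3)
  N0 N1 N2 N3 (iso_epi hY) (iso_mono h0) (iso_epi h0) (iso_mono h2)
  (iso_epi h2) (iso_mono h3).
exact: mono_epi_iso.
Qed.

Lemma shift_ses (V X W : cplx A) (f : chain V X) (g : chain X W) k :
  short_exact f g -> short_exact (shift_chain f k) (shift_chain g k).
Proof. by move=> H i; apply: H. Qed.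

(** The previous lemma concerns [X[1]]; it is applied to the sequence shifted by
    [-1] and rotated to [X[-1] -> cone], where the cone stands for [W[-1]]. *)
Lemma ses_eta_iso_at (V X W : cplx A) (f : chain V X) (g : chain X W) i
    (bV : bounded s V) (bX : bounded s X) (bW : bounded s W)
    (bW' : bounded s (shift W (- 1))) (bV1 : bounded s (shift V 1)) :
  short_exact f g -> eta_iso_at i (dob bW') -> eta_iso_at i (dob bV) ->
  eta_iso_at i (dob bW) -> eta_iso_at i (dob bV1) -> eta_iso_at i (dob bX).
Proof.
move=> fg hW' hV hW hV1.
pose f' := shift_chain f (- 1); pose g' := shift_chain g (- 1).
have fg' : short_exact f' g' := shift_ses (- 1) fg.
have gf0 j : g' j \oa f' j = 0 by have [] := fg' j.
have bV' := shift_bounded (- 1) bV; have bX' := shift_bounded (- 1) bX.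
have bC := cone_bounded f' bV' bX'; have bD := cone_bounded (cone_in f') bX' bC.
have k1 : (- 1 + 1 : int) = 0 by rewrite addNr.
have uns (Z : cplx A) (b : bounded s Z) b' :
    eta_iso_at i (@dob _ s (shift (shift Z (- 1)) 1) b') <-> eta_iso_at i (dob b).
  by apply: (@eta_iso_at_iso i (dob b') (dob b) _ (unshift_iso Z k1)).
have qd := ses_cone_qis gf0 fg'.
apply/(uns _ _ (shift_bounded 1 bX')).
apply: (@eta_iso_at_rot _ _ (cone_in f') i bX' bC bD _
  (shift_bounded 1 bC) (shift_bounded 1 bD)).
- exact/(eta_iso_at_qis i bC bW' qd).
- apply/(eta_iso_at_qis i bD (shift_bounded 1 bV') (cone_rot_qis f')).
  exact/uns.
- apply/(eta_iso_at_qis i _ (shift_bounded 1 bW') (shift_qis 1 qd)).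
  exact/uns.
- apply/(eta_iso_at_qis i _ (shift_bounded 1 (shift_bounded 1 bV'))
    (shift_qis 1 (cone_rot_qis f'))).
  exact/(eta_iso_at_qis i _ bV1 (shift_qis 1 (iso_qis (unshift_iso V k1)))).
Qed.

Lemma ses_reflexive (V X W : cplx A) (f : chain V X) (g : chain X W)
    (bV : bounded s V) (bX : bounded s X) (bW : bounded s W) :
  short_exact f g -> D_reflexive ahat (dob bV) -> D_reflexive ahat (dob bW) ->
  D_reflexive ahat (dob bX).
Proof.
move=> fg rV rW; apply/reflexiveP => i.
have rV1 := reflexive_shift 1 rV; have rW1 := reflexive_shift (- 1) rW.
exact: (@ses_eta_iso_at V X W f g i bV bX bW (shift_bounded (- 1) bW)
  (shift_bounded 1 bV) fg (proj1 (reflexiveP _) rW1 i)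
  (proj1 (reflexiveP _) rV i) (proj1 (reflexiveP _) rW i)
  (proj1 (reflexiveP _) rV1 i)).
Qed.

(** ** Complexes on which both functors vanish in a degree *)

Definition vanish_at i (X : Dstar s A) : Prop :=
  is_zero (cohomology (proj1_sig X) i) /\ is_zero (cohomology (T X) i).

Lemma vanish_eta_iso_at i X : vanish_at i X -> eta_iso_at i X.
Proof. by case; apply: zero_iso. Qed.

Lemma T_shift_cohomology0 (X : Dstar s A) k i :
  is_zero (cohomology (T (shiftS A s k X)) i) <-> is_zero (cohomology (T X) (i + k)).
Proof.
have [sg [_ isg]] := rd_shift_exists RPhi k X.
pose FX : Dstar t B := corestrict RPhi_t X.
have isg' : @is_iso (Dstar t B) (corestrict RPhi_t (shiftS A s k X))
  (shiftS B t (- k) FX) sg := isg.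
have [tau [_ itau]] := rd_shift_exists RPsi (- k) FX.
rewrite -(Diso_cohomology0 i (ct_iso RPsi isg')).
rewrite (Diso_cohomology0 i itau) shift_cohomology0 opprK.
by [].
Qed.

Lemma vanish_at_shift i k (X : Dstar s A) :
  vanish_at i (shiftS A s k X) <-> vanish_at (i + k) X.
Proof. by rewrite /vanish_at T_shift_cohomology0 /= shift_cohomology0. Qed.

Lemma acyclic_rd (C D : abelian) (F : additive_contrafunctor C D) s'
    (P' : cplx C -> Prop) (h : adapted F s' P') (RF : right_derived h)
    (X : Dstar s' C) :
  exact_cplx (proj1_sig X) -> exact_cplx (RF X : cplx D).
Proof.
move=> X0 i; have [R [q [pR qq]]] := ad_resolve h (proj2_sig X).
have [a [_ ia]] := computes_exists RF pR qq.
apply/(Diso_cohomology0 i ia); apply: (ad_exact h pR) => j.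
by apply/(coh_iso0 (qq j)).
Qed.

Lemma acyclic_reflexive (X : Dstar s A) :
  exact_cplx (proj1_sig X) -> D_reflexive ahat X.
Proof.
move=> X0; apply/reflexiveP => i; apply: vanish_eta_iso_at; split=> //.
apply: (@acyclic_rd _ _ _ _ _ _ RPsi (corestrict RPhi_t X)).
exact: (@acyclic_rd _ _ _ _ _ _ RPhi X).
Qed.

(** * Way-out arguments *)

Lemma reflexive_stalk_iso (M N : A) :
  @isomorphic (acat A) M N -> D_reflexive_obj ahat M -> D_reflexive_obj ahat N.
Proof.
case=> f fi; rewrite /D_reflexive_obj.
have iw : @is_iso (Dstar s A) (dob (bounded_stalk s M))
    (dob (bounded_stalk s N)) (Dmap (stalk_map f)) by apply: Dmap_iso; apply: stalk_map_qis.
by move=> H; apply/(reflexive_iso iw).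
Qed.

Lemma reflexive_zero (M : A) : is_zero M -> D_reflexive_obj ahat M.
Proof.
move=> M0; apply: acyclic_reflexive => i; apply: cohomology_term0 => /=.
by case: (i == 0); rewrite // /is_zero azeroP.
Qed.

Definition coh_reflexive (X : cplx A) : Prop :=
  forall i, D_reflexive_obj ahat (cohomology X i).

Definition term_reflexive (X : cplx A) : Prop :=
  forall i, D_reflexive_obj ahat (X i).

Lemma tau_sub_coh_reflexive m (X : cplx A) :
  coh_reflexive X -> coh_reflexive (sub (tauP m) X).
Proof.
move=> H i; have [im|mi] := leP i m; last first.
  by apply: reflexive_zero; apply: tau_sub_coh0.
apply: (reflexive_stalk_iso _ (H i)); apply: isomorphic_sym.
by exists (cohomology_map (sub_inc (tauP m) X) i); apply: tau_sub_coh_iso.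
Qed.

Lemma tau_quo_coh_reflexive m (X : cplx A) :
  coh_reflexive X -> coh_reflexive (quo (tauP m) X).
Proof.
move=> H i; have [im|mi] := leP i m.
  by apply: reflexive_zero; apply: tau_quo_coh0.
apply: (reflexive_stalk_iso _ (H i)).
by exists (cohomology_map (quo_proj (tauP m) X) i); apply: tau_quo_coh_iso.
Qed.

Lemma brutal_sub_term_reflexive m (X : cplx A) :
  term_reflexive X -> term_reflexive (sub (brutalP m) X).
Proof.
move=> H i; have [im|mi] := leP i m.
  by apply: reflexive_zero; apply: sub_term0.
apply: (reflexive_stalk_iso _ (H i)); apply: isomorphic_sym.
exists (sub_inc (brutalP m) X i); apply: sub_term_iso => //.
by rewrite /brutal_a -ltNge.
Qed.

Lemma brutal_quo_term_reflexive m (X : cplx A) :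
  term_reflexive X -> term_reflexive (quo (brutalP m) X).
Proof.
move=> H i; have [im|mi] := leP i m; last first.
  by apply: reflexive_zero; apply: quo_term0; rewrite // /brutal_a -ltNge.
apply: (reflexive_stalk_iso _ (H i)).
by exists (quo_proj (brutalP m) X i); apply: quo_term_iso.
Qed.

Lemma concentrated_reflexive m (Y : cplx A) (bY : bounded s Y) :
  (forall i, i != m -> is_zero (cohomology Y i)) ->
  D_reflexive_obj ahat (cohomology Y m) -> D_reflexive ahat (dob bY).
Proof.
move=> /concentrated_stalk[w iw] /(reflexive_shift (- m)).
by apply: (proj2 (@reflexive_iso (dob bY) (shiftS A s (- m)
  (dob (bounded_stalk s (cohomology Y m)))) w iw)).
Qed.

(** Induction on the number of degrees in which there is cohomology: the lowest
    one is split off by canonical truncation. *)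
Lemma finite_coh_reflexive (N : nat) (m : int) (Y : cplx A) (bY : bounded s Y) :
  (forall i, i < m \/ m + N%:Z <= i -> is_zero (cohomology Y i)) ->
  coh_reflexive Y -> D_reflexive ahat (dob bY).
Proof.
elim: N m Y bY => [|N IH] m Y bY Y0 rY.
  by apply: acyclic_reflexive => i; apply: Y0; lia.
apply: (@ses_reflexive _ _ _ _ _ (sub_bounded (tauP m) bY) bY
  (quo_bounded (tauP m) bY) (sub_quo_ses (tauP m) Y)).
  apply: (@concentrated_reflexive m); last exact: tau_sub_coh_reflexive.
  move=> i im; have [mi|im'] := ltP m i; first exact: tau_sub_coh0.
  apply/(coh_iso0 (tau_sub_coh_iso (tauP m) Y im')); apply: Y0.
  by left; rewrite lt_neqAle im.
apply: (IH (m + 1)); last exact: tau_quo_coh_reflexive.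
move=> i Hi; have [im|mi] := leP i m; first exact: tau_quo_coh0.
apply/(coh_iso0 (tau_quo_coh_iso (tauP m) Y mi)); apply: Y0.
by right; lia.
Qed.

(** The same induction on the number of nonzero terms, with brutal
    truncation. *)
Lemma finite_term_reflexive (N : nat) (m : int) (Y : cplx A) (bY : bounded s Y) :
  (forall i, i < m \/ m + N%:Z <= i -> is_zero (Y i)) ->
  term_reflexive Y -> D_reflexive ahat (dob bY).
Proof.
elim: N m Y bY => [|N IH] m Y bY Y0 rY.
  by apply: acyclic_reflexive => i; apply: cohomology_term0; apply: Y0; lia.
apply: (@ses_reflexive _ _ _ _ _ (sub_bounded (brutalP m) bY) bY
  (quo_bounded (brutalP m) bY) (sub_quo_ses (brutalP m) Y)).
  apply: (IH (m + 1)); last exact: brutal_sub_term_reflexive.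
  move=> i Hi; have [im|mi] := leP i m; first exact: sub_term0.
  apply: sub_term_zero; apply: Y0.
  by case: Hi => Hi; lia.
have W0 i : i != m -> is_zero (quo (brutalP m) Y i).
  move=> im; have [mi|im'] := ltP m i.
    by apply: quo_term0; rewrite // /brutal_a -ltNge.
  by apply: quo_term_zero; apply: Y0; left; rewrite lt_neqAle im.
apply: (@concentrated_reflexive m).
  by move=> i im; apply: cohomology_term0; apply: W0.
apply: reflexive_stalk_iso (brutal_quo_term_reflexive m rY m).
apply: cohomology_d0 => j k; have [jm|jm] := eqVneq j m; last first.
  by apply: zero_dom; apply: W0.
have [km|km] := eqVneq k m; last by apply: zero_cod; apply: W0.
by apply: cd_shape; lia.
Qed.

Lemma bounded_coh_reflexive (X : cplx A) (bX : bounded s X) m M :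
  coh_ge m X -> coh_le M X -> coh_reflexive X -> D_reflexive ahat (dob bX).
Proof.
move=> gX lX rX.
apply: (@finite_coh_reflexive (absz (M + 1 - m)%R) m) => // i Hi.
have [im|mi] := ltP i m; first exact: gX.
by apply: lX; lia.
Qed.

Lemma bounded_term_reflexive (X : cplx A) (bX : bounded s X) m M :
  (forall i, i < m -> is_zero (X i)) -> (forall i, M < i -> is_zero (X i)) ->
  term_reflexive X -> D_reflexive ahat (dob bX).
Proof.
move=> gX lX rX.
apply: (@finite_term_reflexive (absz (M + 1 - m)%R) m) => // i Hi.
have [im|mi] := ltP i m; first exact: gX.
by apply: lX; lia.
Qed.

(** A way-out bound for [T] on complexes with cohomology in degrees [<= 0]
    shifts to all complexes bounded above; the maximum with [0] lets the same
    bound serve for the complex itself. *)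
Lemma way_out_left_vanish : way_out_left T ->
  exists N : int, forall (k : int) (X : Dstar s A),
    coh_le k (proj1_sig X) -> forall i, k + N < i -> vanish_at i X.
Proof.
case=> n H; exists (Num.max n 0) => k X kX i Ni.
have [Nn N0] : n <= Num.max n 0 /\ 0 <= Num.max n 0.
  by rewrite !le_max !lexx orbT.
split; first by apply: kX; lia.
have H0 : coh_le 0 (proj1_sig (shiftS A s k X)).
  by move=> j j0; apply/shift_cohomology0; apply: kX; lia.
have /T_shift_cohomology0 :
    is_zero (cohomology (T (shiftS A s k X)) (i - k)) by apply: H H0 _ _; lia.
by rewrite subrK.
Qed.

Lemma way_out_right_vanish : way_out_right T ->
  exists N : int, forall (k : int) (X : Dstar s A),
    coh_ge k (proj1_sig X) -> forall i, i < k + N -> vanish_at i X.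
Proof.
case=> n H; exists (Num.min n 0) => k X kX i Ni.
have [Nn N0] : Num.min n 0 <= n /\ Num.min n 0 <= 0.
  by rewrite !ge_min !lexx orbT.
split; first by apply: kX; lia.
have H0 : coh_ge 0 (proj1_sig (shiftS A s k X)).
  by move=> j j0; apply/shift_cohomology0; apply: kX; lia.
have /T_shift_cohomology0 :
    is_zero (cohomology (T (shiftS A s k X)) (i - k)) by apply: H H0 _ _; lia.
by rewrite subrK.
Qed.

(** Vanishing in the degrees [i] and [i - 1] settles what [ses_eta_iso_at] asks
    of [W] and of [W[-1]]. *)
Lemma ses_vanish_right (V X W : cplx A) (f : chain V X) (g : chain X W) i
    (bV : bounded s V) (bX : bounded s X) (bW : bounded s W) :
  short_exact f g -> D_reflexive ahat (dob bV) -> vanish_at i (dob bW) ->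
  vanish_at (i - 1) (dob bW) -> eta_iso_at i (dob bX).
Proof.
move=> fg rV v0 v1; have rV1 := reflexive_shift 1 rV.
apply: (@ses_eta_iso_at V X W f g i bV bX bW (shift_bounded (- 1) bW)
  (shift_bounded 1 bV) fg).
- by apply: vanish_eta_iso_at; apply: (proj2 (@vanish_at_shift i (- 1) (dob bW))).
- exact: (proj1 (reflexiveP _) rV i).
- exact: vanish_eta_iso_at.
- exact: (proj1 (reflexiveP _) rV1 i).
Qed.

Lemma ses_vanish_left (V X W : cplx A) (f : chain V X) (g : chain X W) i
    (bV : bounded s V) (bX : bounded s X) (bW : bounded s W) :
  short_exact f g -> D_reflexive ahat (dob bW) -> vanish_at i (dob bV) ->
  vanish_at (i + 1) (dob bV) -> eta_iso_at i (dob bX).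
Proof.
move=> fg rW v0 v1; have rW1 := reflexive_shift (- 1) rW.
apply: (@ses_eta_iso_at V X W f g i bV bX bW (shift_bounded (- 1) bW)
  (shift_bounded 1 bV) fg).
- exact: (proj1 (reflexiveP _) rW1 i).
- exact: vanish_eta_iso_at.
- exact: (proj1 (reflexiveP _) rW i).
- by apply: vanish_eta_iso_at; apply: (proj2 (@vanish_at_shift i 1 (dob bV))).
Qed.

Lemma brutal_sub_coh_ge m (X : cplx A) : coh_ge (m + 1) (sub (brutalP m) X).
Proof.
move=> i im; apply: cohomology_term0; apply: sub_term0.
by rewrite /brutal_a; lia.
Qed.

Lemma brutal_quo_coh_le m (X : cplx A) : coh_le m (quo (brutalP m) X).
Proof.
move=> i im; apply: cohomology_term0; apply: quo_term0 => //.
by rewrite /brutal_a -ltNge.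
Qed.

Lemma tau_sub_coh_le m (X : cplx A) : coh_le m (sub (tauP m) X).
Proof. by move=> i; apply: tau_sub_coh0. Qed.

Lemma tau_quo_coh_ge m (X : cplx A) : coh_ge (m + 1) (quo (tauP m) X).
Proof. by move=> i im; apply: tau_quo_coh0; lia. Qed.

Lemma tau_sub_coh_ge m n (X : cplx A) : coh_ge n X -> coh_ge n (sub (tauP m) X).
Proof.
move=> H i im; have [h|h] := leP i m; last exact: tau_sub_coh0.
by apply/(coh_iso0 (tau_sub_coh_iso (tauP m) X h)); apply: H.
Qed.

Lemma tau_quo_coh_le m n (X : cplx A) : coh_le n X -> coh_le n (quo (tauP m) X).
Proof.
move=> H i im; have [h|h] := leP i m; first exact: tau_quo_coh0.
by apply/(coh_iso0 (tau_quo_coh_iso (tauP m) X h)); apply: H.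
Qed.

(** The degree [k] of the cut is chosen so that the infinite piece vanishes at
    [i] and at the neighbouring degree that enters the five lemma; the same
    choice serves for canonical truncation and, mirrored, for way-out right
    functors. *)
Lemma way_out_left_terms (X : cplx A) (bX : bounded s X) M :
  way_out_left T -> (forall i, M < i -> is_zero (X i)) -> term_reflexive X ->
  D_reflexive ahat (dob bX).
Proof.
move=> /way_out_left_vanish[N HN] XM rX; apply/reflexiveP => i.
pose k := i - N - 2%:Z.
pose bW := quo_bounded (brutalP k) bX.
have W0 j : k + N < j -> vanish_at j (dob bW).
  by apply: HN; apply: brutal_quo_coh_le.
apply: (@ses_vanish_right _ _ _ _ _ i (sub_bounded (brutalP k) bX) bX
  (quo_bounded (brutalP k) bX) (sub_quo_ses (brutalP k) X));
  [|by apply: W0; lia..].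
apply: (@bounded_term_reflexive _ _ (k + 1) M).
- by move=> j jk; apply: sub_term0; rewrite /brutal_a; lia.
- by move=> j /XM; apply: sub_term_zero.
- exact: brutal_sub_term_reflexive.
Qed.

Lemma way_out_left_coh (X : cplx A) (bX : bounded s X) M :
  way_out_left T -> coh_le M X -> coh_reflexive X -> D_reflexive ahat (dob bX).
Proof.
move=> /way_out_left_vanish[N HN] XM rX; apply/reflexiveP => i.
pose k := i - N - 2%:Z.
pose bV := sub_bounded (tauP k) bX.
have V0 j : k + N < j -> vanish_at j (dob bV).
  by apply: HN; apply: tau_sub_coh_le.
apply: (@ses_vanish_left _ _ _ _ _ i (sub_bounded (tauP k) bX) bX
  (quo_bounded (tauP k) bX) (sub_quo_ses (tauP k) X));
  [|by apply: V0; lia..].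
apply: (@bounded_coh_reflexive _ _ (k + 1) M).
- exact: tau_quo_coh_ge.
- exact: tau_quo_coh_le.
- exact: tau_quo_coh_reflexive.
Qed.

Lemma way_out_right_terms (X : cplx A) (bX : bounded s X) m :
  way_out_right T -> (forall i, i < m -> is_zero (X i)) -> term_reflexive X ->
  D_reflexive ahat (dob bX).
Proof.
move=> /way_out_right_vanish[N HN] Xm rX; apply/reflexiveP => i.
pose k := i - N + 1.
pose bV := sub_bounded (brutalP k) bX.
have V0 j : j < k + 1 + N -> vanish_at j (dob bV).
  by apply: HN; apply: brutal_sub_coh_ge.
apply: (@ses_vanish_left _ _ _ _ _ i (sub_bounded (brutalP k) bX) bX
  (quo_bounded (brutalP k) bX) (sub_quo_ses (brutalP k) X));
  [|by apply: V0; lia..].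
apply: (@bounded_term_reflexive _ _ m k).
- by move=> j /Xm; apply: quo_term_zero.
- by move=> j jk; apply: quo_term0; rewrite // /brutal_a -ltNge.
- exact: brutal_quo_term_reflexive.
Qed.

Lemma way_out_right_coh (X : cplx A) (bX : bounded s X) m :
  way_out_right T -> coh_ge m X -> coh_reflexive X -> D_reflexive ahat (dob bX).
Proof.
move=> /way_out_right_vanish[N HN] Xm rX; apply/reflexiveP => i.
pose k := i - N + 1.
pose bW := quo_bounded (tauP k) bX.
have W0 j : j < k + 1 + N -> vanish_at j (dob bW).
  by apply: HN; apply: tau_quo_coh_ge.
apply: (@ses_vanish_right _ _ _ _ _ i (sub_bounded (tauP k) bX) bX
  (quo_bounded (tauP k) bX) (sub_quo_ses (tauP k) X));
  [|by apply: W0; lia..].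
apply: (@bounded_coh_reflexive _ _ m k).
- exact: tau_sub_coh_ge.
- exact: tau_sub_coh_le.
- exact: tau_sub_coh_reflexive.
Qed.

Lemma way_out_both_terms (X : cplx A) (bX : bounded s X) :
  way_out_left T -> way_out_right T -> term_reflexive X ->
  D_reflexive ahat (dob bX).
Proof.
move=> wl wr rX.
apply: (@ses_reflexive _ _ _ _ _ (sub_bounded (brutalP 0) bX) bX
  (quo_bounded (brutalP 0) bX) (sub_quo_ses (brutalP 0) X)).
  apply: (@way_out_right_terms _ _ 1) => //; last exact: brutal_sub_term_reflexive.
  by move=> j jk; apply: sub_term0; rewrite /brutal_a; lia.
apply: (@way_out_left_terms _ _ 0) => //; last exact: brutal_quo_term_reflexive.
by move=> j jk; apply: quo_term0; rewrite // /brutal_a -ltNge.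
Qed.

Lemma way_out_both_coh (X : cplx A) (bX : bounded s X) :
  way_out_left T -> way_out_right T -> coh_reflexive X ->
  D_reflexive ahat (dob bX).
Proof.
move=> wl wr rX.
apply: (@ses_reflexive _ _ _ _ _ (sub_bounded (tauP 0) bX) bX
  (quo_bounded (tauP 0) bX) (sub_quo_ses (tauP 0) X)).
  apply: (@way_out_left_coh _ _ 0) => //; first exact: tau_sub_coh_le.
  exact: tau_sub_coh_reflexive.
apply: (@way_out_right_coh _ _ (0 + 1)) => //; first exact: tau_quo_coh_ge.
exact: tau_quo_coh_reflexive.
Qed.

End Reflexivity.

Theorem theorem3p1
    (A B : abelian) (s t : boundedness)
    (Phi : additive_contrafunctor A B) (Psi : additive_contrafunctor B A)
    (Phi_nz : nonzero_functor Phi) (Psi_nz : nonzero_functor Psi)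
    (a : right_adjoint_pair Phi Psi)
    (P : cplx A -> Prop) (Q : cplx B -> Prop)
    (hP : adapted Phi s P) (hQ : adapted Psi t Q)
    (RPhi : right_derived hP) (RPsi : right_derived hQ)
    (RPhi_t : forall X : Dstar s A, bounded t (RPhi X))
    (RPsi_s : forall Y : Dstar t B, bounded s (RPsi Y))
    (ahat : right_adjoint_pair (corestrict RPhi_t) (corestrict RPsi_s))
    (ahat_induced : induced_by a ahat)
    (X : Dstar s A) :
  let cX : cplx A := proj1_sig X in
  let RPsiRPhi : cofunctor (Dstar s A) (Dcat A) :=
    comp_contra RPsi (corestrict RPhi_t) in
  let terms_reflexive := forall i : int, D_reflexive_obj ahat (cX i) in
  let cohomology_reflexive :=
    forall i : int, D_reflexive_obj ahat (cohomology cX i) in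
  (bounded Bounded cX -> terms_reflexive -> D_reflexive ahat X) /\
  (in_D Bounded cX -> cohomology_reflexive -> D_reflexive ahat X) /\
  (way_out_left RPsiRPhi ->
    (bounded BoundedAbove cX -> terms_reflexive -> D_reflexive ahat X) /\
    (in_D BoundedAbove cX -> cohomology_reflexive -> D_reflexive ahat X)) /\
  (way_out_right RPsiRPhi ->
    (bounded BoundedBelow cX -> terms_reflexive -> D_reflexive ahat X) /\
    (in_D BoundedBelow cX -> cohomology_reflexive -> D_reflexive ahat X)) /\
  (way_out_left RPsiRPhi -> way_out_right RPsiRPhi ->
    (terms_reflexive -> D_reflexive ahat X) /\
    (cohomology_reflexive -> D_reflexive ahat X)).
Proof.
move: X => [X bX] cX RPsiRPhi terms_reflexive cohomology_reflexive.
split.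
  move=> [[m Hm] [M HM]] rX.
  exact: (bounded_term_reflexive bX Hm HM rX).
split.
  move=> /in_D_coh_bounded[m [M [gX lX]]] rX.
  exact: (bounded_coh_reflexive bX (gX isT) (lX isT) rX).
split.
  move=> wl; split; first by move=> [M HM] rX; apply: way_out_left_terms HM rX.
  move=> /in_D_coh_bounded[m [M [_ lX]]] rX.
  exact: way_out_left_coh (lX isT) rX.
split.
  move=> wr; split; first by move=> [m Hm] rX; apply: way_out_right_terms Hm rX.
  move=> /in_D_coh_bounded[m [M [gX _]]] rX.
  exact: way_out_right_coh (gX isT) rX.
move=> wl wr; split=> rX; first exact: way_out_both_terms.
exact: way_out_both_coh.
Qed.
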